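(* Let $\mathcal{Q}=(M,\mathcal{G},\nabla,S,d)$ be a flat logarithmic quantum differential system on $M=\mathbb{C}$, so that in the basis $\omega=(\omega_0,\dots,\omega_{\mu-1})$ the connection $\nabla$ has matrix $$\tau M_1(x)\frac{dx}{x}+(N_0(x)+N_1(x)\tau)\frac{d\tau}{\tau}.$$ 1. There exists a matrix $H(x,\tau)$ of holomorphic functions on $(\mathbb{C},0)\times\mathbb{C}$, uniquely determined by the initial condition $H(0,\tau)=I$, such that the matrix $P(x,\tau)=H(x,\tau)e^{-\tau M_1(0)\ln x}$ is a fundamental solution of the Dubrovin connection. 2. Any fundamental solution takes the form $H(x,\tau)e^{-\tau M_1(0)\ln x}P_{cl}(\tau)$ where $P_{cl}(\tau)$ is a matrix depending only on $\tau$. 3. After the base change of matrix $P$, the matrix of the connection $\nabla$ takes the form $(N_0(0)+N_1(0)\tau)\frac{d\tau}{\tau}$. 4. The fundamental solution $P$ is symmetric and, if $(e_0,\dots,e_{\mu-1})=(\omega_0,\dots,\omega_{\mu-1})P$, we have for all $i,j$ $$\tau\partial_\tau S(e_i,e_j)=S(\tau\nabla_{\partial_\tau}e_i,e_j)+S(e_i,\tau\nabla_{\partial_\tau}e_j).$$ 5. Assume that $M_1(0)=cN_1(0)$ for some non-zero constant $c$. Then the fundamental solution $P$ is conformal.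
   Context: Let $\theta$ be the coordinate on $\mathbb{P}^1$ centered at $0$, $\tau=\theta^{-1}$, $j(\theta,x)=(-\theta,x)$. A logarithmic quantum differential system on $M=\mathbb{C}$ (coordinate $x$), with pole at the origin, is a tuple $(M,\mathcal{G},\nabla,S,d)$, $d\in\mathbb{Z}$, where $\mathcal{G}$ is a holomorphic bundle on $\mathbb{P}^1\times M$ with a basis $\omega=(\omega_0,\dots,\omega_{\mu-1})$ of global sections ($\mathcal{O}_M$-basis of $\pi_*\mathcal{G}$), $\nabla$ is a flat meromorphic connection on $\mathcal{G}$ with matrix in $\omega$ $$(M_0(x)+M_1(x)\tau)\frac{dx}{x}+(N_0(x)+N_1(x)\tau)\frac{d\tau}{\tau},$$ $M_i,N_i$ holomorphic on $\mathbb{C}$, and $S:\mathcal{O}(\mathcal{G})\times j^*\mathcal{O}(\mathcal{G})\to\theta^d\mathcal{O}_{\mathbb{P}^1\times M}$ is a $\nabla$-flat non-degenerate bilinear form (so $S$ is linear in the first variable and $S(a,h(\theta)b)=h(-\theta)S(a,b)$). One writes $S(\omega_i,\omega_j)=g(\omega_i,\omega_j)\theta^d$ with $g$ non-degenerate $\mathcal{O}_M$-bilinear on $\pi_*\mathcal{G}$. The endomorphism with matrix $N_0(x)$ is assumed semi-simple. The system is flat if $M_0(x)=0$ for all $x$; then the $g(\omega_i,\omega_j)$ are constants. Convention: $\nabla(\omega v)=\omega(dv+\Omega v)$, and after the base change of matrix $P$ the matrix is $P^{-1}\Omega P+P^{-1}dP$. The Dubrovin connection $\nabla^d$ is the part of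 $\nabla$ in the direction of $M$, with matrix $\tau M_1(x)\frac{dx}{x}$ in $\omega$. A fundamental solution of $\nabla^d$ is an invertible matrix $P(x,\tau)=P_0(x)+\sum_{i\ge1}P_i(x)\tau^i$, a formal power series in $\tau$ with coefficients (multivalued) holomorphic matrices in $x\neq0$ ($P_0$ invertible), such that $\nabla^d(\omega P)=0$. A fundamental solution $P$ is symmetric if $P^*(x,-\tau)P(x,\tau)=I$, where $P^*(x,-\tau)=\eta^{-1}P(x,-\tau)^T\eta$ and $\eta$ is the Gram matrix of $g$ in $\omega$. It is conformal if after the base change of matrix $P$ the matrix of $\nabla$ is $(R_0+R_1\tau+\cdots+R_\delta\tau^\delta)\frac{d\tau}{\tau}$ with constant matrices $R_k$ satisfying $[R_0,R_k]=-kR_k$ for all $k\ge1$. *)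

(* Defs.v *)
From HB Require Import structures.
From mathcomp Require Export all_boot all_order all_algebra.
From mathcomp Require Export all_classical all_reals all_analysis.
From mathcomp Require Export complex.
Set Implicit Arguments.
Unset Strict Implicit.
Unset Printing Implicit Defensive.
Import Order.TTheory GRing.Theory Num.Theory.
Import numFieldNormedType.Exports.
Local Open Scope classical_set_scope.
Local Open Scope ring_scope.

(* R[i] packaged as a numFieldType, which gives it the topology and the normed
   module structure of MathComp-Analysis: [derivable f z 1] is then complex
   differentiability, [differentiable] is joint complex differentiability. *)
Definition CC (R : realType) : numFieldType := R[i].

Definition cexp (R : realType) (z : CC R) : CC R :=
  Complex (expR (complex.Re z) * cos (complex.Im z))
          (expR (complex.Re z) * sin (complex.Im z)).

(* The radius may be +oo, in which case the disc is the whole plane. *)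
Definition disc (R : realType) (r : \bar R) : set (CC R) :=
  [set x | ((complex.Re `|x|)%:E < r)%E].

(* A multivalued function of x on the punctured disc of radius r is a function
   of t = ln x on this half-plane (the universal cover, x = cexp t); there
   x * d/dx is d/dt and dx/x is dt. *)
Definition logdisc (R : realType) (r : \bar R) : set (CC R) :=
  [set t | disc r (cexp t)].

Definition holo (R : realType) m n (U : set (CC R))
    (F : CC R -> 'M[CC R]_(m, n)) : Prop :=
  forall z, U z -> forall i j, derivable (fun w => F w i j) z 1.

Definition holo2 (R : realType) m n (U : set (CC R * CC R))
    (F : CC R -> CC R -> 'M[CC R]_(m, n)) : Prop :=
  forall p, U p ->
    forall i j, differentiable (fun q : CC R * CC R => F q.1 q.2 i j) p.

Definition dmx (R : realType) m n (F : CC R -> 'M[CC R]_(m, n)) (z : CC R) :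
    'M[CC R]_(m, n) :=
  \matrix_(i, j) derive1 (fun w => F w i j) z.

Definition expm (R : realType) n (A : 'M[CC R]_n) : 'M[CC R]_n :=
  \matrix_(i, j)
    limn (fun m : nat => (\sum_(k < m) (k`!)%:R^-1 *: A ^+ k : 'M[CC R]_n) i j).

(* Every invariant subspace has an invariant complement. A acts on columns,
   whereas MathComp subspaces are row spaces, hence the transpose. *)
Definition semisimple (R : realType) n (A : 'M[CC R]_n) : Prop :=
  forall V : 'M[CC R]_n, stablemx V A^T ->
    exists W : 'M[CC R]_n,
      [/\ stablemx W A^T, (V + W :=: 1%:M)%MS & (V :&: W)%MS = 0].

(* The bundle is trivialised by the global basis omega: a section is the column
   of its coordinates, as a function of (x, tau) with theta = tau^-1. *)
Record qds_data (R : realType) (mu : nat) := QdsData {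
  M0 : CC R -> 'M[CC R]_mu;
  M1 : CC R -> 'M[CC R]_mu;
  N0 : CC R -> 'M[CC R]_mu;
  N1 : CC R -> 'M[CC R]_mu;
  gram : CC R -> 'M[CC R]_mu;
  deg : int
}.

(* Coefficients of dx/x and of dtau/tau in the matrix of the connection. *)
Definition conx (R : realType) mu (Q : qds_data R mu) (x tau : CC R) :=
  M0 Q x + tau *: M1 Q x.
Definition contau (R : realType) mu (Q : qds_data R mu) (x tau : CC R) :=
  N0 Q x + tau *: N1 Q x.

Definition nabla_x (R : realType) mu (Q : qds_data R mu)
    (a : CC R -> CC R -> 'cV[CC R]_mu) (x tau : CC R) : 'cV[CC R]_mu :=
  x *: dmx (a ^~ tau) x + conx Q x tau *m a x tau.

(* Contraction with tau * d/dtau (nabla_x: with x * d/dx), for sections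
   depending on a parameter y lying over the point x = pi y: pi is the identity for ordinary
   sections and cexp for multivalued ones. *)
Definition nabla_tau (R : realType) mu (Q : qds_data R mu) (pi : CC R -> CC R)
    (a : CC R -> CC R -> 'cV[CC R]_mu) (y tau : CC R) : 'cV[CC R]_mu :=
  tau *: dmx (a y) tau + contau Q (pi y) tau *m a y tau.

(* S(omega_i, omega_j) = g(omega_i, omega_j) theta^deg, and the second argument
   is pulled back by theta |-> - theta. *)
Definition pairing (R : realType) mu (Q : qds_data R mu) (pi : CC R -> CC R)
    (a b : CC R -> CC R -> 'cV[CC R]_mu) (y tau : CC R) : CC R :=
  (tau^-1) ^ (deg Q) *
  ((a y tau)^T *m gram Q (pi y) *m b y (- tau)) ord0 ord0.

(* d Omega + Omega /\ Omega = 0, coefficient of dx/x /\ dtau/tau. *)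
Definition flat_connection (R : realType) mu (Q : qds_data R mu) : Prop :=
  forall x tau : CC R, x != 0 -> tau != 0 ->
    x *: dmx (contau Q ^~ tau) x - tau *: dmx (conx Q x) tau
    + (conx Q x tau *m contau Q x tau - contau Q x tau *m conx Q x tau) = 0.

Definition flat_pairing (R : realType) mu (Q : qds_data R mu) : Prop :=
  forall (U : set (CC R * CC R)) (a b : CC R -> CC R -> 'cV[CC R]_mu),
    open U -> (forall p, U p -> p.1 != 0 /\ p.2 != 0) ->
    holo2 U a -> holo2 [set p | U (p.1, - p.2)] b ->
    forall x tau, U (x, tau) ->
      x * derive1 (pairing Q id a b ^~ tau) x =
        pairing Q id (nabla_x Q a) b x tau + pairing Q id a (nabla_x Q b) x tau
      /\
      tau * derive1 (pairing Q id a b x) tau =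
        pairing Q id (nabla_tau Q id a) b x tau
        + pairing Q id a (nabla_tau Q id b) x tau.

Record log_qds (R : realType) mu (Q : qds_data R mu) : Prop := LogQds {
  holo_M0 : holo setT (M0 Q);
  holo_M1 : holo setT (M1 Q);
  holo_N0 : holo setT (N0 Q);
  holo_N1 : holo setT (N1 Q);
  holo_gram : holo setT (gram Q);
  connection_flat : flat_connection Q;
  gram_nondegenerate : forall x, gram Q x \in unitmx;
  pairing_flat : flat_pairing Q;
  N0_semisimple : forall x, semisimple (N0 Q x)
}.

Definition flat_qds (R : realType) mu (Q : qds_data R mu) : Prop :=
  forall x, M0 Q x = 0.

(* Formal power series in tau with matrix coefficients, as sequences. *)
Notation pser R mu := (nat -> 'M[CC R]_mu).

Definition ps1 (R : realType) mu : pser R mu :=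
  fun n => if n is 0%N then 1%:M else 0.

Definition psmul (R : realType) mu (A B : pser R mu) : pser R mu :=
  fun n => \sum_(i < n.+1) A i *m B (n - i)%N.

Definition pstau (R : realType) mu (A : pser R mu) : pser R mu :=
  fun n => if n is m.+1 then A m else 0.

Definition taylor (R : realType) mu (F : CC R -> CC R -> 'M[CC R]_mu)
    (t : CC R) : pser R mu :=
  fun n => \matrix_(i, j) ((n`!)%:R^-1 * derive1n n (fun tau => F t tau i j) 0).

(* P(x, tau) = sum_n P t n tau^n with t = ln x. The Dubrovin connection has
   matrix tau M1(x) dx/x. *)
Definition dubrovin (R : realType) mu (Q : qds_data R mu)
    (P : CC R -> pser R mu) (t : CC R) : pser R mu :=
  fun n => dmx (P ^~ n) t + pstau (fun k => M1 Q (cexp t) *m P t k) n.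

Definition fundamental (R : realType) mu (Q : qds_data R mu) (r : \bar R)
    (P : CC R -> pser R mu) : Prop :=
  [/\ forall n, holo (logdisc r) (P ^~ n),
      forall t, logdisc r t -> P t 0%N \in unitmx &
      forall t, logdisc r t -> forall n, dubrovin Q P t n = 0].

(* After the base change of matrix P, the matrix of the connection is
   A dx/x + B dtau/tau; V is the inverse of P. *)
Definition base_change (R : realType) mu (Q : qds_data R mu) (r : \bar R)
    (P A B : CC R -> pser R mu) : Prop :=
  forall t, logdisc r t ->
    exists V : pser R mu,
      [/\ psmul (P t) V =1 @ps1 R mu,
          psmul V (P t) =1 @ps1 R mu,
          forall n, A t n =
            psmul V (psmul (nth 0 [:: M0 Q (cexp t); M1 Q (cexp t)]) (P t)) n
            + psmul V (fun k => dmx (P ^~ k) t) n &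
          forall n, B t n =
            psmul V (psmul (nth 0 [:: N0 Q (cexp t); N1 Q (cexp t)]) (P t)) n
            + psmul V (fun k => k%:R *: P t k) n].

(* Coefficients of P^*(x, - tau) = eta^-1 P(x, - tau)^T eta. *)
Definition pstar (R : realType) mu (Q : qds_data R mu)
    (P : CC R -> pser R mu) (t : CC R) : pser R mu :=
  fun n => (-1) ^+ n *:
    (invmx (gram Q (cexp t)) *m (P t n)^T *m gram Q (cexp t)).

Definition symmetric_sol (R : realType) mu (Q : qds_data R mu) (r : \bar R)
    (P : CC R -> pser R mu) : Prop :=
  forall t, logdisc r t -> psmul (pstar Q P t) (P t) =1 @ps1 R mu.

Definition conformal_sol (R : realType) mu (Q : qds_data R mu) (r : \bar R)
    (P : CC R -> pser R mu) : Prop :=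
  exists (delta : nat) (Rk : pser R mu),
    [/\ forall k, (delta < k)%N -> Rk k = 0,
        forall k, (1 <= k)%N ->
          Rk 0%N *m Rk k - Rk k *m Rk 0%N = - (k%:R *: Rk k) &
        base_change Q r P (fun _ _ => 0) (fun _ => Rk)].

(* H(x, tau) e^{- tau M1(0) ln x}, with ln x = t. *)
Definition Psol (R : realType) mu (Q : qds_data R mu)
    (H : CC R -> CC R -> 'M[CC R]_mu) (t tau : CC R) : 'M[CC R]_mu :=
  H (cexp t) tau *m expm (- (tau * t) *: M1 Q 0).

Definition normalized_H (R : realType) mu (Q : qds_data R mu) (r : \bar R)
    (H : CC R -> CC R -> 'M[CC R]_mu) : Prop :=
  [/\ holo2 [set p | disc r p.1] H,
      forall tau, H 0 tau = 1%:M &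
      fundamental Q r (taylor (Psol Q H))].

(* Main.v *)
Require Import Defs.
From HB Require Import structures.
From mathcomp Require Import ring lra zify.
Import Order.TTheory GRing.Theory Num.Theory.
Import numFieldNormedType.Exports.
Import ComplexField.Normc.
Local Open Scope classical_set_scope.
Local Open Scope ring_scope.
Set Implicit Arguments.
Unset Strict Implicit.
Unset Printing Implicit Defensive.

(* The coefficients of H = sum_n h_n(x) tau^n solve
   x h_n' = - (M1(x) h_(n-1) - h_(n-1) M1(0)) with h_0 = 1 and h_n(0) = 0 for
   n > 0, which needs a holomorphic antiderivative of (f(x) - f(0)) / x for an
   entire f. Since holomorphy here only means complex differentiability, the
   power series of f has to be obtained through Goursat's lemma.

   Every identity then follows from one principle: an entire matrix K with
   K(0) = 0 and x K' = 0 vanishes. By flatness, the tau-direction of the connection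
   conjugated by H, minus N0(0) + tau N1(0), satisfies inductively such an equation,
   and so does H^*(x, - tau) H(x, tau) - 1. The resulting equation of H in the
   direction of tau has a factor n in front of h_n; this forces factorial decay, so
   that H is entire in tau, although the equation in x is resonant. In particular
   the radius of the disc can be taken to be +oo.

   For uniqueness, two solutions differ at the first order where they differ by a
   function of x = exp t which is constant in t and tends to 0 as x tends to 0. *)

(** * The complex norm and epsilon-delta calculus *)

(** Identities and convergence are kept apart. Base change, symmetry, conformality and the
    comparison with other fundamental solutions only involve coefficients of powers of tau, so they
    are proved for the formal product of the [h n] with the coefficients of the exponential.
    Convergence enters through [taylor_gauge], which identifies this product with
    [taylor (Psol Q H)], through holomorphy in (x, tau), the pairing, and the uniqueness of [H]. The
    value of flatness at x = 0 is [M1(0), N0(0)] = M1(0), together with [M1(0), N1(0)] = 0. Flatness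
    is assumed off x = 0 only, and is extended by continuity of entire functions. These two
    relations make the exponential factor preserve N0(0) + tau N1(0), and the first becomes
    conformality when M1(0) = c N1(0). Flatness of the pairing, tested on the constant basis
    sections, makes the Gram matrix constant and M1(x), N1(x) self-adjoint. The adjoint of the
    solution at - tau is therefore an explicit inverse: symmetry is obtained before the base change,
    which uses this inverse. *)

Definition nc (R : realType) (z : CC R) : R := normc (z : R[i]).

Section Norm.
Variable R : realType.
Implicit Types (x y z w : CC R).

(** The norm of [CC R] takes its values in [CC R]; estimates are carried out on the real number
    [nc z], where [lra] and [nra] apply. *)
Lemma ncE z : `|z| = (nc z)%:C%C :> CC R.
Proof. by case: z. Qed.

Lemma nc_Re z : complex.Re `|z| = nc z.
Proof. by rewrite ncE. Qed.

Lemma nc0 : nc (0 : CC R) = 0. Proof. exact: normc0. Qed.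
Lemma nc1 : nc (1 : CC R) = 1. Proof. exact: normc1. Qed.
Lemma ncM x y : nc (x * y) = nc x * nc y. Proof. exact: normcM. Qed.
Lemma ncN x : nc (- x) = nc x. Proof. exact: normcN. Qed.
Lemma ncD x y : nc (x + y) <= nc x + nc y. Proof. exact: le_normcD. Qed.
Lemma nc_ge0 x : 0 <= nc x.
Proof. by case: x => a b; rewrite /nc /normc sqrtr_ge0. Qed.
Lemma nc_eq0 x : (nc x == 0) = (x == 0).
Proof. by apply/eqP/eqP => [/eq0_normc//|->]; exact: nc0. Qed.
Lemma nc_gt0 x : (0 < nc x) = (x != 0).
Proof. by rewrite lt_def nc_ge0 andbT nc_eq0. Qed.
Lemma ncV x : nc x^-1 = (nc x)^-1. Proof. exact: normcV. Qed.
Lemma ncX x n : nc (x ^+ n) = nc x ^+ n.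
Proof. by elim: n => [|n ih]; rewrite ?expr0 ?nc1// !exprS ncM ih. Qed.
Lemma ncB x y : nc (x - y) <= nc x + nc y.
Proof. by rewrite -(ncN y) ncD. Qed.
Lemma ncBC x y : nc (x - y) = nc (y - x).
Proof. by rewrite -ncN opprB. Qed.
Lemma nc_real (a : R) : nc (a%:C%C : CC R) = `|a|.
Proof. by rewrite /nc /normc /= expr0n /= addr0 sqrtr_sqr. Qed.
Lemma nc_nat n : nc (n%:R : CC R) = n%:R.
Proof. by rewrite -(rmorph_nat (real_complex R)) nc_real normr_nat. Qed.

Lemma nc_sum (I : Type) (r : seq I) (P : pred I) (F : I -> CC R) :
  nc (\sum_(i <- r | P i) F i) <= \sum_(i <- r | P i) nc (F i).
Proof.
elim/big_rec2: _ => [|i x y _ h]; first by rewrite nc0.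
by apply: le_trans (ncD _ _) _; rewrite lerD2l.
Qed.

Lemma Re_le_nc z : `|complex.Re z| <= nc z.
Proof.
case: z => a b; rewrite /nc /normc /= -sqrtr_sqr ler_wsqrtr// lerDl.
exact: sqr_ge0.
Qed.

Lemma Im_le_nc z : `|complex.Im z| <= nc z.
Proof.
case: z => a b; rewrite /nc /normc /= -sqrtr_sqr ler_wsqrtr// lerDr.
exact: sqr_ge0.
Qed.

Lemma nc_le_ReIm z : nc z <= `|complex.Re z| + `|complex.Im z|.
Proof.
case: z => a b; have -> : Complex a b = (a%:C%C : CC R) + Complex 0 b.
  by apply/eqP; rewrite eq_complex /= addr0 add0r !eqxx.
apply: le_trans (ncD _ _) _; rewrite nc_real /= addr0 add0r lerD2l.
by rewrite /nc /normc /= expr0n /= add0r sqrtr_sqr.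
Qed.

Lemma ReD x y : complex.Re (x + y) = complex.Re x + complex.Re y.
Proof. by case: x; case: y. Qed.
Lemma ImD x y : complex.Im (x + y) = complex.Im x + complex.Im y.
Proof. by case: x; case: y. Qed.
Lemma ReN x : complex.Re (- x) = - complex.Re x.
Proof. by case: x. Qed.
Lemma ImN x : complex.Im (- x) = - complex.Im x.
Proof. by case: x. Qed.
Lemma ReZ (a : R) x : complex.Re (a%:C%C * x) = a * complex.Re x.
Proof. by case: x => c d /=; rewrite mul0r subr0. Qed.
Lemma ImZ (a : R) x : complex.Im (a%:C%C * x) = a * complex.Im x.
Proof. by case: x => c d /=; rewrite mul0r addr0. Qed.
Lemma complex_eqE x y : complex.Re x = complex.Re y -> complex.Im x = complex.Im y -> x = y.
Proof. by case: x; case: y => a b c d /= -> ->. Qed.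

Lemma CC_gt0 (e : CC R) : 0 < e -> exists2 e' : R, 0 < e' & e = e'%:C%C.
Proof.
case: e => a b; rewrite ltcE /= => /andP[/eqP -> a0]; by exists a.
Qed.

Lemma nbhs_CCP z (P : set (CC R)) :
  nbhs z P <-> exists2 d : R, 0 < d & forall w, nc (w - z) < d -> P w.
Proof.
split.
  move=> /nbhs_ballP[e /CC_gt0[d d0 ->]] h; exists d => // w hw; apply: h.
  by rewrite -ball_normE /ball_ /= ncE ncBC ltcR.
move=> [d d0 h]; apply/nbhs_ballP; exists (d%:C%C : CC R) => /=.
  by rewrite ltcR.
move=> w; rewrite -ball_normE /ball_ /= ncE ltcR ncBC; exact: h.
Qed.

Lemma nbhs_RP (x : R) (P : set R) :
  nbhs x P <-> exists2 d : R, 0 < d & forall w : R, `|w - x| < d -> P w.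
Proof.
split.
  move=> /nbhs_ballP[e e0] h; exists e => // w hw; apply: h.
  by rewrite -ball_normE /ball_ /= distrC.
move=> [d d0 h]; apply/nbhs_ballP; exists d => //.
move=> w; rewrite -ball_normE /ball_ /= distrC; exact: h.
Qed.

End Norm.

(** Multiplying out the difference quotient admits h = 0 and removes the punctured neighbourhood.
    Stated over any [K], it serves both the real and the complex derivative. *)
Lemma is_derive_near (K : numFieldType) (f : K -> K) (x l : K) :
  is_derive x 1 f l <->
  forall e, 0 < e -> \forall h \near (0 : K), `|f (x + h) - f x - l * h| <= e * `|h|.
Proof.
split.
  move=> [df dl] e e0.
  have : h^-1 *: (f (h *: 1 + x) - f x) @[h --> 0^'] --> l.
    by rewrite -dl; exact: df.
  move/cvgrPdist_le => /(_ e e0); rewrite near_withinE => H.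
  near=> h; have [->|h0] := eqVneq h 0.
    by rewrite mulr0 addr0 subrr subr0 normr0 mulr0.
  suff: `|l - h^-1 *: (f (h *: 1 + x) - f x)| <= e.
  rewrite -(ler_pM2r (_ : 0 < `|h|)) ?normr_gt0//; apply: le_trans.
  rewrite -normrM mulrBl /GRing.scale /= mulr1 mulrAC mulVf// mul1r (addrC h x).
  by rewrite -[in leRHS]normrN opprB.
  by move: h0; near: h.
move=> H.
have : h^-1 *: (f (h *: 1 + x) - f x) @[h --> 0^'] --> l.
  apply/cvgrPdist_le => e e0; rewrite near_withinE; near=> h => h0.
  rewrite -(ler_pM2r (_ : 0 < `|h|)) ?normr_gt0//.
  rewrite -normrM mulrBl /GRing.scale /= mulr1 mulrAC mulVf// mul1r (addrC h x).
  by rewrite -normrN opprB; near: h; exact: H.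
move=> cl; split.
  by rewrite /derivable; apply/cvg_ex; exists l.
exact: cvg_lim.
Unshelve. all: by end_near. Qed.

Definition cder (R : realType) (f : CC R -> CC R) (z l : CC R) : Prop :=
  forall e : R, 0 < e -> exists2 d : R, 0 < d &
    forall h, nc h < d -> nc (f (z + h) - f z - l * h) <= e * nc h.

(** [CC R] is normed over itself and not over [R], so the derivative along a real parameter is
    spelled out; [rderP] reduces it to real and imaginary parts. *)
Definition rder (R : realType) (u : R -> CC R) (x : R) (l : CC R) : Prop :=
  forall e : R, 0 < e -> exists2 d : R, 0 < d &
    forall h : R, `|h| < d -> nc (u (x + h) - u x - l * h%:C%C) <= e * `|h|.

Definition ccont (R : realType) (f : CC R -> CC R) (z : CC R) : Prop :=
  forall e : R, 0 < e -> exists2 d : R, 0 < d &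
    forall w, nc (w - z) < d -> nc (f w - f z) < e.

Definition rcont (R : realType) (u : R -> CC R) (x : R) : Prop :=
  forall e : R, 0 < e -> exists2 d : R, 0 < d &
    forall y, `|y - x| < d -> nc (u y - u x) < e.

Section Der.
Variable R : realType.
Implicit Types (f g : CC R -> CC R) (u v : R -> CC R).

Lemma cderP f z l : cder f z l <-> is_derive z 1 f l.
Proof.
split.
  move=> H; apply/is_derive_near => e /CC_gt0[e' e0 ->].
  have [d d0 h] := H _ e0; apply/nbhs_CCP; exists d => // w.
  by rewrite subr0 => /h hw; rewrite !ncE -rmorphM lecR.
move=> /is_derive_near H e e0; have := H (e%:C%C : CC R); rewrite ltcR => /(_ e0).
move=> /nbhs_CCP[d d0 h]; exists d => // w wd; have := h w; rewrite subr0 => /(_ wd).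
by rewrite !ncE -rmorphM lecR.
Qed.

Lemma rderP u x l : rder u x l <->
  is_derive x 1 (fun s => complex.Re (u s)) (complex.Re l) /\ is_derive x 1 (fun s =>
    complex.Im (u s)) (complex.Im l).
Proof.
split.
  move=> H; split; apply/is_derive_near => e e0; have [d d0 h] := H _ e0;
    apply/nbhs_RP; exists d => // w; rewrite subr0 => /h hw; apply: le_trans hw => /=.
    apply: le_trans (Re_le_nc _); rewrite !ReD !ReN.
    by rewrite [l * _]mulrC ReZ (mulrC _ w).
  apply: le_trans (Im_le_nc _); rewrite !ImD !ImN.
  by rewrite [l * _]mulrC ImZ (mulrC _ w).
move=> [/is_derive_near H1 /is_derive_near H2] e e0.
have e2 : 0 < e / 2 by rewrite divr_gt0.
have /nbhs_RP[d1 d10 h1] := H1 _ e2; have /nbhs_RP[d2 d20 h2] := H2 _ e2.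
exists (Num.min d1 d2); first by rewrite lt_min d10.
move=> h; rewrite lt_min => /andP[hd1 hd2].
have := h1 h; have := h2 h; rewrite subr0 => /(_ hd2) b2 /(_ hd1) b1.
apply: le_trans (nc_le_ReIm _) _.
rewrite !ReD !ReN !ImD !ImN [l * _]mulrC ReZ ImZ (mulrC h) (mulrC h).
by rewrite [leRHS](_ : _ = e / 2 * `|h| + e / 2 * `|h|); [rewrite lerD|field].
Qed.

Lemma cder_derive1 f z l : cder f z l -> derive1 f z = l.
Proof. by move=> /cderP[_ <-]; rewrite derive1E. Qed.

Lemma cder_derivable f z l : cder f z l -> derivable f z 1.
Proof. by move=> /cderP[]. Qed.

Lemma derivable_cder f z : derivable f z 1 -> cder f z (derive1 f z).
Proof. by move=> df; apply/cderP; rewrite derive1E; split. Qed.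

Lemma cder_cont f z l : cder f z l -> ccont f z.
Proof.
move=> H e e0; have [d d0 h] := H 1 ltr01.
have B : 0 < 1 + nc l + 1 by have := nc_ge0 l; lra.
exists (Num.min d (e / (1 + nc l + 1))); first by rewrite lt_min d0 divr_gt0.
move=> w; rewrite lt_min => /andP[wd we].
have := h _ wd; rewrite (addrC z) subrK mul1r => hw.
have -> : f w - f z = (f w - f z - l * (w - z)) + l * (w - z) by rewrite subrK.
apply: le_lt_trans (ncD _ _) _; rewrite ncM.
move: we; rewrite ltr_pdivlMr//.
have := nc_ge0 (w - z); nra.
Qed.

Lemma ccont_continuous f z : ccont f z <-> {for z, continuous f}.
Proof.
split.
  move=> H P /nbhs_CCP[e e0 hP]; have [d d0 h] := H _ e0.
  by apply/nbhs_CCP; exists d => // w /h /hP.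
move=> H e e0; have /H/nbhs_CCP[d d0 h] : nbhs (f z) [set w | nc (w - f z) < e].
  by apply/nbhs_CCP; exists e.
by exists d.
Qed.

Lemma rcont_continuous u x : rcont u x -> {for x, continuous (fun s => complex.Re (u s))} /\
  {for x, continuous (fun s => complex.Im (u s))}.
Proof.
move=> H; split=> P /nbhs_RP[e e0 hP]; have [d d0 h] := H _ e0;
  apply/nbhs_RP; exists d => // w /h hw; apply: hP; apply: le_lt_trans hw.
  by rewrite -ReN -ReD; exact: Re_le_nc.
by rewrite -ImN -ImD; exact: Im_le_nc.
Qed.

End Der.

(** * Integrals along real segments *)

Section RealLine.
Variable R : realType.
Implicit Types (u v U : R -> CC R) (a b s x : R).

(** The mean value theorem fails for complex values, so it is applied to the real and imaginary
    parts separately; hence the factor 2, which propagates to the later integral estimates. *)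
Lemma mvt_le u du a b (K : R) : a <= b ->
  (forall x, a < x < b -> rder u x (du x)) ->
  (forall x, a <= x <= b -> rcont u x) ->
  (forall x, a < x < b -> nc (du x) <= K) -> nc (u b - u a) <= 2 * K * (b - a).
Proof.
rewrite le_eqVlt => /predU1P[->|ab] hd hc hK; first by rewrite !subrr nc0 mulr0.
have key (p : CC R -> R) : (forall z, `|p z| <= nc z) -> (forall z w, p (z - w) = p z - p w) ->
    (forall x, a < x < b -> is_derive x 1 (fun s => p (u s)) (p (du x))) ->
    (forall x, a <= x <= b -> {for x, continuous (fun s => p (u s))}) ->
    `|p (u b - u a)| <= K * (b - a).
  move=> ple pB pd pc.
  have h1 x : x \in `]a, b[ -> is_derive x 1 (fun s => p (u s)) (p (du x)).
    by rewrite in_itv /=; exact: pd.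
  have h2 : {within `[a, b], continuous (fun s => p (u s))}.
    by apply: continuous_in_subspaceT => x; rewrite inE /= in_itv /=; exact: pc.
  have [c] := MVT ab h1 h2.
  rewrite in_itv /= => cab; rewrite pB => ->;
    rewrite normrM (gtr0_norm (_ : 0 < b - a)) ?subr_gt0//.
  by rewrite ler_pM2r ?subr_gt0//; exact: le_trans (ple _) (hK _ cab).
apply: le_trans (nc_le_ReIm _) _.
rewrite -mulrA mulr_natl mulr2n; apply: lerD; apply: key.
- exact: Re_le_nc.
- by move=> x y; rewrite ReD ReN.
- by move=> x /hd /rderP[].
- by move=> x /hc /rcont_continuous[].
- exact: Im_le_nc.
- by move=> x y; rewrite ImD ImN.
- by move=> x /hd /rderP[].
- by move=> x /hc /rcont_continuous[].
Qed.

Lemma mvt0 u a b : a <= b ->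
  (forall x, a < x < b -> rder u x 0) ->
  (forall x, a <= x <= b -> rcont u x) -> u b = u a.
Proof.
move=> ab hd hc; have := @mvt_le u (fun=> 0) a b 0 ab hd hc.
rewrite nc0 mulr0 mul0r => /(_ (fun _ _ => lexx _)) h.
by apply/eqP; rewrite -subr_eq0 -nc_eq0 eq_le h nc_ge0.
Qed.

Lemma rder_rcont u x l : rder u x l -> rcont u x.
Proof.
move=> H e e0; have [d d0 h] := H 1 ltr01.
have B : 0 < 1 + nc l + 1 by have := nc_ge0 l; lra.
exists (Num.min d (e / (1 + nc l + 1))); first by rewrite lt_min d0 divr_gt0.
move=> w; rewrite lt_min => /andP[wd we].
have := h _ wd; rewrite (addrC x) subrK mul1r => hw.
have -> : u w - u x = (u w - u x - l * (w - x)%:C%C) + l * (w - x)%:C%C by rewrite subrK.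
apply: le_lt_trans (ncD _ _) _; rewrite ncM nc_real.
move: we; rewrite ltr_pdivlMr//.
have := normr_ge0 (w - x); nra.
Qed.

(** The integral from -1 is a primitive to the right of -1. Applied to u and to its reflection, it
    gives two primitives that overlap on ]-1, 1[; the constant [c] makes them agree at 0, hence on
    the overlap, and they are glued at 0. *)
Lemma prim_real (u : R -> R) : continuous u ->
  exists U : R -> R, forall x, is_derive x 1 U (u x).
Proof.
have base (v : R -> R) : continuous v -> exists V : R -> R,
    forall x, -1 < x -> is_derive x 1 V (v x).
  move=> cv; exists (fun x => \int[lebesgue_measure]_(t in `[-1, x]) v t)%R => x x1.
  have i1 : (@lebesgue_measure R).-integrable `[-1, x + 1] (EFin \o v).
    apply: continuous_compact_integrable; first exact: segment_compact.
    exact: continuous_subspaceT.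
  have [d1 d2] := continuous_FTC1_closed (ltr_pwDr ltr01 (lexx x)) i1 x1 (cv x).
  by split => //; rewrite -derive1E.
move=> cu; have [A1 h1] := base _ cu.
have [|A2 h2] := base (fun s => u (- s)).
  by move=> x; apply: continuous_comp; [exact: opp_continuous|exact: cu].
pose c := A1 0 + A2 0.
have h3 x : x < 1 -> is_derive x 1 (fun s => - A2 (- s) + c) (u x).
  move=> x1.
  have dN : is_derive x 1 (fun s : R => - s) (-1) by exact: is_deriveN.
  have d2 : is_derive x 1 (A2 \o (fun s : R => - s)) (u x * - 1).
    apply: is_derive1_comp; rewrite -[in u x](opprK x); apply: h2; lra.
  have := is_deriveD (is_deriveN d2) (is_derive_cst c x 1).
  by rewrite mulrN1 opprK addr0.
have h4 x : -1 < x < 1 -> - A2 (- x) + c = A1 x.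
  move=> /andP[xl xr].
  have hd (y : R) : -1 < y < 1 -> is_derive y 1 ((fun s => - A2 (- s) + c) - A1) 0.
    move=> /andP[yl yr]; rewrite -(subrr (u y)); apply: is_deriveB; [exact: h3|exact: h1].
  have gen (a b : R) : -1 < a -> b < 1 -> a <= b ->
    (fun s => - A2 (- s) + c - A1 s) b = (fun s => - A2 (- s) + c - A1 s) a.
    move=> a1 b1 ab; have k1 (y : R) : y \in `]a, b[ ->
      is_derive y 1 ((fun s => - A2 (- s) + c) - A1) 0.
      by rewrite in_itv /= => /andP[ya yb]; apply: hd; apply/andP; split; lra.
    have k2 : {within `[a, b], continuous ((fun s => - A2 (- s) + c) - A1)}.
      apply: continuous_in_subspaceT => y; rewrite inE /= in_itv /= => /andP[ya yb].
      apply: differentiable_continuous; apply/derivable1_diffP.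
      have yy : -1 < y < 1 by apply/andP; split; lra.
      by have [] := hd y yy.
    have [z _] := @MVT_segment R _ (fun=> 0) a b ab k1 k2.
    by rewrite mul0r => /eqP; rewrite subr_eq0 => /eqP.
  apply/eqP; rewrite -subr_eq0; apply/eqP.
  have e0 : - A2 (- 0) + c - A1 0 = 0 by rewrite oppr0 /c; ring.
  have [x0|x0] := leP 0 x.
    by rewrite (gen 0 x _ xr x0)//; lra.
  by rewrite -(gen x 0 xl _ (ltW x0))//; lra.
exists (fun x => if 0 <= x then A1 x else - A2 (- x) + c) => x.
have [x0|x0] := leP 0 x.
  apply: near_eq_is_derive (h1 x _); last by lra.
  apply/nbhs_RP; exists 1 => // y; rewrite ltr_norml => /andP[yl yr].
  by have [y0|y0] := leP 0 y => //; rewrite h4//; apply/andP; split; lra.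
apply: near_eq_is_derive (h3 x _); last by lra.
apply/nbhs_RP; exists (- x); first lra.
move=> y; rewrite ltr_norml => /andP[yl yr].
by rewrite leNgt (_ : y < 0 = true)//; lra.
Qed.

Definition isprim u U := forall x, rder U x (u x).

Lemma prim_ex u : (forall x, rcont u x) -> exists U, isprim u U.
Proof.
move=> cu; have [A hA] := prim_real (fun x => (rcont_continuous (cu x)).1).
have [B hB] := prim_real (fun x => (rcont_continuous (cu x)).2).
by exists (fun x => Complex (A x) (B x)) => x; apply/rderP; split; [exact: hA|exact: hB].
Qed.

(* Defined through an antiderivative, so that additivity and integration of
   derivatives need no orientation of the interval. *)
Definition cint a b u : CC R :=
  let U := get [set U | isprim u U] in U b - U a.

Lemma rderD u v x k l : rder u x k -> rder v x l ->
  rder (fun s => u s + v s) x (k + l).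
Proof.
move=> hu hv e e0; have e2 : 0 < e / 2 by rewrite divr_gt0.
have [d1 d10 h1] := hu _ e2; have [d2 d20 h2] := hv _ e2.
exists (Num.min d1 d2); first by rewrite lt_min d10.
move=> h; rewrite lt_min => /andP[/h1 b1 /h2 b2].
rewrite [X in nc X](_ : _ = (u (x + h) - u x - k * h%:C%C) + (v (x +
  h) - v x - l * h%:C%C)); last by ring.
by apply: le_trans (ncD _ _) _; lra.
Qed.

Lemma rderZ u x k (c : CC R) : rder u x k -> rder (fun s => c * u s) x (c * k).
Proof.
move=> hu e e0; have B : 0 < 1 + nc c by have := nc_ge0 c; lra.
have [|d d0 h] := hu (e / (1 + nc c)); first by rewrite divr_gt0.
exists d => // y /h hy.
rewrite [X in nc X](_ : _ = c * (u (x + y) - u x - k * y%:C%C)); last by ring.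
rewrite ncM; apply: le_trans (ler_wpM2l (nc_ge0 c) hy) _.
rewrite [leLHS](_ : _ = nc c / (1 + nc c) * (e * `|y|)); last by field; rewrite gt_eqF.
rewrite ler_piMl ?mulr_ge0 ?(ltW e0)// ler_pdivrMr// mul1r; lra.
Qed.

Lemma rderN u x k : rder u x k -> rder (fun s => - u s) x (- k).
Proof.
move=> /(rderZ (-1)); rewrite mulN1r.
by rewrite (_ : (fun s => -1 * u s) = (fun s => - u s))//; apply/funext => s; rewrite mulN1r.
Qed.

Lemma cintE u U a b : isprim u U -> cint a b u = U b - U a.
Proof.
move=> hU; rewrite /cint; have /= hV : isprim u (get [set U | isprim u U]).
  by exact: (@getI _ [set U | isprim u U] U hU).
set V := get _ in hV *.
have gen x y : x <= y -> V y - U y = V x - U x.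
  have hd z : rder (fun s => V s - U s) z 0.
    by rewrite -(subrr (u z)); apply: rderD (hV z) (rderN (hU z)).
  move=> xy; apply: (mvt0 (u := fun s => V s - U s) xy) => // z _.
  exact: rder_rcont (hd z).
have [ab|/ltW ab] := leP a b.
  by have /eqP := gen _ _ ab; rewrite subr_eq => /eqP ->; ring.
by have /eqP := gen _ _ ab; rewrite subr_eq => /eqP ->; ring.
Qed.

Lemma cint_chasles a m b u : cint a b u = cint a m u + cint m b u.
Proof. by rewrite /cint; ring. Qed.

Lemma cintD a b u v : (forall x, rcont u x) -> (forall x, rcont v x) ->
  cint a b (fun s => u s + v s) = cint a b u + cint a b v.
Proof.
move=> /prim_ex[U hU] /prim_ex[V hV].
rewrite (cintE (U := fun s => U s + V s)); last by move=> x; exact: rderD.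
by rewrite (cintE _ _ hU) (cintE _ _ hV); ring.
Qed.

Lemma cintZ a b u (c : CC R) : (forall x, rcont u x) ->
  cint a b (fun s => c * u s) = c * cint a b u.
Proof.
move=> /prim_ex[U hU].
rewrite (cintE (U := fun s => c * U s)); last by move=> x; exact: rderZ.
by rewrite (cintE _ _ hU); ring.
Qed.

Lemma cint_le a b u K : a <= b -> (forall x, rcont u x) ->
  (forall x, a <= x <= b -> nc (u x) <= K) -> nc (cint a b u) <= 2 * K * (b - a).
Proof.
move=> ab /prim_ex[U hU] hK; rewrite (cintE _ _ hU).
apply: (@mvt_le U u) => // [x _|x /andP[ax xb]].
  exact: rder_rcont (hU x).
by apply: hK; rewrite !ltW.
Qed.

End RealLine.

(** * Goursat's lemma *)

Section Bisection.
Variable R : realType.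

Definition rect := (R * R * R * R)%type.

Variable Phi : R -> R -> R -> R -> CC R.
Hypothesis PhiH : forall a m b c d, Phi a b c d = Phi a m c d + Phi m b c d.
Hypothesis PhiV : forall a b c m d, Phi a b c d = Phi a b c m + Phi a b m d.

Let size (q : rect) : R := let: (a, b, c, d) := q in nc (Phi a b c d).

(** The first quarter whose size is at least a fourth of the whole. The last one is taken without a
    test: by the triangle inequality it qualifies when the other three fail. *)
Let quarter (q : rect) : rect :=
  let: (a, b, c, d) := q in
  let m := (a + b) / 2 in let n := (c + d) / 2 in
  if size q <= 4 * size (a, m, c, n) then (a, m, c, n) else
  if size q <= 4 * size (m, b, c, n) then (m, b, c, n) else
  if size q <= 4 * size (a, m, n, d) then (a, m, n, d) else (m, b, n, d).

Let size_quarter q : size q <= 4 * size (quarter q).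
Proof.
case: q => [[[a b] c] d]; rewrite /quarter.
set m := (a + b) / 2; set n := (c + d) / 2.
case: ifPn => //; case: ifPn => //; case: ifPn => //; rewrite -!ltNge /=.
move=> h1 h2 h3.
have := nc_ge0 (Phi m b n d).
have : nc (Phi a b c d) <= nc (Phi a m c n) + nc (Phi a m n d) + (nc (Phi m b c n) +
  nc (Phi m b n d)).
  rewrite (PhiH a m b c d) (PhiV a m c n d) (PhiV m b c n d).
  by apply: le_trans (ncD _ _) _; apply: lerD; exact: ncD.
lra.
Qed.

Let quarterP a b c d : a <= b -> c <= d ->
  let: (a', b', c', d') := quarter (a, b, c, d) in
  [/\ a <= a', b' <= b, c <= c' & d' <= d] /\ (b' - a' = (b - a) / 2 /\ d' - c' = (d - c) / 2).
Proof.
move=> ab cd; rewrite /quarter; do 3?case: ifP => _; (split; [split; lra|by split; field]).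
Qed.

(* Quartering a rectangle divides [nc Phi] by at most 4, which is exactly the
   factor lost by the squared perimeter in the local bound. *)
Lemma bisection_eq0 a b c d : a <= b -> c <= d ->
  (forall x y, a <= x <= b -> c <= y <= d -> forall e : R, 0 < e -> exists2 t : R, 0 < t &
     forall a' b' c' d', a' <= x <= b' -> c' <= y <= d' -> b' - a' < t -> d' - c' < t ->
       nc (Phi a' b' c' d') <= e * ((b' - a') + (d' - c')) ^+ 2) ->
  Phi a b c d = 0.
Proof.
move=> ab cd loc; apply/eqP; rewrite -nc_eq0; apply: contraT => nz.
have eta0 : 0 < nc (Phi a b c d) by rewrite lt_def nz nc_ge0.
pose Q n := iter n quarter (a, b, c, d).
pose A n := (Q n).1.1.1; pose B n := (Q n).1.1.2; pose C n := (Q n).1.2; pose D n := (Q n).2.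
have QE n : Q n = (A n, B n, C n, D n) by rewrite /A /B /C /D; case: (Q n) => [[[? ?] ?] ?].
have wid n : B n - A n = (b - a) / 2 ^+ n /\ D n - C n = (d - c) / 2 ^+ n.
  elim: n => [|n [ih1 ih2]]; first by rewrite expr0 !divr1.
  have hA : A n <= B n by rewrite -subr_ge0 ih1 divr_ge0 ?exprn_ge0// subr_ge0.
  have hC : C n <= D n by rewrite -subr_ge0 ih2 divr_ge0 ?exprn_ge0// subr_ge0.
  have := quarterP hA hC; rewrite -QE.
  have -> : quarter (Q n) = Q n.+1 by [].
  rewrite QE => -[_ [-> ->]]; rewrite ih1 ih2 exprS; split; field; by rewrite expf_neq0.
have AB n : A n <= B n by rewrite -subr_ge0 (wid n).1 divr_ge0 ?exprn_ge0// subr_ge0.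
have CD n : C n <= D n by rewrite -subr_ge0 (wid n).2 divr_ge0 ?exprn_ge0// subr_ge0.
have step n : [/\ A n <= A n.+1, B n.+1 <= B n, C n <= C n.+1 & D n.+1 <= D n].
  have := quarterP (AB n) (CD n); rewrite -QE.
  have -> : quarter (Q n) = Q n.+1 by [].
  by rewrite QE => -[[-> -> -> ->] _].
have sz n : nc (Phi a b c d) <= 4 ^+ n * nc (Phi (A n) (B n) (C n) (D n)).
  elim: n => [|n ih]; first by rewrite expr0 mul1r.
  apply: le_trans ih _; rewrite exprSr -mulrA ler_pM2l ?exprn_gt0//.
  by have := size_quarter (Q n); rewrite -[quarter (Q n)]/(Q n.+1) !QE.
have homA : {homo A : m n / (m <= n)%N >-> m <= n}.
  by apply: homo_leq => [x|y x z|n]; [exact: lexx|exact: le_trans|have [] := step n].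
have homC : {homo C : m n / (m <= n)%N >-> m <= n}.
  by apply: homo_leq => [x|y x z|n]; [exact: lexx|exact: le_trans|have [] := step n].
have homB : {homo B : m n / (m <= n)%N >-> n <= m}.
  by apply: homo_leq => [x|y x z yx zy|n];
    [exact: lexx|exact: le_trans zy yx|have [] := step n].
have homD : {homo D : m n / (m <= n)%N >-> n <= m}.
  by apply: homo_leq => [x|y x z yx zy|n];
    [exact: lexx|exact: le_trans zy yx|have [] := step n].
have point (X Y : nat -> R) : {homo X : m n / (m <= n)%N >-> m <= n} ->
    {homo Y : m n / (m <= n)%N >-> n <= m} -> (forall n, X n <= Y n) ->
    exists x, forall n, X n <= x <= Y n.
  move=> hX hY XY.
  have ubn n : ubound (range X) (Y n).
    move=> _ [k _ <-]; apply: le_trans (hX _ _ (leq_maxl k n)) _.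
    exact: le_trans (XY _) (hY _ _ (leq_maxr k n)).
  have ne : (range X) !=set0 by exists (X 0%N), 0%N.
  exists (sup (range X)) => n; apply/andP; split.
    by apply: sup_upper_bound; [split => //; exists (Y 0%N)|exists n].
  exact: ge_sup.
have [x hx] := point _ _ homA homB AB.
have [y hy] := point _ _ homC homD CD.
(* [L] is positive even for a degenerate rectangle. At level n the local bound gets multiplied by
   4^n, and the constant below then leaves less than half of [nc (Phi a b c d)], a contradiction. *)
pose L := (b - a) + (d - c) + 1.
have L0 : 0 < L by rewrite /L; lra.
have e0 : 0 < nc (Phi a b c d) / (2 * L ^+ 2) by rewrite divr_gt0 ?mulr_gt0 ?exprn_gt0.
have [t t0 ht] := loc x y (hx 0%N) (hy 0%N) _ e0.
have [n hn] : exists n : nat, L / t < 2 ^+ n.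
  by exists (Num.Def.archi_bound (L / t)); apply: upper_nthrootP.
have small z : z <= L -> z / 2 ^+ n < t.
  move=> zL; rewrite ltr_pdivrMr ?exprn_gt0//.
  by move: hn; rewrite ltr_pdivrMr// mulrC; exact: le_lt_trans.
have := ht _ _ _ _ (hx n) (hy n).
rewrite (wid n).1 (wid n).2 => /(_ (small _ _) (small _ _)) h.
have {h} : nc (Phi (A n) (B n) (C n) (D n)) <= nc (Phi a b c d) / (2 * L ^+ 2) *
       ((b - a) / 2 ^+ n + (d - c) / 2 ^+ n) ^+ 2 by apply: h; rewrite /L; lra.
rewrite -(ler_pM2l (_ : 0 < 4 ^+ n)) ?exprn_gt0// => h.
have {h} := le_trans (sz n) h.
rewrite [leRHS](_ : _ = nc (Phi a b c d) * (((b - a) + (d - c)) ^+ 2 / (2 * L ^+ 2)));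
  last first.
  rewrite (_ : 4 ^+ n = (2 ^+ n) ^+ 2 :> R); last by rewrite -exprM mulnC exprM;
    congr (_ ^+ _); ring.
  by field; rewrite expf_neq0 //= gt_eqF.
rewrite ler_pMr// ler_pdivlMr ?mulr_gt0 ?exprn_gt0// mul1r /L.
have : 0 <= b - a + (d - c) by lra.
by move: (b - a + (d - c)) => S S0; nra.
Qed.

End Bisection.

Section Goursat.
Variable R : realType.
Implicit Types (g f : CC R -> CC R) (a b c d x y s : R).
Local Notation ii := (Complex 0 1 : CC R).

Lemma complexDE (x y : R) : Complex x y = x%:C%C + ii * y%:C%C :> CC R.
Proof. by apply: complex_eqE; rewrite /= !(mul0r, mul1r, mulr0, mulr1, addr0, subr0, add0r,
  subrr, oppr0). Qed.

Lemma nc_ii : nc ii = 1.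
Proof. by rewrite /nc /normc /= expr0n /= add0r expr1n sqrtr1. Qed.

Lemma nc_complexB (x y x' y' : R) :
  nc (Complex x y - Complex x' y' : CC R) <= `|x - x'| + `|y - y'|.
Proof. exact: nc_le_ReIm. Qed.

Lemma rcont_line f (p q : CC R) x : ccont f (p + q * x%:C%C) ->
  rcont (fun s => f (p + q * s%:C%C)) x.
Proof.
move=> H e e0; have [d d0 h] := H _ e0.
have B : 0 < 1 + nc q by have := nc_ge0 q; lra.
exists (d / (1 + nc q)); first by rewrite divr_gt0.
move=> y; rewrite ltr_pdivlMr// => hy; apply: h.
rewrite (_ : _ - _ = q * (y - x)%:C%C); last by rewrite rmorphB /=; ring.
by rewrite ncM nc_real; have := normr_ge0 (y - x); have := nc_ge0 q; nra.
Qed.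

Lemma rder_line f (p q l : CC R) x : cder f (p + q * x%:C%C) l ->
  rder (fun s => f (p + q * s%:C%C)) x (l * q).
Proof.
move=> H e e0; have B : 0 < 1 + nc q by have := nc_ge0 q; lra.
have [|d d0 h] := H (e / (1 + nc q)); first by rewrite divr_gt0.
exists (d / (1 + nc q)); first by rewrite divr_gt0.
move=> y; rewrite ltr_pdivlMr// => hy.
have := h (q * y%:C%C); rewrite ncM nc_real.
rewrite (_ : p + q * (x + y)%:C%C = p + q * x%:C%C + q * y%:C%C);
  last by rewrite rmorphD /=; ring.
move=> h'; rewrite -(mulrA l); apply: le_trans (h' _) _.
  by have := normr_ge0 y; have := nc_ge0 q; nra.
rewrite mulrA ler_wpM2r//.
rewrite -mulrA ler_piMr ?(ltW e0)// mulrC ler_pdivrMr// mul1r; lra.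
Qed.

Definition hline g c := fun s : R => g (Complex s c).
Definition vline g a := fun s : R => g (Complex a s).

(** The contour integral of g(w) dw counterclockwise around [a, b] x [c, d]; the factor [ii] is dw =
    i dy on the vertical sides. *)
Definition boundary g a b c d : CC R :=
  cint a b (hline g c) + ii * cint c d (vline g b)
  - cint a b (hline g d) - ii * cint c d (vline g a).

Lemma hlineE g c : hline g c = fun s => g (ii * c%:C%C + 1 * s%:C%C).
Proof. by apply/funext => s; rewrite /hline complexDE mul1r addrC. Qed.

Lemma vlineE g a : vline g a = fun s => g (a%:C%C + ii * s%:C%C).
Proof. by apply/funext => s; rewrite /vline complexDE. Qed.

Lemma rcont_hline g c : (forall w, ccont g w) -> forall x, rcont (hline g c) x.
Proof. by move=> cg x; rewrite hlineE; exact: rcont_line. Qed.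

Lemma rcont_vline g c : (forall w, ccont g w) -> forall x, rcont (vline g c) x.
Proof. by move=> cg x; rewrite vlineE; exact: rcont_line. Qed.

Lemma boundaryD f g a b c d : (forall w, ccont f w) -> (forall w, ccont g w) ->
  boundary (fun w => f w + g w) a b c d = boundary f a b c d + boundary g a b c d.
Proof.
move=> cf cg; rewrite /boundary /hline /vline.
rewrite !cintD; first ring.
all: by move=> x; [exact: rcont_hline|exact: rcont_vline] || (try exact: rcont_hline);
  exact: rcont_vline.
Qed.

Lemma boundary_le g a b c d K : a <= b -> c <= d -> (forall w, ccont g w) ->
  (forall x y, a <= x <= b -> c <= y <= d -> nc (g (Complex x y)) <= K) ->
  nc (boundary g a b c d) <= 4 * K * ((b - a) + (d - c)).
Proof.
move=> ab cd cg hK.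
have h1 y : c <= y <= d -> nc (cint a b (hline g y)) <= 2 * K * (b - a).
  by move=> yc; apply: cint_le ab (rcont_hline _ cg) _ => x xa; exact: hK.
have h2 x : a <= x <= b -> nc (ii * cint c d (vline g x)) <= 2 * K * (d - c).
  by move=> yc; rewrite ncM nc_ii mul1r; apply: cint_le cd (rcont_vline _ cg) _ => y ya;
    exact: hK.
rewrite /boundary; apply: le_trans (ncB _ _) _.
apply: le_trans (lerD (ncB _ _) (lexx _)) _.
apply: le_trans (lerD (lerD (ncD _ _) (lexx _)) (lexx _)) _.
have := h1 c; have := h1 d; have := h2 a; have := h2 b.
rewrite !lexx ab cd /= => /(_ isT) ? /(_ isT) ? /(_ isT) ? /(_ isT) ?; lra.
Qed.

(** The primitive [F] makes the four sides telescope. *)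
Lemma boundary_affine (p q : CC R) a b c d :
  boundary (fun w => p + q * w) a b c d = 0.
Proof.
pose F (w : CC R) := p * w + q / 2 * w ^+ 2.
have two : 2 != 0 :> CC R by rewrite pnatr_eq0.
have dF w : cder F w (p + q * w).
  move=> e e0; have B : 0 < 1 + nc (q / 2) by have := nc_ge0 (q / 2); lra.
  exists (e / (1 + nc (q / 2))); first by rewrite divr_gt0.
  move=> h; rewrite ltr_pdivlMr// => he.
  rewrite (_ : F _ - _ - _ = q / 2 * h * h); last by rewrite /F; field.
  by rewrite ncM ler_wpM2r ?nc_ge0// ncM; have := nc_ge0 h; nra.
have H y : isprim (hline (fun w => p + q * w) y) (hline F y).
  move=> x; rewrite !hlineE.
  have := @rder_line F (ii * y%:C%C) 1 _ x (dF _).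
  by rewrite mulr1.
have V x : isprim (fun s => ii * vline (fun w => p + q * w) x s) (vline F x).
  move=> y; rewrite !vlineE.
  have := @rder_line F (x%:C%C) ii _ y (dF _).
  by rewrite mulrC.
have cg w : ccont (fun w => p + q * w) w.
  have B : 0 < 1 + nc q by have := nc_ge0 q; lra.
  move=> e e0; exists (e / (1 + nc q)); first by rewrite divr_gt0.
  move=> z; rewrite ltr_pdivlMr// => he.
  rewrite (_ : _ - _ = q * (z - w)); last by ring.
  by rewrite ncM; have := nc_ge0 (z - w); nra.
rewrite /boundary -!cintZ; try exact: rcont_vline.
by rewrite !(cintE _ _ (H _)) !(cintE _ _ (V _)) /hline /vline; ring.
Qed.

Lemma ccontB f g w : ccont f w -> ccont g w -> ccont (fun z => f z - g z) w.
Proof.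
move=> hf hg e e0; have e2 : 0 < e / 2 by rewrite divr_gt0.
have [d1 d10 h1] := hf _ e2; have [d2 d20 h2] := hg _ e2.
exists (Num.min d1 d2); first by rewrite lt_min d10.
move=> z; rewrite lt_min => /andP[/h1 b1 /h2 b2].
rewrite (_ : _ - _ = (f z - f w) - (g z - g w)); last by ring.
by apply: le_lt_trans (ncB _ _) _; lra.
Qed.

(** Near the limit point of the bisection, g is its affine part [A] plus a remainder that is small
    compared with the distance. The affine part integrates to 0, and the remainder yields the
    quadratic local bound. Continuity is assumed on the whole plane because the sides are integrated
    through primitives on all of [R]. *)
Lemma goursat g a b c d : a <= b -> c <= d -> (forall w, ccont g w) ->
  (forall x y, a <= x <= b -> c <= y <= d -> exists l, cder g (Complex x y) l) ->
  boundary g a b c d = 0.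
Proof.
move=> ab cd cg dg; apply: bisection_eq0 ab cd _.
- by move=> a' m b' c' d'; rewrite /boundary (cint_chasles a' m b') (cint_chasles a' m b'
  (hline g d')); ring.
- by move=> a' b' c' m d'; rewrite /boundary (cint_chasles c' m d') (cint_chasles c' m d'
  (vline g a')); ring.
move=> x y xab ycd e e0; have [l hl] := dg _ _ xab ycd.
(* The 4 cancels the constant of [boundary_le]. Below, [t / 2] is used because the distance to [z]
   is bounded by the sum of two side lengths. *)
have e4 : 0 < e / 4 by rewrite divr_gt0.
have [t t0 ht] := hl _ e4; exists (t / 2); first by rewrite divr_gt0.
move=> a' b' c' d' xa' yc' bt dt.
have ab' : a' <= b' by lra.
have cd' : c' <= d' by lra.
set z := Complex x y : CC R in hl ht *.
pose A (w : CC R) := (g z - l * z) + l * w.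
have cA w : ccont A w.
  have B : 0 < 1 + nc l by have := nc_ge0 l; lra.
  move=> k k0; exists (k / (1 + nc l)); first by rewrite divr_gt0.
  move=> w'; rewrite ltr_pdivlMr// => he.
  rewrite (_ : _ - _ = l * (w' - w)); last by rewrite /A; ring.
  by rewrite ncM; have := nc_ge0 (w' - w); nra.
have -> : g = (fun w => A w + (g w - A w)) by apply/funext => w; rewrite addrC subrK.
rewrite boundaryD//; last by move=> w; exact: ccontB.
rewrite boundary_affine add0r.
rewrite (_ : e * _ = 4 * (e / 4 * ((b' - a') + (d' - c'))) * ((b' - a') + (d' - c')));
  last by field.
apply: boundary_le => //; first by move=> w; exact: ccontB.
move=> x' y' xa yc.
have dist : nc (Complex x' y' - z) <= (b' - a') + (d' - c').
  apply: le_trans (nc_complexB _ _ _ _) _; apply: lerD; rewrite ler_norml; apply/andP;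
    split; lra.
have := ht (Complex x' y' - z); rewrite (addrC z) subrK.
rewrite (_ : _ - _ - _ = g (Complex x' y') - A (Complex x' y')); last by rewrite /A; ring.
move=> h; apply: le_trans (h _) _; first by apply: le_lt_trans dist _; lra.
by rewrite ler_pM2l.
Qed.

End Goursat.

(** * Complex derivatives and the exponential *)

Section ComplexDerivative.
Variable R : realType.
Implicit Types (f g : CC R -> CC R) (z w k l c : CC R).

Lemma cder_ext f g z l : f =1 g -> cder f z l -> cder g z l.
Proof. by move=> /funext ->. Qed.

Lemma cder_near f g z l (d : R) : 0 < d ->
  (forall w, nc (w - z) < d -> f w = g w) -> cder f z l -> cder g z l.
Proof.
move=> d0 fg H e e0; have [d' d'0 h'] := H _ e0.
exists (Num.min d d'); first by rewrite lt_min d0.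
move=> h; rewrite lt_min => /andP[hd /h'].
by rewrite !fg// ?subrr ?nc0// addrAC subrr add0r.
Qed.

Lemma cder_cst c z : cder (fun=> c) z 0.
Proof. by apply/cderP; exact: is_derive_cst. Qed.

Lemma cder_id z : cder (fun w => w) z 1.
Proof. by apply/cderP; exact: is_derive_id. Qed.

Lemma cderD f g z k l : cder f z k -> cder g z l -> cder (fun w => f w + g w) z (k + l).
Proof. by move=> /cderP hf /cderP hg; apply/cderP; exact: is_deriveD. Qed.

Lemma cderN f z k : cder f z k -> cder (fun w => - f w) z (- k).
Proof. by move=> /cderP hf; apply/cderP; exact: is_deriveN. Qed.

Lemma cderB f g z k l : cder f z k -> cder g z l -> cder (fun w => f w - g w) z (k - l).
Proof. by move=> hf hg; exact: cderD hf (cderN hg). Qed.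

Lemma cderM f g z k l : cder f z k -> cder g z l ->
  cder (fun w => f w * g w) z (k * g z + f z * l).
Proof.
move=> /cderP hf /cderP hg; apply/cderP.
by rewrite addrC (mulrC k); exact: is_deriveM.
Qed.

Lemma cderZ c f z k : cder f z k -> cder (fun w => c * f w) z (c * k).
Proof. by move=> hf; have := cderM (cder_cst c z) hf; rewrite mul0r add0r. Qed.

Lemma cder_sum n (F : 'I_n -> CC R -> CC R) z (L : 'I_n -> CC R) :
  (forall i, cder (F i) z (L i)) -> cder (fun w => \sum_(i < n) F i w) z (\sum_(i < n) L i).
Proof.
move=> H; have -> : (fun w => \sum_(i < n) F i w) = \sum_(i < n) F i.
  by apply/funext => w; rewrite fct_sumE.
by apply/cderP; apply: is_derive_sum => i; apply/cderP.
Qed.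

Lemma cderX n z : cder (fun w => w ^+ n) z (n%:R * z ^+ n.-1).
Proof.
elim: n => [|n ih].
  by rewrite mul0r; apply: cder_ext (cder_cst 1 z) => w; rewrite expr0.
have := cderM (cder_id z) ih; rewrite mul1r.
rewrite (_ : _ + _ = n.+1%:R * z ^+ n.+1.-1); last first.
  case: n {ih} => [|n]; first by rewrite !mul0r mulr0 addr0 mul1r.
  by rewrite /= exprS -[n.+2%:R]natr1 -natr1; ring.
by apply: cder_ext => w; rewrite exprS.
Qed.

Lemma cderV z : z != 0 -> cder (fun w => w^-1) z (- z ^- 2).
Proof.
rewrite -nc_gt0 => z0 e e0.
have B : 0 < nc z ^+ 3 * e / 2 by rewrite divr_gt0// mulr_gt0 ?exprn_gt0.
exists (Num.min (nc z / 2) (nc z ^+ 3 * e / 2)); first by rewrite lt_min B divr_gt0.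
move=> h; rewrite lt_min => /andP[h1 h2].
have zh : nc z / 2 <= nc (z + h).
  have := ncB (z + h) h; rewrite addrK; lra.
have zh0 : z + h != 0 by rewrite -nc_gt0; apply: lt_le_trans zh; rewrite divr_gt0.
have nz : z != 0 by rewrite -nc_gt0.
rewrite (_ : _ - _ - _ = h * h * (z ^- 2 * (z + h)^-1)); last by field; rewrite nz zh0.
rewrite !ncM -mulrA mulrC ler_wpM2r ?nc_ge0//.
rewrite !ncV ncX mulrA ler_pdivrMr ?(lt_le_trans _ zh) ?divr_gt0//.
rewrite ler_pdivrMr ?exprn_gt0//.
apply: le_trans (ltW h2) _.
have : e * (nc z ^+ 2) * (nc z / 2) <= e * (nc z ^+ 2) * nc (z + h).
  by rewrite ler_wpM2l// mulr_ge0 ?exprn_ge0 ?(ltW z0) ?(ltW e0).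
by rewrite !exprS expr0; lra.
Qed.

Lemma cder_comp f g z k l : cder g z k -> cder f (g z) l -> cder (fun w => f (g w)) z (l * k).
Proof.
move=> hg hf e e0.
have B : 0 < 1 + nc k by have := nc_ge0 k; lra.
have C : 0 < 1 + nc l by have := nc_ge0 l; lra.
have [|d1 d10 h1] := hf (e / 2 / (1 + nc k)); first by rewrite !divr_gt0.
have [|d2 d20 h2] := hg (Num.min 1 (e / 2 / (1 + nc l)));
  first by rewrite lt_min ltr01 !divr_gt0.
exists (Num.min d2 (d1 / (1 + nc k))); first by rewrite lt_min d20 divr_gt0.
move=> h; rewrite lt_min ltr_pdivlMr// => /andP[/h2 hh hd].
set q := g (z + h) - g z.
have q1 : nc (q - k * h) <= nc h.
  by apply: le_trans hh _; rewrite ler_piMl ?nc_ge0// ge_min lexx.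
have q2 : nc (q - k * h) <= e / 2 / (1 + nc l) * nc h.
  by apply: le_trans hh _; rewrite ler_wpM2r ?nc_ge0// ge_min lexx orbT.
have qq : nc q <= (1 + nc k) * nc h.
  have := ncD (q - k * h) (k * h); rewrite subrK ncM; lra.
have := h1 q; rewrite (_ : g z + q = g (z + h)); last by rewrite /q addrC subrK.
rewrite mulrC in hd; move=> /(_ (le_lt_trans qq hd)) h3.
rewrite (_ : _ - _ - _ = (f (g (z + h)) - f (g z) - l * q) + l * (q - k * h)); last by ring.
apply: le_trans (ncD _ _) _; rewrite ncM.
have h4 : e / 2 / (1 + nc k) * nc q <= e / 2 * nc h.
  rewrite -mulrA ler_pM2l ?divr_gt0// mulrC ler_pdivrMr//; lra.
have h5 : nc l * nc (q - k * h) <= e / 2 * nc h.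
  apply: le_trans (_ : nc l * (e / 2 / (1 + nc l) * nc h) <= _);
    first by rewrite ler_wpM2l ?nc_ge0.
  rewrite mulrA ler_wpM2r ?nc_ge0// mulrA ler_pdivrMr// mulrC ler_pM2l ?divr_gt0//; lra.
lra.
Qed.

Lemma cder_shift f z c l : cder f (z + c) l -> cder (fun w => f (w + c)) z l.
Proof.
move=> hf; rewrite -(mulr1 l); apply: (@cder_comp f (fun w => w + c) z 1 l _ hf).
by rewrite -(addr0 1); apply: cderD; [exact: cder_id|exact: cder_cst].
Qed.

End ComplexDerivative.

Section ComplexExp.
Variable R : realType.
Implicit Types (z w : CC R) (a b s t x : R).

Definition cis (t : R) : CC R := Complex (cos t) (sin t).

Lemma cexpE z : cexp z = (expR (complex.Re z))%:C%C * cis (complex.Im z).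
Proof. by apply: complex_eqE; rewrite /= !mul0r ?subr0 ?addr0. Qed.

Lemma nc_cis t : nc (cis t) = 1.
Proof. by rewrite /nc /normc /cis /= cos2Dsin2 sqrtr1. Qed.

Lemma cisD s t : cis (s + t) = cis s * cis t.
Proof. by apply: complex_eqE; rewrite /= ?cosD ?sinD; ring. Qed.

Lemma cis0 : cis 0 = 1.
Proof. by apply: complex_eqE; rewrite /= ?cos0 ?sin0. Qed.

Lemma cis2pi t : cis (t + pi *+ 2) = cis t.
Proof. by rewrite /cis cosD2pi sinD2pi. Qed.

Lemma nc_cexp z : nc (cexp z) = expR (complex.Re z).
Proof. by rewrite cexpE ncM nc_cis mulr1 nc_real gtr0_norm ?expR_gt0. Qed.

Lemma cexpD z w : cexp (z + w) = cexp z * cexp w.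
Proof. by rewrite !cexpE ReD ImD expRD cisD rmorphM /=; ring. Qed.

Lemma cexp0 : cexp (0 : CC R) = 1.
Proof. by rewrite cexpE /= expR0 cis0 mulr1. Qed.

Lemma cexp_neq0 z : cexp z != 0.
Proof. by rewrite -nc_gt0 nc_cexp expR_gt0. Qed.

Lemma cexp_surj z : z != 0 -> exists t : CC R, cexp t = z.
Proof.
move=> z0; have r0 : 0 < nc z by rewrite nc_gt0.
suff [t ht] : exists t : R, cis t = ((nc z)^-1)%:C%C * z.
  exists (Complex (ln (nc z)) t); rewrite cexpE /= lnK// ht mulrA -rmorphM /= divff ?gt_eqF//.
  by rewrite mul1r.
move: z z0 r0 => [a b] z0 r0.
set r := nc _ in r0 *.
have ab : a ^+ 2 + b ^+ 2 = r ^+ 2.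
  by rewrite /r /nc /normc sqr_sqrtr// addr_ge0 ?sqr_ge0.
have ar : (a / r) ^+ 2 + (b / r) ^+ 2 = 1 by rewrite !expr_div_n -mulrDl ab divff//
  expf_neq0 ?gt_eqF.
have i1 : -1 <= a / r <= 1.
  have : (a / r) ^+ 2 <= 1 by rewrite -ar lerDl sqr_ge0.
  by move: (a / r) => q q1; apply/andP; split; nra.
have E x y : Complex x y = (r^-1)%:C%C * (Complex a b : CC R) <-> x = a / r /\ y = b / r.
  split=> [|[-> ->]]; last by apply: complex_eqE; rewrite /= mul0r ?subr0 ?addr0 mulrC.
  by move=> [-> ->]; rewrite !mul0r subr0 addr0 !(mulrC r^-1).
have [b0|b0] := leP 0 b.
  exists (acos (a / r)); apply/E; rewrite sin_acos// acosK ?in_itv//; split => //.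
  by rewrite -ar addrAC subrr add0r sqrtr_sqr ger0_norm// divr_ge0// ltW.
exists (- acos (a / r)); apply/E; rewrite cosN sinN sin_acos// acosK ?in_itv//; split => //.
rewrite -ar addrAC subrr add0r sqrtr_sqr ltr0_norm ?opprK//.
by rewrite pmulr_llt0 ?invr_gt0.
Qed.

Lemma real_der_eps (f : R -> R) l : is_derive (0 : R) 1 f l -> forall e : R, 0 < e ->
  exists2 d : R, 0 < d &
  forall h : R, `|h| < d -> `|f h - f 0 - l * h| <= e * `|h|.
Proof.
move=> /is_derive_near H e e0; have /nbhs_RP[d d0 hd] := H _ e0.
by exists d => // h hh; have := hd h; rewrite subr0 add0r; exact.
Qed.

Lemma cder_cexp z : cder (@cexp R) z (cexp z).
Proof.
suff H : cder (@cexp R) 0 1.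
  apply: (@cder_ext _ (fun w => cexp z * cexp (w + - z))).
    by move=> w; rewrite -cexpD addrC subrK.
  by rewrite -[X in cder _ _ X]mulr1; apply/cderZ/cder_shift; rewrite subrr.
move=> e e0.
(* The real and the imaginary error are each at most 3 e' |h|; the cap at 1 serves to bound [expR a]
   by 2. *)
pose e' := Num.min (e / 6) 1.
have e'0 : 0 < e' by rewrite lt_min ltr01 divr_gt0.
have e'1 : e' <= 1 by rewrite ge_min lexx orbT.
have e'e : 6 * e' <= e by rewrite mulrC -ler_pdivlMr// ge_min lexx.
have [d1 d10 h1] := real_der_eps (is_derive_expR 0) e'0.
have [d2 d20 h2] := real_der_eps (is_derive_cos 0) e'0.
have [d3 d30 h3] := real_der_eps (is_derive_sin 0) e'0.
exists (Num.min (e' / 2) (Num.min d1 (Num.min d2 d3)));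
  first by rewrite !lt_min d10 d20 d30 divr_gt0.
move=> [a b]; set h := Complex a b : CC R;
  rewrite !lt_min => /andP[he /andP[hd1 /andP[hd2 hd3]]].
have ha : `|a| <= nc h := Re_le_nc h.
have hb : `|b| <= nc h := Im_le_nc h.
have {}h1 := h1 a (le_lt_trans ha hd1).
have {}h2 := h2 b (le_lt_trans hb hd2).
have {}h3 := h3 b (le_lt_trans hb hd3).
move: h1 h2 h3; rewrite expR0 cos0 sin0 oppr0 !mul0r !mul1r !subr0 !addr0 => h1 h2 h3.
rewrite add0r cexp0.
have h0 := nc_ge0 h.
have ea : `|expR a - 1| <= e'.
  have := ler_normD (expR a - 1 - a) a; rewrite subrK => q; apply: le_trans q _.
  apply: le_trans (lerD h1 (lexx _)) _.
  have := normr_ge0 a; nra.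
have ea2 : `|expR a| <= 2.
  have := ler_normD (expR a - 1) 1; rewrite subrK normr1 => q; apply: le_trans q _; lra.
apply: le_trans (nc_le_ReIm _) _.
rewrite !ReD !ImD !ReN !ImN /= subr0.
have r1 : `|expR a * cos b - 1 - a| <= 3 * e' * nc h.
  rewrite (_ : _ - _ - _ = (expR a - 1 - a) + expR a * (cos b - 1)); last by ring.
  apply: le_trans (ler_normD _ _) _; rewrite normrM.
  have : `|expR a| * `|cos b - 1| <= 2 * (e' * nc h).
    by apply: ler_pM => //; apply: le_trans h2 _; rewrite ler_pM2l.
  have : e' * `|a| <= e' * nc h by rewrite ler_pM2l.
  lra.
have r2 : `|expR a * sin b - b| <= 3 * e' * nc h.
  rewrite (_ : _ - _ = expR a * (sin b - b) + (expR a - 1) * b); last by ring.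
  apply: le_trans (ler_normD _ _) _; rewrite !normrM.
  have : `|expR a| * `|sin b - b| <= 2 * (e' * nc h).
    by apply: ler_pM => //; apply: le_trans h3 _; rewrite ler_pM2l.
  have : `|expR a - 1| * `|b| <= e' * nc h by apply: ler_pM.
  lra.
have fin : 3 * e' * nc h + 3 * e' * nc h <= e * nc h.
  by have := ler_wpM2r h0 e'e; lra.
exact: le_trans (lerD r1 r2) fin.
Qed.

End ComplexExp.

(** * Circle means and Cauchy's formula *)

Section Tube.
Variable R : realType.

(** Tube lemma: by compactness of the segment, joint continuity at the points of the slice t = t0
    becomes uniform along it. It lets limits pass under circle means and under Cauchy's estimate. *)
Lemma tube_segment (T : topologicalType) (t0 : T) (F : T -> R -> CC R) (a b e : R) :
  (forall x, a <= x <= b -> forall k : R, 0 < k ->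
     \forall y \near x & t \near t0, nc (F t y - F t0 x) < k) -> 0 < e ->
  \forall t \near t0, forall x, a <= x <= b -> nc (F t x - F t0 x) < e.
Proof.
move=> H e0.
have /compact_near_coveringP/(_ T (nbhs t0) (fun t x => nc (F t x - F t0 x) < e)) cov :=
  @segment_compact R a b.
have e2 : 0 < e / 2 by rewrite divr_gt0.
apply: filterS (cov _ _) => [t ht x xab|x]; first by apply: ht; rewrite /= in_itv.
rewrite /= in_itv /= => xab; have := H _ xab _ e2.
move=> [[U V] /= [hU hV] UV]; exists (U, V) => //= -[y t] /= [Uy Vt].
rewrite (_ : _ - _ = (F t y - F t0 x) - (F t0 y - F t0 x)); last by ring.
apply: le_lt_trans (ncB _ _) _.
have := UV (y, t) (conj Uy Vt); have /= := UV (y, t0) (conj Uy (nbhs_singleton hV)); lra.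
Qed.

End Tube.

Section CircleMean.
Variable R : realType.
Implicit Types (f g phi : CC R -> CC R) (z w k l c : CC R) (r s x : R).

Lemma pi2_gt0 : 0 < pi *+ 2 :> R.
Proof. by rewrite pmulrn_lgt0// pi_gt0. Qed.

Lemma rcont_cis x : rcont (@cis R) x.
Proof.
have h : {for x, continuous (fun s => cos s : R)} := @continuous_cos R x.
have h' : {for x, continuous (fun s => sin s : R)} := @continuous_sin R x.
move=> e e0; have e2 : 0 < e / 2 by rewrite divr_gt0.
have /h/nbhs_RP[d1 d10 h1] : nbhs (cos x) [set y | `|y - cos x| < e / 2].
  by apply/nbhs_RP; exists (e / 2).
have /h'/nbhs_RP[d2 d20 h2] : nbhs (sin x) [set y | `|y - sin x| < e / 2].
  by apply/nbhs_RP; exists (e / 2).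
exists (Num.min d1 d2); first by rewrite lt_min d10.
move=> y; rewrite lt_min => /andP[/h1 /= b1 /h2 /= b2].
by apply: le_lt_trans (nc_complexB _ _ _ _) _; lra.
Qed.

Lemma rcont_circle phi r x : ccont phi (r%:C%C * cis x) ->
  rcont (fun s => phi (r%:C%C * cis s)) x.
Proof.
move=> H e e0; have [d d0 h] := H _ e0.
have B : 0 < 1 + `|r| by have := normr_ge0 r; lra.
have [|d' d'0 h'] := @rcont_cis x (d / (1 + `|r|)); first by rewrite divr_gt0.
exists d' => // y /h'; rewrite ltr_pdivlMr// => hy; apply: h.
rewrite -mulrBr ncM nc_real; have := nc_ge0 (cis y - cis x); have := normr_ge0 r; nra.
Qed.

Lemma circle_bounded (u : R -> CC R) a b : (forall x, rcont u x) -> exists K : R, forall x,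
  a <= x <= b -> nc (u x) <= K.
Proof.
move=> cu; have [ab|ba] := leP a b; last first.
  by exists 0 => x /andP[ax xb]; lra.
have [|c _ hc] := @EVT_max R (fun x => nc (u x)) a b ab.
  apply: continuous_in_subspaceT => x _ P /nbhs_RP[e e0 hP].
  have [d d0 h] := cu x _ e0; apply/nbhs_RP; exists d => // y /h hy; apply: hP.
  rewrite ltr_norml; have := ncD (u y - u x) (u x); have := ncD (u x - u y) (u y).
  by rewrite !subrK (ncBC (u x)) => ? ?; apply/andP; split; lra.
by exists (nc (u c)) => x xab; apply: hc; rewrite in_itv.
Qed.

(** The contour integral of phi(w) dw / (2 pi i w) over the circle of radius r about 0. *)
Definition cmean phi r : CC R :=
  ((pi *+ 2)^-1)%:C%C * cint 0 (pi *+ 2) (fun x => phi (r%:C%C * cis x)).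

Lemma nc_2piV : nc (((pi *+ 2)^-1)%:C%C : CC R) = (pi *+ 2)^-1.
Proof. by rewrite nc_real gtr0_norm// invr_gt0 pi2_gt0. Qed.

Lemma cmean_le phi r K : (forall x, rcont (fun s => phi (r%:C%C * cis s)) x) ->
  (forall x, 0 <= x <= pi *+ 2 -> nc (phi (r%:C%C * cis x)) <= K) ->
  nc (cmean phi r) <= 2 * K.
Proof.
move=> cphi hK; rewrite /cmean ncM nc_2piV.
have := @cint_le R 0 (pi *+ 2) _ K (ltW pi2_gt0) cphi hK.
by rewrite subr0 (mulrC _^-1) ler_pdivrMr ?pi2_gt0.
Qed.

Lemma cmeanD phi psi r : (forall x, rcont (fun s => phi (r%:C%C * cis s)) x) ->
  (forall x, rcont (fun s => psi (r%:C%C * cis s)) x) ->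
  cmean (fun z => phi z + psi z) r = cmean phi r + cmean psi r.
Proof. by move=> h1 h2; rewrite /cmean cintD// mulrDr. Qed.

Lemma cmeanZ phi c r : (forall x, rcont (fun s => phi (r%:C%C * cis s)) x) ->
  cmean (fun z => c * phi z) r = c * cmean phi r.
Proof. by move=> h1; rewrite /cmean cintZ// mulrCA. Qed.

Lemma cmean_eq phi psi r : (forall x, phi (r%:C%C * cis x) = psi (r%:C%C * cis x)) ->
  cmean phi r = cmean psi r.
Proof. by move=> H; rewrite /cmean; congr (_ * cint _ _ _); apply/funext. Qed.

Lemma cmean_cst c r : cmean (fun=> c) r = c.
Proof.
rewrite /cmean (cintE (U := fun x => c * x%:C%C)).
  rewrite -mulrBr -rmorphB subr0 mulrC -mulrA -rmorphM /= divff ?gt_eqF ?pi2_gt0//.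
  by rewrite mulr1.
move=> x e e0; exists 1 => // h _.
by rewrite rmorphD /= mulrDr [c * x%:C%C + _]addrC addrK subrr nc0 mulr_ge0// ltW.
Qed.

Lemma cmean0 phi : cmean phi 0 = phi 0.
Proof.
by rewrite -[RHS](cmean_cst _ 0); apply: cmean_eq => x; rewrite !mul0r.
Qed.

Lemma cmean_cont phi r : (forall z, ccont phi z) -> forall e : R, 0 < e ->
  exists2 d : R, 0 < d & forall s, `|s - r| < d -> nc (cmean phi s - cmean phi r) < e.
Proof.
move=> cphi e e0.
have cc s x : rcont (fun x => phi (s%:C%C * cis x)) x by exact: rcont_circle.
have e3 : 0 < e / 3 by rewrite divr_gt0.
have [|d d0 h] := (nbhs_RP _ _).1 (@tube_segment R R r (fun s x => phi (s%:C%C * cis x)) 0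
  (pi *+ 2) (e / 3) _ e3).
  move=> x _ k k0; have [t t0 ht] := cphi (r%:C%C * cis x) _ k0.
  have B : 0 < 1 + `|r| by have := normr_ge0 r; lra.
  have [|d' d'0 h'] := @rcont_cis x (t / 2 / (1 + `|r|)); first by rewrite !divr_gt0.
  exists ([set y | `|y - x| < d'], [set s | `|s - r| < t / 2]).
    by split; apply/nbhs_RP; [exists d'|exists (t / 2); rewrite ?divr_gt0].
  move=> -[y s] /= [/h' hy hs]; apply: ht.
  rewrite (_ : _ - _ = (s - r)%:C%C * cis y + r%:C%C * (cis y - cis x));
    last by rewrite rmorphB /=; ring.
  apply: le_lt_trans (ncD _ _) _; rewrite !ncM !nc_real nc_cis mulr1.
  move: hy; rewrite ltr_pdivlMr// => hy.
  have := nc_ge0 (cis y - cis x); have := normr_ge0 r; nra.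
exists d => // s /h hs; rewrite /cmean -mulrBr ncM nc_2piV.
have -> : cint 0 (pi *+ 2) (fun x => phi (s%:C%C * cis x)) - cint 0 (pi *+ 2) (fun x => phi
  (r%:C%C * cis x))
   = cint 0 (pi *+ 2) (fun x => phi (s%:C%C * cis x) + -1 * phi (r%:C%C * cis x)).
  by rewrite cintD// ?cintZ ?mulN1r// => x; have := @rcont_circle (fun z => -1 * phi z) r x;
     apply => k k0; have [t t0 ht] := cphi (r%:C%C * cis x) _ k0; exists t => // w /ht;
     rewrite !mulN1r -opprD ncN.
have := @cint_le R 0 (pi *+ 2) (fun x => phi (s%:C%C * cis x) +
  -1 * phi (r%:C%C * cis x)) (e / 3) (ltW pi2_gt0).
rewrite subr0 => hh.
rewrite mulrC ltr_pdivrMr ?pi2_gt0//; apply: le_lt_trans (hh _ _) _.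
- move=> x k k0; have k2 : 0 < k / 2 by rewrite divr_gt0.
  have [d1 d10 h1] := cc s x _ k2; have [d2 d20 h2] := cc r x _ k2.
  exists (Num.min d1 d2); first by rewrite lt_min d10.
  move=> y; rewrite lt_min => /andP[/h1 b1 /h2 b2].
  rewrite (_ : _ - _ = (phi (s%:C%C * cis y) - phi (s%:C%C * cis x)) -
     (phi (r%:C%C * cis y) - phi (r%:C%C * cis x))); last by ring.
  apply: le_lt_trans (ncB _ _) _; lra.
- by move=> x xx; rewrite mulN1r ltW// hs.
by rewrite ltr_pM2r ?pi2_gt0//; lra.
Qed.

(* The function [phi (cexp w)] has period 2 pi i, so the horizontal sides of its
   boundary integral over a strip of height 2 pi cancel. *)
Lemma cmean_const phi r s : 0 < r -> r <= s -> (forall z, z != 0 -> ccont phi z) ->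
  (forall z, r <= nc z <= s -> exists l, cder phi z l) -> cmean phi r = cmean phi s.
Proof.
move=> r0 rs cphi dphi.
have s0 : 0 < s by apply: lt_le_trans rs.
pose g w := phi (cexp w).
have cg w : ccont g w.
  move=> e e0; have [d d0 h] := cphi _ (cexp_neq0 w) _ e0.
  have [d' d'0 h'] := cder_cont (cder_cexp w) d0.
  by exists d' => // w' /h' /h.
have lrs : ln r <= ln s by rewrite ler_ln ?posrE.
have := @goursat R g (ln r) (ln s) 0 (pi *+ 2) lrs (ltW pi2_gt0) cg.
have E (t x : R) : 0 < t -> g (Complex (ln t) x) = phi (t%:C%C * cis x).
  by move=> t0; rewrite /g cexpE /= lnK.
rewrite /boundary => H.
have hE : hline g 0 = hline g (pi *+ 2).
  apply/funext => x; rewrite /hline /g !cexpE /=.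
  by rewrite -[pi *+ 2]add0r cis2pi.
have vE t : 0 < t -> vline g (ln t) = fun x => phi (t%:C%C * cis x).
  by move=> t0; apply/funext => x; rewrite /vline E.
have key (A B C : CC R) : A + B - A - C = B - C by ring.
move: H; rewrite hE !vE// key => H.
rewrite /cmean; congr (_ * _); apply/esym/eqP.
have : Complex 0 1 != 0 :> CC R by rewrite -nc_gt0 nc_ii.
move=> /mulfI i0; rewrite -subr_eq0; apply/eqP; apply: i0; rewrite mulr0 mulrBr; apply: H.
move=> x y /andP[rx xs] _.
have [|l hl] := dphi (cexp (Complex x y)).
  by rewrite nc_cexp /= -[r]lnK ?posrE// -[s]lnK ?posrE// !ler_expR rx.
exists (l * cexp (Complex x y)); exact: cder_comp (cder_cexp _) hl.
Qed.

(* The circle through the exceptional point is crossed by continuity of the mean,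
   so no theorem on removable singularities is needed. *)
Lemma cmean_mvp phi z r : 0 <= r -> (forall w, ccont phi w) ->
  (forall w, w != z -> exists l, cder phi w l) -> cmean phi r = phi 0.
Proof.
move=> r0 cphi dphi; rewrite -cmean0.
pose t := nc z.
have lim (p : R) c : (forall d : R, 0 < d -> exists2 s, `|s - p| < d & cmean phi s = c) ->
    cmean phi p = c.
  move=> H; apply/eqP; rewrite -subr_eq0 -nc_eq0; apply: contraT => nz.
  have e0 : 0 < nc (cmean phi p - c) by rewrite lt_def nz nc_ge0.
  have [d d0 h] := cmean_cont p cphi e0.
  by have [s /h + E] := H _ d0; rewrite E ncBC ltxx.
(* The annulus p <= |w| <= q avoids the circle of radius t, which carries the exceptional point. *)
have const (p q : R) : 0 < p -> p <= q -> (q < t) || (t < p) -> cmean phi p = cmean phi q.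
  move=> p0 pq tpq; apply: cmean_const => // w /andP[pw wq]; apply: dphi.
  by apply/eqP => wz; move: tpq pw wq; rewrite wz -/t => /orP[]; lra.
have inside (p : R) : 0 < p < t -> cmean phi p = cmean phi 0.
  move=> /andP[p0 pt]; apply/eqP; rewrite -subr_eq0 -nc_eq0; apply: contraT => nz.
  have e0 : 0 < nc (cmean phi p - cmean phi 0) by rewrite lt_def nz nc_ge0.
  have [d d0 h] := cmean_cont 0 cphi e0.
  have m0 : 0 < Num.min (d / 2) p by rewrite lt_min p0 divr_gt0.
  have md : Num.min (d / 2) p < d by rewrite gt_min; apply/orP; left; lra.
  have := h (Num.min (d / 2) p); rewrite subr0 gtr0_norm// => /(_ md).
  by rewrite (const _ p) ?ltxx// ?ge_min ?lexx ?orbT// pt.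
have at_t : cmean phi t = cmean phi 0.
  have [->//|t0] := eqVneq t 0.
  have tp : 0 < t by rewrite lt_def t0 nc_ge0.
  apply: lim => d d0; exists (t - Num.min (d / 2) (t / 2)).
    rewrite addrAC subrr add0r normrN gtr0_norm ?lt_min ?divr_gt0//.
    by rewrite gt_min; apply/orP; left; lra.
  have : 0 < Num.min (d / 2) (t / 2) by rewrite lt_min !divr_gt0.
  have : Num.min (d / 2) (t / 2) <= t / 2 by rewrite ge_min lexx orbT.
  by move=> *; apply: inside; apply/andP; split; lra.
have [rt|tr|->//] := ltgtP r t.
  by move: r0; rewrite le_eqVlt => /predU1P[<-//|r0]; apply: inside; rewrite r0.
have t0 : 0 <= t := nc_ge0 z.
rewrite -at_t; apply/esym; apply: lim => d d0.
exists (Num.min (t + d / 2) r).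
  have : 0 < d / 2 by rewrite divr_gt0.
  by move=> d2; rewrite ltr_norml; case: (leP (t + d / 2) r) => cmp; apply/andP; split; lra.
apply: const; first by rewrite lt_min; apply/andP; split; lra.
  by rewrite ge_min lexx orbT.
by apply/orP; right; rewrite lt_min tr andbT; lra.
Qed.

End CircleMean.

(** * Power series of entire functions *)

Section Sums.
Variable R : realType.
Implicit Types (a b : nat -> CC R) (s t c z : CC R).

Definition csums a s := forall e : R, 0 < e -> exists N : nat, forall n, (N <= n)%N ->
  nc (\sum_(k < n) a k - s) < e.

Lemma csums_unique a s t : csums a s -> csums a t -> s = t.
Proof.
move=> hs ht; apply/eqP; rewrite -subr_eq0 -nc_eq0; apply: contraT => nz.
have e0 : 0 < nc (s - t) / 2 by rewrite divr_gt0// lt_def nz nc_ge0.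
have [N hN] := hs _ e0; have [M hM] := ht _ e0.
have := hN _ (leq_maxl N M); have := hM _ (leq_maxr N M).
set S := \sum_(_ < _) _.
have := ncB (S - t) (S - s); rewrite (_ : S - t - (S - s) = s - t); last by ring.
lra.
Qed.

Lemma csumsD a b s t : csums a s -> csums b t -> csums (fun k => a k + b k) (s + t).
Proof.
move=> hs ht e e0; have e2 : 0 < e / 2 by rewrite divr_gt0.
have [N hN] := hs _ e2; have [M hM] := ht _ e2; exists (maxn N M) => n.
rewrite geq_max => /andP[/hN h1 /hM h2]; rewrite big_split /=.
rewrite (_ : _ - _ = (\sum_(k < n) a k - s) + (\sum_(k < n) b k - t)); last by ring.
by apply: le_lt_trans (ncD _ _) _; lra.
Qed.

Lemma csumsZ a s c : csums a s -> csums (fun k => c * a k) (c * s).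
Proof.
move=> hs e e0; have B : 0 < 1 + nc c by have := nc_ge0 c; lra.
have [|N hN] := hs (e / (1 + nc c)); first by rewrite divr_gt0.
exists N => n /hN; rewrite -mulr_sumr -mulrBr ncM ltr_pdivlMr//.
have := nc_ge0 (\sum_(k < n) a k - s); nra.
Qed.

Lemma csums_ext a b s : a =1 b -> csums a s -> csums b s.
Proof. by move=> /funext ->. Qed.

Lemma csums_le a s (b : nat -> R) B : csums a s -> (forall k, nc (a k) <= b k) ->
  (forall n, \sum_(k < n) b k <= B) -> nc s <= B.
Proof.
move=> hs hab hB; rewrite leNgt; apply/negP => Bs.
have e0 : 0 < nc s - B by rewrite subr_gt0.
have [N hN] := hs _ e0; have := hN _ (leqnn N).
set S := \sum_(_ < _) _ => h.
have : nc S <= B.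
  by apply: le_trans (hB N); apply: le_trans (nc_sum _ _ _) _; apply: ler_sum.
have := ncB S (S - s); rewrite (_ : S - (S - s) = s); last by ring.
lra.
Qed.

Lemma csumsS a s : csums a s <-> csums (fun k => a k.+1) (s - a 0%N).
Proof.
split=> H e e0; have [N hN] := H _ e0.
  exists N => n Nn; have := hN n.+1 (leqW Nn); rewrite big_ord_recl /=.
  rewrite (_ : _ + _ - _ = \sum_(k < n) a k.+1 - (s - a 0%N))//; last by ring.
exists N.+1 => -[//|n] Nn; have := hN n Nn; rewrite big_ord_recl /=.
rewrite (_ : _ + _ - s = \sum_(k < n) a k.+1 - (s - a 0%N))//; last by ring.
Qed.

Lemma sum_geo_le (C : R) n : 0 <= C -> \sum_(k < n) C * (2^-1) ^+ k <= 2 * C.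
Proof.
move=> C0; suff -> : \sum_(k < n) C * (2^-1) ^+ k = 2 * C - 2 * C * 2^-1 ^+ n.
  by rewrite gerBl ?mulr_ge0// exprn_ge0 ?invr_ge0.
elim: n => [|n ih]; first by rewrite big_ord0 expr0; ring.
by rewrite big_ord_recr /= ih exprS; field.
Qed.

Lemma csums_ex a (C : R) : (forall k, nc (a k) <= C * (2^-1) ^+ k) -> exists s, csums a s.
Proof.
move=> hC.
have key (u : nat -> R) : (forall k, `|u k| <= C * (2^-1) ^+ k) ->
    exists l : R, forall e : R, 0 < e -> exists N : nat, forall n, (N <= n)%N ->
      `|\sum_(k < n) u k - l| < e.
  move=> hu; have C0 : 0 <= C by have := hu 0%N; rewrite expr0 mulr1; exact: le_trans.
  have cvu : cvgn (series u).
    apply: normed_cvg; apply: (@series_le_cvg R _ (geometric C 2^-1)) => [n|n|n|].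
    - exact: normr_ge0.
    - by rewrite /geometric /= mulr_ge0 ?exprn_ge0 ?invr_ge0.
    - exact: hu.
    apply: is_cvg_geometric_series; rewrite ger0_norm ?invr_ge0// invf_lt1//; lra.
  exists (limn (series u)) => e e0.
  move/cvgrPdist_lt : cvu => /(_ e e0)[N _ hN]; exists N => n /hN.
  by rewrite /series /= big_mkord distrC.
have [|x hx] := key (fun k => complex.Re (a k)).
  by move=> k; apply: le_trans (Re_le_nc _) (hC k).
have [|y hy] := key (fun k => complex.Im (a k)).
  by move=> k; apply: le_trans (Im_le_nc _) (hC k).
have ReS n : complex.Re (\sum_(k < n) a k) = \sum_(k < n) complex.Re (a k).
  by elim: n => [|n ih]; rewrite ?big_ord0// !big_ord_recr /= ReD ih.
have ImS n : complex.Im (\sum_(k < n) a k) = \sum_(k < n) complex.Im (a k).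
  by elim: n => [|n ih]; rewrite ?big_ord0// !big_ord_recr /= ImD ih.
exists (Complex x y) => e e0; have e2 : 0 < e / 2 by rewrite divr_gt0.
have [N hN] := hx _ e2; have [M hM] := hy _ e2; exists (maxn N M) => n.
rewrite geq_max => /andP[/hN h1 /hM h2].
apply: le_lt_trans (nc_le_ReIm _) _; rewrite ReD ImD ReN ImN ReS ImS /=; lra.
Qed.

End Sums.

Section PowerSeries.
Variable R : realType.
Implicit Types (a b : nat -> CC R) (f g : CC R -> CC R) (z w h c : CC R) (r C : R).

(** Infinite radius of convergence, expressed by Cauchy-type bounds at every radius. Doubling the
    radius turns such a bound into domination by a geometric series of ratio 1/2, the only
    comparison series used. *)
Definition ecoef a := forall r, 0 < r -> exists C, forall k, nc (a k) * r ^+ k <= C.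

Definition psum a f := ecoef a /\ forall z, csums (fun k => a k * z ^+ k) (f z).

Lemma ecoef_half a r : ecoef a -> 0 < r -> exists2 C, 0 <= C &
  forall k, nc (a k) * r ^+ k <= C * (2^-1) ^+ k.
Proof.
move=> ha r0; have [|C hC] := ha (2 * r); first by rewrite mulr_gt0.
exists C; first by have := hC 0%N; rewrite expr0 mulr1; apply: le_trans; exact: nc_ge0.
move=> k; rewrite exprVn ler_pdivlMr ?exprn_gt0//; apply: le_trans (hC k).
by rewrite exprMn -mulrA (mulrC (r ^+ k)).
Qed.

Lemma psum_ex a : ecoef a -> exists f, psum a f.
Proof.
move=> ha; suff /choice[f hf] : forall z, exists s,
  csums (fun k => a k * z ^+ k) s by exists f.
move=> z; have r0 : 0 < nc z + 1 by have := nc_ge0 z; lra.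
have [C C0 hC] := ecoef_half ha r0; apply: (@csums_ex _ _ C) => k.
apply: le_trans (hC k); rewrite ncM ncX ler_wpM2l ?nc_ge0// lerXn2r ?nnegrE ?nc_ge0 ?(ltW
  r0)//.
by rewrite lerDl.
Qed.

Lemma psum_ext a b f g : a =1 b -> f =1 g -> psum a f -> psum b g.
Proof. by move=> /funext -> /funext ->. Qed.

Definition taylor_rem k z h : CC R := (z + h) ^+ k - z ^+ k - k%:R * z ^+ k.-1 * h.

(** The recurrence [rem (k+1) = (z + h) rem k + k z^(k-1) h^2] gives the bound k^2 r^k |h|^2, and
    k^2 <= 4^k lets the radius 4 r absorb the polynomial factor. *)
Lemma taylor_rem_le k z h r : nc z + 1 <= r -> nc h <= 1 ->
  nc (taylor_rem k z h) <= (4 * r) ^+ k * nc h ^+ 2.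
Proof.
move=> zr h1; have z0 := nc_ge0 z; have h0 := nc_ge0 h.
have r1 : 1 <= r by lra.
have rr0 : 0 <= r by lra.
have : nc (taylor_rem k z h) <= (k ^ 2)%:R * r ^+ k * nc h ^+ 2.
  elim: k => [|k ih]; first by rewrite /taylor_rem !expr0 !mul0r subrr subr0 nc0.
  have -> : taylor_rem k.+1 z h = (z + h) * taylor_rem k z h + k%:R * z ^+ k.-1 * h ^+ 2.
    rewrite /taylor_rem; case: k {ih} => [|k]; first by rewrite !expr1 !expr0; ring.
    by rewrite /= !exprS -[k.+2%:R]natr1; ring.
  apply: le_trans (ncD _ _) _; rewrite !ncM !ncX nc_nat.
  have e1 : nc (z + h) * nc (taylor_rem k z h) <= r * ((k ^ 2)%:R * r ^+ k * nc h ^+ 2).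
    by apply: ler_pM => //; rewrite ?nc_ge0//; apply: le_trans (ncD _ _) _; lra.
  have e2 : k%:R * nc z ^+ k.-1 * nc h ^+ 2 <= k%:R * r ^+ k.+1 * nc h ^+ 2.
    rewrite ler_wpM2r ?exprn_ge0// ler_wpM2l//.
    apply: (@le_trans _ _ (r ^+ k.-1)); first by rewrite lerXn2r ?nnegrE//; lra.
    by apply: ler_weXn2l => //; case: (k) => // n; rewrite ltnW// ltnW.
  apply: le_trans (lerD e1 e2) _.
  rewrite (_ : r * _ + _ = (k ^ 2 + k)%:R * r ^+ k.+1 * nc h ^+ 2);
    last by rewrite natrD (exprS r k); ring.
  rewrite ler_wpM2r ?exprn_ge0// ler_wpM2r ?exprn_ge0// ler_nat.
  by rewrite -!mulnn mulSn mulnS; lia.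
move/le_trans; apply; rewrite ler_wpM2r ?exprn_ge0// exprMn ler_wpM2r ?exprn_ge0//.
rewrite -natrX ler_nat (_ : 4 = 2 ^ 2)%N// -expnM mulnC expnM leq_exp2r//.
by rewrite ltnW// ltn_expl.
Qed.

Definition dcoef a : nat -> CC R := fun k => k.+1%:R * a k.+1.

Lemma ecoef_d a : ecoef a -> ecoef (dcoef a).
Proof.
move=> ha r r0; have r1 : 0 < r + 1 by lra.
have [|C C0 hC] := @ecoef_half a (2 * (r + 1)) ha; first by rewrite mulr_gt0.
exists C => k; rewrite /dcoef ncM nc_nat.
apply: le_trans (_ : C * 2^-1 ^+ k.+1 <= _); last first.
  by rewrite ler_piMr// exprn_ile1// ?invr_ge0// invf_le1//; lra.
apply: le_trans (hC k.+1); rewrite mulrAC mulrC ler_wpM2l ?nc_ge0// exprMn;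
  apply: ler_pM => //.
- by rewrite exprn_ge0// ltW.
- by rewrite -natrX ler_nat ltnW// ltn_expl.
apply: (@le_trans _ _ ((r + 1) ^+ k)); first by rewrite lerXn2r ?nnegrE//; lra.
by rewrite exprS ler_peMl ?exprn_ge0//; lra.
Qed.

(** The remainder of f is the series of the [taylor_rem]. Their quadratic bounds sum up since the
    coefficients are controlled at radius 4 (|z| + 1), so the termwise derivative is the
    derivative. *)
Lemma psum_der a f : psum a f -> exists g, psum (dcoef a) g /\ forall z, cder f z (g z).
Proof.
move=> [ha hf]; have [g [hd hg]] := psum_ex (ecoef_d ha); exists g; split => // z.
have r0 : 0 < nc z + 1 by have := nc_ge0 z; lra.
have [|C C0 hC] := @ecoef_half a (4 * (nc z + 1)) ha; first by rewrite mulr_gt0.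
have quad h : nc h <= 1 -> nc (f (z + h) - f z - g z * h) <= 2 * C * nc h ^+ 2.
  move=> h1.
  have s1 : csums (fun k => k%:R * a k * z ^+ k.-1) (g z).
    apply/csumsS; rewrite !mul0r subr0; apply: csums_ext (hg z) => k.
    by rewrite /dcoef.
  have : csums (fun k => a k * taylor_rem k z h) (f (z + h) - f z - g z * h).
    have := csumsD (csumsD (hf (z + h)) (csumsZ (-1) (hf z))) (csumsZ (- h) s1).
    rewrite mulN1r mulNr (mulrC h); apply: csums_ext => k.
    by rewrite /taylor_rem; ring.
  move/csums_le => /(_ (fun k => C * nc h ^+ 2 * (2^-1) ^+ k)); apply.
    move=> k; rewrite ncM; apply: le_trans (ler_wpM2l (nc_ge0 _) (taylor_rem_le k (lexx _)
      h1)) _.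
    by rewrite mulrA [leRHS]mulrAC ler_wpM2r ?exprn_ge0 ?nc_ge0.
  by move=> n; rewrite -mulrA; apply: sum_geo_le; rewrite mulr_ge0 ?exprn_ge0 ?nc_ge0.
move=> e e0; have B : 0 < 2 * C + 1 by lra.
exists (Num.min 1 (e / (2 * C + 1))); first by rewrite lt_min ltr01 divr_gt0.
move=> h; rewrite lt_min ltr_pdivlMr// => /andP[/ltW/quad h1 h2].
apply: le_trans h1 _; rewrite expr2 mulrA ler_wpM2r ?nc_ge0//.
have := nc_ge0 h; nra.
Qed.

Definition entire f := forall z, exists l, cder f z l.

Lemma psum_entire a f : psum a f -> entire f.
Proof. by move=> /psum_der[g [_ hg]] z; exists (g z). Qed.

Lemma psum_at0 a f : psum a f -> f 0 = a 0%N.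
Proof.
move=> [_ /(_ 0) h]; apply: csums_unique h _; apply/csumsS.
rewrite expr0 mulr1 subrr => e e0; exists 0%N => n _.
by rewrite big1 ?subrr ?nc0// => k _; rewrite exprS mul0r mulr0.
Qed.

Lemma psum_derive1n a f n : psum a f -> derive1n n f 0 = n`!%:R * a n.
Proof.
elim: n a f => [|n ih] a f hf; first by rewrite /= mul1r; exact: psum_at0.
have [g [hg fg]] := psum_der hf.
rewrite /derive1n iterSr; have -> : derive1 f = g.
  by apply/funext => z; exact: cder_derive1.
rewrite [LHS](ih _ _ hg) /dcoef factS natrM; ring.
Qed.

Definition coef n f : CC R := (n`!%:R)^-1 * derive1n n f 0.

Lemma psum_coef a f n : psum a f -> coef n f = a n.
Proof.
by move=> /(psum_derive1n n) h; rewrite /coef h mulrA mulVf ?mul1r.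
Qed.

End PowerSeries.

(** * Cauchy's formula and the Taylor expansion of entire functions *)

Section CauchyFormula.
Variable R : realType.
Implicit Types (f g phi : CC R -> CC R) (z w k l c : CC R) (r s x : R).

Lemma ccontM f g z : ccont f z -> ccont g z -> ccont (fun w => f w * g w) z.
Proof.
move=> /ccont_continuous hf /ccont_continuous hg; apply/ccont_continuous.
exact: (@continuousM _ _ f g z hf hg).
Qed.

Lemma cder_expV n z : z != 0 -> exists l, cder (fun w => (w^-1) ^+ n) z l.
Proof. by move=> /cderV h; eexists; apply: (cder_comp h (cderX n _)). Qed.

Lemma geo_small (q K e : R) : 0 <= q < 1 -> 0 < e ->
  exists N : nat, forall n, (N <= n)%N -> K * q ^+ n < e.
Proof.
move=> /andP[q0 q1] e0.
have /cvgrPdist_lt /(_ e e0)[N _ hN] : geometric K q x @[x --> \oo] --> (0 : R).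
  by apply: cvg_geometric; rewrite ger0_norm.
exists N => n /hN /=; rewrite sub0r normrN; apply: le_lt_trans; exact: ler_norm.
Qed.

Lemma circle_neq0 r x : 0 < r -> r%:C%C * cis x != 0.
Proof. by move=> r0; rewrite -nc_gt0 ncM nc_cis mulr1 nc_real gtr0_norm. Qed.

Section Coefficients.
Variables (f : CC R -> CC R) (df : entire f).

(** Cauchy's integral for the n-th Taylor coefficient, over the unit circle; [aE] moves it to any
    radius. *)
Let a n := cmean (fun w => f w * (w^-1) ^+ n) 1.

Let der n z : z != 0 -> exists l, cder (fun w => f w * (w^-1) ^+ n) z l.
Proof.
move=> z0; have [l hl] := df z; have [m hm] := cder_expV n z0.
by eexists; exact: cderM hl hm.
Qed.

Lemma aE n r : 0 < r -> cmean (fun w => f w * (w^-1) ^+ n) r = a n.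
Proof.
move=> r0.
have cc z : z != 0 -> ccont (fun w => f w * (w^-1) ^+ n) z.
  by move=> /(der n)[l]; exact: cder_cont.
have dd s t : 0 < s -> forall z, s <= nc z <= t ->
  exists l, cder (fun w => f w * (w^-1) ^+ n) z l.
  by move=> s0 z /andP[sz _]; apply: der; rewrite -nc_gt0; exact: lt_le_trans sz.
have [r1|/ltW r1] := leP r 1; first exact: cmean_const (dd _ _ r0).
by apply/esym; apply: cmean_const (dd _ _ ltr01).
Qed.

Lemma cauchy_estimate n r B : 0 < r -> (forall x, 0 <= x <= pi *+ 2 ->
  nc (f (r%:C%C * cis x)) <= B) ->
  nc (a n) * r ^+ n <= 2 * B.
Proof.
move=> r0 hB; rewrite -(aE n r0) -ler_pdivlMr ?exprn_gt0// -mulrA.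
apply: cmean_le => x.
  by apply: (@rcont_circle R (fun w => f w * (w^-1) ^+ n));
    have [l] := der n (circle_neq0 x r0); exact: cder_cont.
move=> hx; rewrite ncM ncX ncV ncM nc_cis mulr1 nc_real gtr0_norm// exprVn.
by rewrite ler_wpM2r ?hB// invr_ge0 exprn_ge0// ltW.
Qed.

End Coefficients.

Lemma entire_cst c : entire (fun=> c).
Proof. by move=> z; exists 0; exact: cder_cst. Qed.

(** For n > 0 the mean is the same on every circle while the integrand decays with the radius, which
    forces it to vanish. *)
Lemma cmean_expV n : cmean (fun w => (w^-1) ^+ n) 1 = (n == 0%N)%:R :> CC R.
Proof.
case: n => [|n]; first by rewrite -[RHS](cmean_cst 1 1); apply: cmean_eq => x; rewrite expr0.
apply/eqP; rewrite -nc_eq0; apply: contraT => nz.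
set m := cmean _ _ in nz *.
have m0 : 0 < nc m by rewrite lt_def nz nc_ge0.
have mE : m = cmean (fun w => 1 * (w^-1) ^+ n.+1) 1 by apply: cmean_eq => x; rewrite mul1r.
(* With this radius Cauchy's estimate for the constant 1 would give 4 + nc m <= 2. *)
have r0 : 1 < 4 / nc m + 1 by rewrite ltrDr divr_gt0.
have := @cauchy_estimate _ (entire_cst 1) n.+1 (4 / nc m + 1) 1 _ _.
rewrite -mE nc1 => /(_ (lt_trans ltr01 r0) (fun _ _ => lexx _)).
have : nc m * (4 / nc m + 1) <= nc m * (4 / nc m + 1) ^+ n.+1.
  by rewrite ler_wpM2l ?nc_ge0// exprS ler_peMr ?exprn_ege1// ltW// (lt_trans ltr01).
rewrite mulrDr mulrCA divff ?gt_eqF// => h1 h2; lra.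
Qed.

(* [Phi w = (f w - f z) w / (w - z)] vanishes at 0, hence has mean 0 over large
   circles; expanding [w / (w - z)] in a finite geometric sum identifies [rem n] with
   the remainder of the expansion of [f] at order n. *)
Lemma entire_psum f : entire f -> exists2 a, psum a f &
  forall n r B, 0 < r -> (forall x, 0 <= x <= pi *+ 2 -> nc (f (r%:C%C * cis x)) <= B) ->
    nc (a n) * r ^+ n <= 2 * B.
Proof.
move=> df; pose a n := cmean (fun w => f w * (w^-1) ^+ n) 1.
have est := cauchy_estimate df.
exists a => //; split.
  move=> r r0; have [|K hK] := @circle_bounded R (fun x => f (r%:C%C * cis x)) 0 (pi *+ 2).
    by move=> x; apply: rcont_circle; have [l] := df (r%:C%C * cis x); exact: cder_cont.
  by exists (2 * K) => n; exact: est.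
move=> z; have [l hl] := df z.
pose r := nc z + 1; have r0 : 0 < r by rewrite /r; have := nc_ge0 z; lra.
(* The value at [z] is the limit of the quotient, which makes [Phi] continuous there, as [cmean_mvp]
   requires. *)
pose Phi w := if w == z then l * z else (f w - f z) / (w - z) * w.
have dPhi w : w != z -> exists m, cder Phi w m.
  move=> wz; have [m hm] := df w.
  have wz0 : w - z != 0 by rewrite subr_eq0.
  have h1 : cder (fun w => (w - z)^-1) w (- (w - z) ^- 2 * 1).
    apply: (@cder_comp _ (fun u => u^-1) (fun u => u - z)); last exact: cderV.
    by have := cderB (cder_id w) (cder_cst z w); rewrite subr0.
  have h2 := cderM (cderM (cderB hm (cder_cst (f z) w)) h1) (cder_id w).
  have wz1 : 0 < nc (w - z) by rewrite nc_gt0.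
  eexists; apply: (cder_near wz1 _ h2).
  move=> u uw; rewrite /Phi ifN//; apply/eqP => uz.
  by move: uw; rewrite uz ncBC ltxx.
have cPhi w : ccont Phi w.
  have [->|wz] := eqVneq w z; last by have [m] := dPhi w wz; exact: cder_cont.
  move=> e e0; have B : 0 < nc z + nc l + 1 by have := nc_ge0 z; have := nc_ge0 l; lra.
  have B' := mulr_gt0 (ltr0n R 2) B.
  have [|d d0 hd] := hl (Num.min 1 (e / (2 * (nc z + nc l + 1)))).
    by rewrite lt_min ltr01 divr_gt0.
  exists (Num.min d (e / (2 * (nc z + nc l + 1)))); first by rewrite lt_min d0 divr_gt0.
  move=> u; rewrite lt_min => /andP[ud ue]; rewrite /Phi eqxx.
  case: eqVneq => [_|uz]; first by rewrite subrr nc0.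
  have uz0 : u - z != 0 by rewrite subr_eq0.
  have := hd _ ud; rewrite (addrC z) subrK => hu.
  set q := (f u - f z) / (u - z).
  have : nc (q - l) <= Num.min 1 (e / (2 * (nc z + nc l + 1))).
    rewrite -(ler_pM2r (_ : 0 < nc (u - z))) ?nc_gt0// -ncM.
    by rewrite mulrBl /q mulfVK.
  rewrite le_min => /andP[q1 q2].
  rewrite (_ : _ - _ = (q - l) * z + q * (u - z)); last by ring.
  apply: le_lt_trans (ncD _ _) _; rewrite (ncM (q - l)) (ncM q).
  have qq : nc q <= 1 + nc l by have := ncD (q - l) l; rewrite subrK; lra.
  have a1 : nc (q - l) * nc z <= e / (2 * (nc z + nc l +
    1)) * nc z by rewrite ler_wpM2r ?nc_ge0.
  have a2 : nc q * nc (u - z) <= (1 + nc l) * (e / (2 * (nc z + nc l + 1))).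
    by apply: ler_pM; rewrite ?nc_ge0// ltW.
  have -> : e = e / (2 * (nc z + nc l + 1)) * (2 * (nc z + nc l +
    1)) by rewrite mulfVK ?gt_eqF.
  have : 0 < e / (2 * (nc z + nc l + 1)) by rewrite divr_gt0.
  move: (e / _) a1 a2 => q0 a1 a2 q00; have := nc_ge0 z; have := nc_ge0 l; nra.
have Phi0 : cmean Phi r = 0.
  rewrite (cmean_mvp (ltW r0) cPhi dPhi) /Phi; case: eqP => [<-|_]; by rewrite mulr0.
pose rem n := cmean (fun w => z ^+ n * ((w^-1) ^+ n * Phi w)) r.
have cV n w : w != 0 -> ccont (fun w => (w^-1) ^+ n) w.
  by move=> /(cder_expV n)[m]; exact: cder_cont.
have cf w : ccont f w by have [m] := df w; exact: cder_cont.
have rV n x : rcont (fun s => (((r%:C%C * cis s)^-1) ^+ n * Phi (r%:C%C * cis s))) x.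
  apply: (@rcont_circle R (fun w => (w^-1) ^+ n * Phi w)).
  by apply: ccontM => //; apply: cV; exact: circle_neq0.
(* Since (1 - z / w) w / (w - z) = 1, the integrand of the difference is z^n w^-n (f w - f z): the
   n-th term of the series, minus f z when n = 0. Summing over n telescopes. *)
have remS n : rem n - rem n.+1 = z ^+ n * a n - f z * z ^+ n * (n == 0%N)%:R.
  have remE (j : nat) : rem j = z ^+ j * cmean (fun w => (w^-1) ^+ j * Phi w) r by exact:
    cmeanZ.
  have -> : rem n - rem n.+1 = z ^+ n * (cmean (fun w => (w^-1) ^+ n * Phi w +
    (- z) * ((w^-1) ^+ n.+1 * Phi w)) r).
    rewrite cmeanD ?cmeanZ//; first by rewrite !remE exprS; ring.
    move=> x; apply: (@rcont_circle R (fun w => (- z) * ((w^-1) ^+ n.+1 * Phi w))).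
    apply: ccontM; first by apply: (@cder_cont _ _ _ 0); exact: cder_cst.
    by apply: ccontM => //; apply: cV; exact: circle_neq0.
  rewrite -cmean_expV.
  have -> : cmean (fun w => (w^-1) ^+ n) 1 = cmean (fun w => (w^-1) ^+ n) r :> CC R.
    have := @aE _ (entire_cst 1) n r r0.
    by rewrite (_ : (fun w => _) = (fun w => (w^-1) ^+ n)) => [<-//|]; apply/funext => w;
      rewrite mul1r.
  rewrite -[X in z ^+ n * X - _](@aE _ df n r r0).
  have -> : f z * z ^+ n * cmean (fun w => (w^-1) ^+ n) r = z ^+ n * cmean (fun w => f z *
    (w^-1) ^+ n) r.
    rewrite cmeanZ; first ring.
    by move=> x; apply: (@rcont_circle R (fun w => (w^-1) ^+ n)); apply: cV;
      exact: circle_neq0.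
  rewrite -mulrBr; congr (_ * _); apply/eqP; rewrite eq_sym subr_eq; apply/eqP.
  rewrite -cmeanD //.
  - apply: cmean_eq => x; have := circle_neq0 x r0; set w := _ * _ => w0.
    have wz : w != z.
      apply/eqP => wz; have : nc w = nc z by rewrite wz.
      by rewrite /w ncM nc_cis mulr1 nc_real gtr0_norm// /r => /eqP; lra.
    have wz0 : w - z != 0 by rewrite subr_eq0.
    rewrite /Phi ifN// exprS.
    by move: (w^-1 ^+ n) => v; field; rewrite wz0.
  - move=> x; apply: (@rcont_circle R (fun w => (w^-1) ^+ n * Phi w +
    (- z) * ((w^-1) ^+ n.+1 * Phi w))).
    have [m1 h1] := cder_expV n (circle_neq0 x r0).
    have [m2 h2] := cder_expV n.+1 (circle_neq0 x r0).
    have [|m3 h3] := dPhi (r%:C%C * cis x).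
      apply/eqP => wz; have : nc (r%:C%C * cis x) = nc z by rewrite wz.
      by rewrite ncM nc_cis mulr1 nc_real gtr0_norm// /r => /eqP; lra.
    exact: cder_cont (cderD (cderM h1 h3) (cderZ _ (cderM h2 h3))).
  - move=> x; apply: (@rcont_circle R (fun w => f z * (w^-1) ^+ n)).
    have [m1 h1] := cder_expV n (circle_neq0 x r0).
    exact: cder_cont (cderZ _ h1).
have remB : exists K, forall n, nc (rem n) <= K * (nc z / r) ^+ n.
  have [|K hK] := @circle_bounded R (fun x => Phi (r%:C%C * cis x)) 0 (pi *+ 2).
    by move=> x; exact: rcont_circle.
  exists (2 * K) => n; rewrite -mulrA; apply: cmean_le.
    move=> x; apply: (@rcont_circle R (fun w => z ^+ n * ((w^-1) ^+ n * Phi w))).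
    apply: ccontM; first by apply: (@cder_cont _ _ _ 0); exact: cder_cst.
    by apply: ccontM => //; apply: cV; exact: circle_neq0.
  move=> x hx; rewrite mulrA !ncM mulrC !ncX ncV ncM nc_cis mulr1 nc_real gtr0_norm//.
  by rewrite exprMn ler_wpM2r ?hK// -exprMn exprn_ge0// divr_ge0 ?nc_ge0// ltW.
have rem0 : rem 0%N = 0.
  by rewrite -Phi0; apply: cmean_eq => x; rewrite !expr0 !mul1r.
have sumE n : \sum_(k < n.+1) a k * z ^+ k - f z = - rem n.+1.
  elim: n => [|n ih].
    have E0 : - rem 1%N = 1 * a 0%N - f z * 1 * 1 by rewrite -sub0r -rem0; exact: remS.
    by rewrite E0 big_ord_recl big_ord0 expr0; move: (a _) => b; ring.
  rewrite big_ord_recr /= addrAC ih; have := remS n.+1; rewrite /= mulr0 subr0 => /eqP.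
  by rewrite subr_eq => /eqP ->; ring.
move=> e e0; have [K hK] := remB.
have q1 : 0 <= nc z / r < 1.
  by rewrite divr_ge0 ?nc_ge0 ?(ltW r0)//= ltr_pdivrMr// /r; lra.
have [N hN] := geo_small K q1 e0.
exists N.+1 => -[//|n] Nn; rewrite sumE ncN.
by apply: le_lt_trans (hK _) _; apply: hN; exact: leqW.
Qed.

End CauchyFormula.

(** * Coefficients, estimates and the equation z g' = f for entire functions *)

Section EntireFunctions.
Variable R : realType.
Implicit Types (a b : nat -> CC R) (f g : CC R -> CC R) (z w h c : CC R) (r C B : R).

Lemma entireD f g : entire f -> entire g -> entire (fun z => f z + g z).
Proof. by move=> hf hg z; have [k hk] := hf z; have [l hl] := hg z; eexists;
  exact: cderD hk hl. Qed.

Lemma entireM f g : entire f -> entire g -> entire (fun z => f z * g z).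
Proof. by move=> hf hg z; have [k hk] := hf z; have [l hl] := hg z; eexists;
  exact: cderM hk hl. Qed.

Lemma entire_id : entire (fun z : CC R => z).
Proof. by move=> z; exists 1; exact: cder_id. Qed.

Lemma entire_sum n (F : 'I_n -> CC R -> CC R) : (forall i, entire (F i)) ->
  entire (fun z => \sum_(i < n) F i z).
Proof.
move=> hF z; have /choice[L hL] : forall i, exists l, cder (F i) z l by move=> i; exact: hF.
by eexists; exact: cder_sum hL.
Qed.

Lemma ecoefD a b : ecoef a -> ecoef b -> ecoef (fun k => a k + b k).
Proof.
move=> ha hb r r0; have [C hC] := ha r r0; have [D hD] := hb r r0; exists (C + D) => k.
apply: le_trans (_ : (nc (a k) + nc (b k)) * r ^+ k <= _); last by rewrite mulrDl lerD.
by rewrite ler_wpM2r ?ncD// exprn_ge0// ltW.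
Qed.

Lemma ecoefZ a c : ecoef a -> ecoef (fun k => c * a k).
Proof.
move=> ha r r0; have [C hC] := ha r r0; exists (nc c * C) => k.
by rewrite ncM -mulrA ler_wpM2l ?nc_ge0.
Qed.

Lemma psumD a b f g : psum a f -> psum b g -> psum (fun k => a k + b k) (fun z => f z + g z).
Proof.
move=> [ha hf] [hb hg]; split=> [|z]; first exact: ecoefD.
by apply: csums_ext (csumsD (hf z) (hg z)) => k; rewrite mulrDl.
Qed.

Lemma psumZ a f c : psum a f -> psum (fun k => c * a k) (fun z => c * f z).
Proof.
move=> [ha hf]; split=> [|z]; first exact: ecoefZ.
by apply: csums_ext (csumsZ c (hf z)) => k; rewrite mulrA.
Qed.

Definition cons_seq c a : nat -> CC R := fun n => if n is m.+1 then a m else c.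

Lemma psum_cons a f c : psum a f -> psum (cons_seq c a) (fun z => c + z * f z).
Proof.
move=> [ha hf]; split=> [r r0|z].
  have [C hC] := ha r r0; exists (Num.max (nc c) (C * r)) => -[|k] /=.
    by rewrite mulr1 le_max lexx.
  by rewrite le_max; apply/orP; right; rewrite exprSr mulrA ler_wpM2r// ltW.
apply/csumsS; rewrite /= mulr1 addrC addKr.
by apply: csums_ext (csumsZ z (hf z)) => k; rewrite /= exprS mulrCA.
Qed.

Lemma psum_uncons a f : psum a f -> exists g, psum (fun k => a k.+1) g /\
  forall z, f z = a 0%N + z * g z.
Proof.
move=> [ha hf]; have hS : ecoef (fun k => a k.+1).
  move=> r r0; have [C hC] := ha r r0; exists (C / r) => k.
  by rewrite ler_pdivlMr// -mulrA -exprSr.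
have [g [_ hg]] := psum_ex hS; exists g; split => // z.
have /csumsS h := hf z; rewrite expr0 mulr1 in h.
have h' : csums (fun k => z * (a k.+1 * z ^+ k)) (f z - a 0%N).
  by apply: csums_ext h => k; rewrite exprS mulrCA.
by rewrite (csums_unique (csumsZ z (hg z)) h') addrC subrK.
Qed.

Lemma entire_coef f : entire f -> psum (fun n => coef n f) f.
Proof.
move=> /entire_psum[a ha _]; apply: (psum_ext _ _ ha) => // n.
by rewrite (psum_coef n ha).
Qed.

Lemma psum_unique a f g : psum a f -> psum a g -> f =1 g.
Proof. by move=> [_ hf] [_ hg] z; exact: csums_unique (hf z) (hg z). Qed.

Lemma entire_coef_inj f g : entire f -> entire g -> (forall n, coef n f = coef n g) -> f =1 g.
Proof.
move=> /entire_coef hf /entire_coef hg fg; apply: psum_unique hf _.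
exact: psum_ext hg.
Qed.

Lemma coef0 f : coef 0 f = f 0.
Proof. by rewrite /coef fact0 invr1 mul1r. Qed.

(* Writing [f z = f 0 + z f1 z] reduces the Cauchy product to an induction. *)
Lemma coefM n f g : entire f -> entire g ->
  coef n (fun z => f z * g z) = \sum_(i < n.+1) coef i f * coef (n - i) g.
Proof.
elim: n f => [|n ih] f hf hg; first by rewrite big_ord1 subn0 !coef0.
have [f1 [h1 fE]] := psum_uncons (entire_coef hf).
have e1 : entire f1 := psum_entire h1.
have := psumD (psumZ (coef 0 f) (entire_coef hg)) (psum_cons 0 (entire_coef (entireM e1 hg))).
have -> : (fun z => coef 0 f * g z + (0 + z * (f1 z * g z))) = (fun z => f z * g z).
  by apply/funext => z; rewrite [in RHS]fE; ring.
move=> /(psum_coef n.+1) ->; rewrite /= ih// [RHS]big_ord_recl subn0; congr (_ + _).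
by apply: eq_bigr => i _; rewrite (psum_coef i h1).
Qed.

Lemma coefD n f g : entire f -> entire g ->
  coef n (fun z => f z + g z) = coef n f + coef n g.
Proof.
by move=> /entire_coef hf /entire_coef hg; rewrite (psum_coef n (psumD hf hg)).
Qed.

Lemma coef_sum n m (F : 'I_m -> CC R -> CC R) : (forall i, entire (F i)) ->
  coef n (fun z => \sum_(i < m) F i z) = \sum_(i < m) coef n (F i).
Proof.
elim: m F => [|m ih] F hF.
  rewrite big_ord0 (_ : (fun z => _) = fun=> 0); last by apply/funext => z; rewrite big_ord0.
  have := psumZ 0 (entire_coef (entire_cst (0 : CC R))) => /(psum_coef n).
  by rewrite !mul0r.
rewrite big_ord_recl (_ : (fun z => _) = fun z => F ord0 z + \sum_(i < m) F (lift ord0 i) z).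
  by rewrite coefD ?ih//; exact: entire_sum.
by apply/funext => z; rewrite big_ord_recl.
Qed.

Lemma entire_cauchy f n r B : entire f -> 0 < r ->
  (forall x : R, 0 <= x <= pi *+ 2 -> nc (f (r%:C%C * cis x)) <= B) ->
    nc (coef n f) * r ^+ n <= 2 * B.
Proof. by move=> /entire_psum[a ha H] r0 hB; rewrite (psum_coef n ha); exact: H. Qed.

Lemma entire_bound f r : entire f -> exists2 B, 0 <= B & forall z, nc z <= r -> nc (f z) <= B.
Proof.
move=> /entire_psum[a [ha hf] _].
have r0 : 0 < `|r| + 1 by have := normr_ge0 r; lra.
have [C C0 hC] := ecoef_half ha r0; exists (2 * C); first by rewrite mulr_ge0.
move=> z zr; apply: csums_le (hf z) _ (fun n => sum_geo_le n C0) => k.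
apply: le_trans (hC k); rewrite ncM ncX ler_wpM2l ?nc_ge0// lerXn2r ?nnegrE ?nc_ge0 ?(ltW
  r0)//.
by have := ler_norm r; lra.
Qed.

(** Recentring at z, Cauchy's estimate on the circle of radius 2 gives |c_n| 2^n <= 2 B. The
    resulting remainder depends on f only through B, which makes the first-order expansions of all
    [h n] in x summable against powers of tau. *)
Lemma entire_quad f z B : entire f -> (forall w, nc (w - z) <= 2 -> nc (f w) <= B) ->
  nc (derive1 f z) <= B /\
  forall h, nc h <= 1 -> nc (f (z + h) - f z - derive1 f z * h) <= 4 * B * nc h ^+ 2.
Proof.
move=> df hB; pose F w := f (w + z).
have eF : entire F by move=> w; have [l hl] := df (w + z); exists l; exact: cder_shift.
have B0 : 0 <= B by apply: le_trans (nc_ge0 _) (hB z _); rewrite subrr nc0.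
have est n : nc (coef n F) * 2 ^+ n <= 2 * B.
  apply: entire_cauchy => // x _; apply: hB.
  by rewrite addrK ncM nc_cis mulr1 nc_real ger0_norm.
have c0 : coef 0 F = f z by rewrite coef0 /F add0r.
have c1 : coef 1 F = derive1 f z.
  rewrite /coef factS fact0 invr1 mul1r; have [l hl] := df z.
  have hF : cder F 0 l by apply: cder_shift; rewrite add0r.
  by rewrite /derive1n /= (cder_derive1 hF) (cder_derive1 hl).
split; first by have := est 1%N; rewrite c1 expr1; lra.
move=> h h1; have [_ /(_ h)] := entire_coef eF.
move=> /csumsS /csumsS; rewrite /= c0 c1 expr0 expr1 mulr1 /F (addrC h).
move/csums_le => /(_ (fun k => 2 * B * nc h ^+ 2 * (2^-1) ^+ k) (4 * B * nc h ^+ 2)); apply.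
  move=> k; rewrite ncM ncX [leRHS]mulrAC.
  apply: ler_pM; rewrite ?nc_ge0 ?exprn_ge0 ?nc_ge0//; last by apply: ler_wiXn2l;
    rewrite ?nc_ge0.
  rewrite exprVn ler_pdivlMr ?exprn_gt0//; apply: le_trans (est k.+2).
  by rewrite ler_wpM2l ?nc_ge0// ler_weXn2l ?ler1n// leqW.
move=> n; rewrite (_ : 4 * B * _ = 2 * (2 * B * nc h ^+ 2)); last by ring.
by apply: sum_geo_le; rewrite !mulr_ge0 ?exprn_ge0 ?nc_ge0.
Qed.

Lemma entire_derive1 f : entire f -> entire (derive1 f).
Proof.
move=> /entire_coef/psum_der[g [hg fg]].
have -> : derive1 f = g by apply/funext => z; exact: cder_derive1.
exact: psum_entire hg.
Qed.

(** The coefficient of z^k gets divided by k, so the only obstruction is the constant term of f. One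
    such equation is solved, entry by entry, for each [h n]. *)
Lemma entire_primitive f : entire f -> f 0 = 0 ->
  exists g, [/\ entire g, g 0 = 0 & forall z, z * derive1 g z = f z].
Proof.
move=> /entire_psum[a ha _] f0.
have a0 : a 0%N = 0 by rewrite -(psum_at0 ha).
(* Division by 0 is harmless at k = 0, where a 0 = 0; then b 0 = 0 gives the normalisation of g. *)
pose b k : CC R := a k / k%:R.
have hb : ecoef b.
  move=> r r0; have [C hC] := ha.1 r r0; exists C => k; apply: le_trans (hC k).
  rewrite ler_wpM2r ?exprn_ge0 ?(ltW r0)// /b ncM ncV nc_nat ler_piMr ?nc_ge0//.
  by case: k => [|k]; [rewrite invr0|rewrite invf_le1// ler1n].
have [g hg] := psum_ex hb; have [g' [hg' dg]] := psum_der hg.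
exists g; split; first exact: psum_entire hg.
  by rewrite (psum_at0 hg) /b a0 mul0r.
move=> z; rewrite (cder_derive1 (dg z)).
have E := psum_unique (psum_cons 0 hg') _ z; rewrite add0r in E; apply: E.
apply: psum_ext ha => // -[|k] //=; by rewrite /dcoef /b mulrCA divff ?mulr1// pnatr_eq0.
Qed.

(** The derivative is required only inside the segment: an equation x f' = 0 gives no direct
    information at the endpoint 0, where continuity suffices. *)
Lemma cder0_segment f z w :
  (forall s : R, 0 < s < 1 -> cder f (z + (w - z) * s%:C%C) 0) ->
  (forall s : R, 0 <= s <= 1 -> ccont f (z + (w - z) * s%:C%C)) -> f w = f z.
Proof.
move=> hd hc; have := @mvt0 R (fun s => f (z + (w - z) * s%:C%C)) 0 1 ler01.
rewrite (_ : z + _ * 1%:C%C = w); last by rewrite mulr1 addrC subrK.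
rewrite (_ : z + _ * 0%:C%C = z); last by rewrite mulr0 addr0.
apply => s hs.
  by have := rder_line (hd _ hs); rewrite mul0r.
by apply: rcont_line; exact: hc.
Qed.

Lemma ccont_eq0 f : ccont f 0 -> (forall z, z != 0 -> f z = 0) -> f 0 = 0.
Proof.
move=> cf f0; apply/eqP; rewrite -nc_eq0; apply: contraT => nz.
have e0 : 0 < nc (f 0) by rewrite lt_def nz nc_ge0.
have [d d0 h] := cf _ e0.
have nd : nc ((d / 2)%:C%C : CC R) = d / 2 by rewrite nc_real gtr0_norm// divr_gt0.
have := h (d / 2)%:C%C; rewrite subr0 nd => hh.
have {hh} := hh (_ : d / 2 < d); rewrite f0; first by rewrite sub0r ncN ltxx => ->//; lra.
by rewrite -nc_gt0 nd divr_gt0.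
Qed.

Lemma entire_ode0 f : entire f -> f 0 = 0 -> (forall z, z * derive1 f z = 0) ->
  forall z, f z = 0.
Proof.
move=> df f0 H z; rewrite -f0; apply: cder0_segment => s.
  move=> /andP[s0 s1]; have [->|z0] := eqVneq z 0.
    have [l hl] := entire_derive1 df 0.
    have : derive1 f 0 = 0.
      apply: (ccont_eq0 (cder_cont hl)) => w w0.
      by have /eqP := H w; rewrite mulf_eq0 (negPf w0) => /eqP.
    move=> e; rewrite subrr mul0r addr0 -[X in cder _ _ X]e; have [m hm] := df 0.
    by rewrite (cder_derive1 hm).
  have [m hm] := df (0 + (z - 0) * s%:C%C); suff m0 : m = 0 by rewrite -[X in cder _ _ X]m0.
  have := H (0 + (z - 0) * s%:C%C); rewrite (cder_derive1 hm) => /eqP.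
  rewrite subr0 add0r !mulf_eq0 (negPf z0) /= => /orP[|/eqP//].
  by rewrite -nc_eq0 nc_real normr_eq0 gt_eqF.
by move=> _; have [l] := df (0 + (z - 0) * s%:C%C); exact: cder_cont.
Qed.

End EntireFunctions.

(** * Matrix calculus and formal series *)

(* Matrix products do not commute, but once they are fully distributed an identity
   between them is linear in the monomials and can be checked entrywise. *)
Ltac mulmx_atoms := repeat match goal with
  | |- context [@mulmx ?T ?m ?n ?p ?A ?B] => move: (@mulmx T m n p A B) => ?
  end.

Ltac mx_linear := rewrite ?(mulmxDl, mulmxDr, mulmxBl, mulmxBr, mulmxN, mulNmx, mulmxA,
    =^~ scalemxAl, =^~ scalemxAr);
  mulmx_atoms; apply/matrixP => ? ?; rewrite !mxE; ring.

Section MatrixCalculus.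
Variable R : realType.
Implicit Types (z w : CC R).

Definition mder m n (F : CC R -> 'M[CC R]_(m, n)) z (L : 'M[CC R]_(m, n)) :=
  forall i j, cder (fun w => F w i j) z (L i j).

Definition mentire m n (F : CC R -> 'M[CC R]_(m, n)) :=
  forall i j, entire (fun z => F z i j).

Lemma mder_dmx m n (F : CC R -> 'M[CC R]_(m, n)) z L : mder F z L -> dmx F z = L.
Proof. by move=> h; apply/matrixP => i j; rewrite mxE; exact: cder_derive1. Qed.

Lemma mentire_mder m n (F : CC R -> 'M[CC R]_(m, n)) z : mentire F -> mder F z (dmx F z).
Proof.
by move=> h i j; have [l hl] := h i j z; rewrite mxE (cder_derive1 hl).
Qed.

Lemma mder_ext m n (F G : CC R -> 'M[CC R]_(m, n)) z L : F =1 G -> mder F z L -> mder G z L.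
Proof. by move=> /funext ->. Qed.

Lemma mder_cst m n (A : 'M[CC R]_(m, n)) z : mder (fun=> A) z 0.
Proof. by move=> i j; rewrite mxE; exact: cder_cst. Qed.

Lemma mderD m n (F G : CC R -> 'M[CC R]_(m, n)) z K L : mder F z K -> mder G z L ->
  mder (fun w => F w + G w) z (K + L).
Proof.
move=> hF hG i j; rewrite mxE; apply: (cder_ext _ (cderD (hF i j) (hG i j))) => w.
by rewrite mxE.
Qed.

Lemma mderZ m n (F : CC R -> 'M[CC R]_(m, n)) (f : CC R -> CC R) z K k :
  mder F z K -> cder f z k -> mder (fun w => f w *: F w) z (k *: F z + f z *: K).
Proof.
move=> hF hf i j; rewrite !mxE; apply: (cder_ext _ (cderM hf (hF i j))) => w.
by rewrite mxE.
Qed.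

Lemma mderZc m n (F : CC R -> 'M[CC R]_(m, n)) (c : CC R) z K :
  mder F z K -> mder (fun w => c *: F w) z (c *: K).
Proof. by move=> hF; have := mderZ hF (cder_cst c z); rewrite scale0r add0r. Qed.

Lemma mderN m n (F : CC R -> 'M[CC R]_(m, n)) z K : mder F z K ->
  mder (fun w => - F w) z (- K).
Proof.
move=> hF i j; rewrite mxE; apply: (cder_ext _ (cderN (hF i j))) => w; by rewrite mxE.
Qed.

Lemma mderB m n (F G : CC R -> 'M[CC R]_(m, n)) z K L : mder F z K -> mder G z L ->
  mder (fun w => F w - G w) z (K - L).
Proof. by move=> hF hG; exact: mderD hF (mderN hG). Qed.

Lemma mderM m n p (F : CC R -> 'M[CC R]_(m, n)) (G : CC R -> 'M[CC R]_(n, p)) z K L :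
  mder F z K -> mder G z L ->
  mder (fun w => F w *m G w) z (K *m G z + F z *m L).
Proof.
move=> hF hG i j; rewrite !mxE -big_split /=.
apply: (cder_ext _ (cder_sum (fun k => cderM (hF i k) (hG k j)))) => w.
by rewrite mxE.
Qed.

Lemma mder_sum I (r : seq I) m n (F : I -> CC R -> 'M[CC R]_(m, n)) z K :
  (forall i, mder (F i) z (K i)) -> mder (fun w => \sum_(i <- r) F i w) z (\sum_(i <- r) K i).
Proof.
move=> h; elim: r => [|i r ih].
  by rewrite big_nil; apply: mder_ext (mder_cst 0 z) => w; rewrite big_nil.
rewrite big_cons; apply: (mder_ext _ (mderD (h i) ih)) => w.
by rewrite big_cons.
Qed.

Lemma mder_tr m n (F : CC R -> 'M[CC R]_(m, n)) z K : mder F z K ->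
  mder (fun w => (F w)^T) z K^T.
Proof.
move=> hF i j; rewrite mxE; apply: cder_ext (hF j i) => w; by rewrite mxE.
Qed.

Lemma mder_comp m n (F : CC R -> 'M[CC R]_(m, n)) (f : CC R -> CC R) z K k :
  mder F (f z) K -> cder f z k -> mder (fun w => F (f w)) z (k *: K).
Proof. by move=> hF hf i j; rewrite mxE mulrC; exact: cder_comp hf (hF i j). Qed.

Lemma mder_entire m n (F : CC R -> 'M[CC R]_(m, n)) :
  (forall z, exists L, mder F z L) -> mentire F.
Proof. by move=> h i j z; have [L hL] := h z; exists (L i j). Qed.

Lemma mentireB m n (F G : CC R -> 'M[CC R]_(m, n)) : mentire F -> mentire G ->
  mentire (fun z => F z - G z).
Proof. by move=> hF hG; apply: mder_entire => z; eexists;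
  exact: mderB (mentire_mder z hF) (mentire_mder z hG). Qed.

Lemma mentireN m n (F : CC R -> 'M[CC R]_(m, n)) : mentire F -> mentire (fun z => - F z).
Proof. by move=> hF; apply: mder_entire => z; eexists; exact: mderN (mentire_mder z hF). Qed.

Lemma mentireM m n p (F : CC R -> 'M[CC R]_(m, n)) (G : CC R -> 'M[CC R]_(n, p)) :
  mentire F -> mentire G -> mentire (fun z => F z *m G z).
Proof. by move=> hF hG; apply: mder_entire => z; eexists;
  exact: mderM (mentire_mder z hF) (mentire_mder z hG). Qed.

Lemma mentire_cst m n (A : 'M[CC R]_(m, n)) : mentire (fun=> A).
Proof. by move=> i j; exact: entire_cst. Qed.

Lemma mentireZ m n (F : CC R -> 'M[CC R]_(m, n)) (f : CC R -> CC R) : entire f -> mentire F ->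
  mentire (fun z => f z *: F z).
Proof.
move=> hf hF; apply: mder_entire => z; have [k hk] := hf z.
by eexists; exact: mderZ (mentire_mder z hF) hk.
Qed.

Lemma mentire_dmx m n (F : CC R -> 'M[CC R]_(m, n)) : mentire F -> mentire (dmx F).
Proof.
move=> hF i j; have := entire_derive1 (hF i j).
by rewrite (_ : (fun z => dmx F z i j) = derive1 (fun z => F z i j))//; apply/funext => z;
  rewrite mxE.
Qed.

Lemma holo_mentire m n (F : CC R -> 'M[CC R]_(m, n)) : holo setT F -> mentire F.
Proof.
move=> h i j z; exists (derive1 (fun z => F z i j) z); apply: derivable_cder.
exact: h.
Qed.

Lemma mder_derivable m n (F : CC R -> 'M[CC R]_(m, n)) z L i j : mder F z L ->
  derivable (fun w => F w i j) z 1.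
Proof. by move=> h; exact: cder_derivable (h i j). Qed.

Lemma mentire_primitive m n (F : CC R -> 'M[CC R]_(m, n)) : mentire F -> F 0 = 0 ->
  exists G, [/\ mentire G, G 0 = 0 & forall z, z *: dmx G z = F z].
Proof.
move=> hF F0.
have /choice[g hg] : forall p : 'I_m * 'I_n, exists g, [/\ entire g, g 0 = 0 & forall z,
  z * derive1 g z = F z p.1 p.2].
  by move=> p; apply: entire_primitive (hF p.1 p.2) _; rewrite F0 mxE.
exists (fun z => \matrix_(i, j) g (i, j) z).
have gE i j : (fun z => (\matrix_(i, j) g (i, j) z) i j) = g (i, j).
  by apply/funext => z; rewrite mxE.
split.
- by move=> i j; rewrite gE; case: (hg (i, j)).
- by apply/matrixP => i j; rewrite !mxE; case: (hg (i, j)).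
- by move=> z; apply/matrixP => i j; rewrite mxE mxE gE; case: (hg (i, j)).
Qed.

Lemma mentire_ode0 m n (F : CC R -> 'M[CC R]_(m, n)) : mentire F -> F 0 = 0 ->
  (forall z, z *: dmx F z = 0) -> forall z, F z = 0.
Proof.
move=> hF F0 H z; apply/matrixP => i j; rewrite [RHS]mxE.
apply: (entire_ode0 (hF i j)) => [|w]; first by rewrite F0 mxE.
by have /matrixP/(_ i j) := H w; rewrite !mxE.
Qed.

Lemma mentire_eq0 m n (F : CC R -> 'M[CC R]_(m, n)) : mentire F ->
  (forall z, z != 0 -> F z = 0) -> forall z, F z = 0.
Proof.
move=> hF H z; have [->|] := eqVneq z 0; last exact: H.
apply/matrixP => i j; have [l hl] := hF i j 0; rewrite [RHS]mxE.
by apply: (ccont_eq0 (cder_cont hl)) => w /H ->; rewrite mxE.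
Qed.

End MatrixCalculus.

(** * The ring of formal power series in tau with matrix coefficients *)

Section FormalSeries.
Variables (R : realType) (mu : nat).
Local Notation mx := 'M[CC R]_mu.
Implicit Types (A B C : pser R mu) (X Y : mx) (n : nat).

Lemma eq_psmul A B A' B' n : A =1 A' -> B =1 B' -> psmul A B n = psmul A' B' n.
Proof. by move=> /funext -> /funext ->. Qed.

Lemma psmulDl A B C n : psmul (fun k => A k + B k) C n = psmul A C n + psmul B C n.
Proof. by rewrite /psmul -big_split /=; apply: eq_bigr => i _; rewrite mulmxDl. Qed.

Lemma psmulDr A B C n : psmul C (fun k => A k + B k) n = psmul C A n + psmul C B n.
Proof. by rewrite /psmul -big_split /=; apply: eq_bigr => i _; rewrite mulmxDr. Qed.

Lemma psmulNl A C n : psmul (fun k => - A k) C n = - psmul A C n.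
Proof. by rewrite /psmul -sumrN; apply: eq_bigr => i _; rewrite mulNmx. Qed.

Lemma psmulNr A C n : psmul C (fun k => - A k) n = - psmul C A n.
Proof. by rewrite /psmul -sumrN; apply: eq_bigr => i _; rewrite mulmxN. Qed.

Lemma psmulZr A C n (c : CC R) : psmul C (fun k => c *: A k) n = c *: psmul C A n.
Proof. by rewrite /psmul scaler_sumr; apply: eq_bigr => i _; rewrite -scalemxAr. Qed.

Lemma psmul_mxl X A C n : psmul (fun k => X *m A k) C n = X *m psmul A C n.
Proof. by rewrite /psmul mulmx_sumr; apply: eq_bigr => i _; rewrite mulmxA. Qed.

Lemma psmul_mxr X A C n : psmul C (fun k => A k *m X) n = psmul C A n *m X.
Proof. by rewrite /psmul mulmx_suml; apply: eq_bigr => i _; rewrite mulmxA. Qed.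

Lemma psmul_mxm X A C n : psmul (fun k => A k *m X) C n = psmul A (fun k => X *m C k) n.
Proof. by rewrite /psmul; apply: eq_bigr => i _; rewrite mulmxA. Qed.

Lemma psmul_taul A C n : psmul (pstau A) C n = pstau (psmul A C) n.
Proof. by case: n => [|n]; rewrite /psmul /= ?big_ord1 ?mul0mx// big_ord_recl /= mul0mx
  add0r. Qed.

Lemma psmul_taur A C n : psmul C (pstau A) n = pstau (psmul C A) n.
Proof.
case: n => [|n]; rewrite /psmul /= ?big_ord1 ?mulmx0// big_ord_recr /= subnn mulmx0 addr0.
by apply: eq_bigr => i _; rewrite subSn// -ltnS.
Qed.

Lemma psmul1l A n : psmul (@ps1 R mu) A n = A n.
Proof.
rewrite /psmul big_ord_recl /= mul1mx subn0 big1 ?addr0// => i _.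
by rewrite mul0mx.
Qed.

Lemma psmul1r A n : psmul A (@ps1 R mu) n = A n.
Proof.
rewrite /psmul big_ord_recr /= subnn mulmx1 big1 ?add0r// => i _.
by rewrite -[X in ps1 R mu X]prednK ?subn_gt0//= mulmx0.
Qed.

Lemma psmulA A B C n : psmul A (psmul B C) n = psmul (psmul A B) C n.
Proof.
rewrite /psmul.
under eq_bigr do rewrite mulmx_sumr.
under [RHS]eq_bigr do rewrite mulmx_suml.
(* Triangular index sets become conditions on the full range, so that the sums can be exchanged and
   then reindexed by k = i + j. *)
rewrite (eq_bigr (fun i : 'I_n.+1 => \sum_(j < n.+1 | (i +
  j <= n)%N) A i *m B j *m C (n - i - j)%N)); last first.
  move=> i _; have e : ((n - i).+1 <= n.+1)%N by rewrite ltnS leq_subr.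
  rewrite (big_ord_widen _ (fun j => A i *m (B j *m C (n - i - j)%N)) e).
  by apply: eq_big => [j|j _]; [rewrite ltnS leq_subRL// -ltnS|rewrite mulmxA].
rewrite [RHS](eq_bigr (fun k : 'I_n.+1 => \sum_(i < n.+1 | (i <= k)%N) A i *m B (k - i)%N
  *m C (n - k)%N)); last first.
  by move=> k _; rewrite (big_ord_widen _ (fun i => A i *m B (k - i)%N *m C (n - k)%N)
    (ltn_ord k)).
rewrite [RHS](exchange_big_dep xpredT) //=; apply: eq_bigr => i _.
rewrite (reindex_onto (fun k : 'I_n.+1 => inord (k - i) : 'I_n.+1) (fun j => inord (i +
  j))) /=; last first.
  by move=> j ij; apply/val_inj; rewrite /= inordK ?ltnS// ?inordK ?ltnS ?addKn// leq_ord.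
apply: eq_big => [k|k].
  have ki : (k - i < n.+1)%N by rewrite ltnS (leq_trans (leq_subr _ _))// leq_ord.
  rewrite inordK//; have [ik|ki'] := leqP i k.
    by rewrite subnKC// leq_ord /=; apply/eqP/val_inj; rewrite /= inordK.
  have -> : (k - i = 0)%N by apply/eqP; rewrite subn_eq0 ltnW.
  rewrite addn0 leq_ord /=; apply/eqP => /(congr1 val) /=; rewrite inordK// => e.
  by rewrite e ltnn in ki'.
have ki : (k - i < n.+1)%N by rewrite ltnS (leq_trans (leq_subr _ _))// leq_ord.
rewrite inordK// => /andP[_ /eqP/(congr1 val)] /=.
have [ik _|ki' ] := leqP i k; first by congr (_ *m C _); rewrite -subnDA subnKC.
have -> : (k - i = 0)%N by apply/eqP; rewrite subn_eq0 ltnW.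
rewrite addn0 inordK// => e; by rewrite e ltnn in ki'.
Qed.

(** [nth 0 [:: X; Y]] is the polynomial X + Y tau seen as a series. *)
Lemma psmul_poly1 X Y A n : psmul (nth 0 [:: X; Y]) A n = X *m A n + Y *m pstau A n.
Proof.
case: n => [|n]; first by rewrite /psmul big_ord1 /= mulmx0 addr0.
rewrite /psmul big_ord_recl big_ord_recl /= !subn0 subSS subn0 big1 ?addr0// => i _.
by rewrite /= nth_nil mul0mx.
Qed.

Lemma psmul_poly1r X Y A n : psmul A (nth 0 [:: X; Y]) n = A n *m X + pstau A n *m Y.
Proof.
case: n => [|n]; first by rewrite /psmul big_ord1 /= mul0mx addr0.
rewrite /psmul big_ord_recr big_ord_recr /= subnn subSnn /= addrC big1 ?add0r// => i _.
by rewrite subSn 1?ltnW//= -[(n - i)%N]prednK ?subn_gt0//= nth_nil mulmx0.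
Qed.

(** The Leibniz rule for tau d/dtau, which multiplies the coefficient of tau^n by n. *)
Lemma psmul_deg A C n : n%:R *: psmul A C n =
  psmul (fun k => k%:R *: A k) C n + psmul A (fun k => k%:R *: C k) n.
Proof.
rewrite /psmul scaler_sumr -big_split /=; apply: eq_bigr => i _.
rewrite -scalemxAl -scalemxAr -scalerDl -natrD subnKC//.
by rewrite -ltnS.
Qed.

(** From C (A C - 1) = 0 and the invertibility of the constant term of C, the coefficients of A C -
    1 vanish one after the other. *)
Lemma psmul_linv A C : A 0%N \in unitmx -> psmul C A =1 @ps1 R mu -> psmul A C =1 @ps1 R mu.
Proof.
move=> A0 CA.
have C0 : C 0%N \in unitmx.
  have := CA 0%N; rewrite /psmul big_ord1 /= => /mulmx1_unit[]//.
have E n : psmul C (psmul A C) n = C n.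
  rewrite psmulA -[RHS]psmul1l; exact: eq_psmul.
have E2 n : psmul C (fun k => psmul A C k - ps1 R mu k) n = 0.
  by rewrite psmulDr psmulNr E psmul1r subrr.
have Z n : psmul A C n - ps1 R mu n = 0.
  elim/ltn_ind: n => n ih; have := E2 n; rewrite {1}/psmul big_ord_recl subn0 big1.
    by rewrite addr0 => /(congr1 (mulmx (invmx (C 0%N)))); rewrite mulmx0 mulKmx.
  move=> i _; rewrite ih ?mulmx0// /lift /= /bump /= add1n.
  by case: i => i /= hi; rewrite ltn_subrL (leq_ltn_trans _ hi).
by move=> n; apply/eqP; rewrite -subr_eq0 Z.
Qed.

Lemma mder_psmul (A C : CC R -> pser R mu) z (DA DC : pser R mu) n :
  (forall k, mder (fun w => A w k) z (DA k)) -> (forall k, mder (fun w => C w k) z (DC k)) ->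
  mder (fun w => psmul (A w) (C w) n) z (psmul DA (C z) n + psmul (A z) DC n).
Proof.
by move=> hA hC; rewrite /psmul -big_split /=; apply: mder_sum => i; exact: mderM.
Qed.

End FormalSeries.

(** * The gauge transformation *)

Section MatrixNorm.
Variable R : realType.

(** The sum of the moduli dominates every entry and is submultiplicative, as the recursive bound on
    the [h n] requires. *)
Definition mnorm m n (A : 'M[CC R]_(m, n)) : R := \sum_i \sum_j nc (A i j).

Lemma mnorm_ge0 m n (A : 'M[CC R]_(m, n)) : 0 <= mnorm A.
Proof. by apply: sumr_ge0 => i _; apply: sumr_ge0 => j _; exact: nc_ge0. Qed.

Lemma nc_le_mnorm m n (A : 'M[CC R]_(m, n)) i j : nc (A i j) <= mnorm A.
Proof.
rewrite /mnorm (bigD1 i)//= (bigD1 j)//= -addrA lerDl addr_ge0//.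
  by apply: sumr_ge0 => k _; exact: nc_ge0.
by apply: sumr_ge0 => k _; apply: sumr_ge0 => l _; exact: nc_ge0.
Qed.

Lemma mnormD m n (A B : 'M[CC R]_(m, n)) : mnorm (A + B) <= mnorm A + mnorm B.
Proof.
rewrite /mnorm -big_split /=; apply: ler_sum => i _; rewrite -big_split /=.
by apply: ler_sum => j _; rewrite mxE ncD.
Qed.

Lemma mnormN m n (A : 'M[CC R]_(m, n)) : mnorm (- A) = mnorm A.
Proof. by apply: eq_bigr => i _; apply: eq_bigr => j _; rewrite mxE ncN. Qed.

Lemma mnormB m n (A B : 'M[CC R]_(m, n)) : mnorm (A - B) <= mnorm A + mnorm B.
Proof. by rewrite -(mnormN B) mnormD. Qed.

Lemma mnormZ m n (c : CC R) (A : 'M[CC R]_(m, n)) : mnorm (c *: A) = nc c * mnorm A.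
Proof.
rewrite /mnorm mulr_sumr; apply: eq_bigr => i _; rewrite mulr_sumr; apply: eq_bigr => j _.
by rewrite mxE ncM.
Qed.

Lemma mnormM m n p (A : 'M[CC R]_(m, n)) (B : 'M[CC R]_(n, p)) :
  mnorm (A *m B) <= mnorm A * mnorm B.
Proof.
have row k : \sum_j nc (B k j) <= mnorm B.
  by rewrite /mnorm (bigD1 k)//= lerDl; apply: sumr_ge0 => l _; apply: sumr_ge0 => j _;
    exact: nc_ge0.
rewrite /mnorm mulr_suml; apply: ler_sum => i _.
apply: (@le_trans _ _ (\sum_j \sum_k nc (A i k) * nc (B k j))).
  apply: ler_sum => j _; rewrite mxE; apply: le_trans (nc_sum _ _ _) _.
  by apply: ler_sum => k _; rewrite ncM.
rewrite exchange_big /= mulr_suml; apply: ler_sum => k _.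
by rewrite -mulr_sumr ler_wpM2l ?nc_ge0.
Qed.

Lemma mentire_bound m n (F : CC R -> 'M[CC R]_(m, n)) (r : R) : mentire F ->
  exists2 B, 0 <= B & forall z, nc z <= r -> mnorm (F z) <= B.
Proof.
move=> hF; have /choice[b hb] : forall p : 'I_m * 'I_n, exists B : R, 0 <= B /\ forall z,
  nc z <= r -> nc (F z p.1 p.2) <= B.
  by move=> p; have [B B0 hB] := entire_bound r (hF p.1 p.2); exists B.
exists (\sum_i \sum_j b (i, j)).
  by apply: sumr_ge0 => i _; apply: sumr_ge0 => j _; exact: (hb (i, j)).1.
by move=> z zr; apply: ler_sum => i _; apply: ler_sum => j _; exact: (hb (i, j)).2.
Qed.

End MatrixNorm.

Section Identities.
Variables (R : realType) (mu : nat).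

Lemma scale_derivation (z k : CC R) (N0 N1 N10 K H B D : 'M[CC R]_mu) :
  z *: (N0 *m K + (B *m H + N1 *m D) + k *: K - K *m N0 - D *m N10) =
  N0 *m (z *: K) + ((z *: B) *m H + N1 *m (z *: D)) + k *: (z *: K)
  - (z *: K) *m N0 - (z *: D) *m N10.
Proof. by mx_linear. Qed.

(** With H, g for two consecutive coefficients and M, N10 for the values at 0, the left side is x
    times the derivative of the defect of order k + 1. It is expressed by the defect of order k,
    plus three terms that the flatness relations annihilate. *)
Lemma gauge_identity (k : CC R) (N0 N1 N10 M M1 g H : 'M[CC R]_mu) :
  N0 *m (- (M1 *m H - H *m M))
  + ((M1 - (M1 *m N0 - N0 *m M1)) *m H + N1 *m (- (M1 *m g - g *m M)))
  + (k + 1) *: (- (M1 *m H - H *m M)) - (- (M1 *m H - H *m M)) *m N0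
  - (- (M1 *m g - g *m M)) *m N10 =
  - (M1 *m (N0 *m H + N1 *m g + k *: H - H *m N0 - g *m N10)
     - (N0 *m H + N1 *m g + k *: H - H *m N0 - g *m N10) *m M)
  + H *m (M - M *m N0 + N0 *m M) + (M1 *m N1 - N1 *m M1) *m g + g *m (N10 *m M - M *m N10).
Proof. by mx_linear. Qed.

Lemma gauge_step (z k : CC R) (N0 N1 N10 M M1 g H K B D : 'M[CC R]_mu) :
  z *: K = - (M1 *m H - H *m M) -> z *: B = M1 - (M1 *m N0 - N0 *m M1) ->
  z *: D = - (M1 *m g - g *m M) ->
  N0 *m H + N1 *m g + k *: H - H *m N0 - g *m N10 = 0 ->
  N0 *m M = M *m N0 - M -> M1 *m N1 = N1 *m M1 -> M *m N10 = N10 *m M ->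
  z *: (N0 *m K + (B *m H + N1 *m D) + (k + 1) *: K - K *m N0 - D *m N10) = 0.
Proof.
move=> eK eB eD e0 e1 e2 e3.
rewrite scale_derivation eK eB eD gauge_identity e0 e1 e2 e3.
rewrite !subrr mulmx0 !mul0mx mulmx0 subrr oppr0.
by rewrite -(opprB (M *m N0)) addNr mulmx0 !addr0.
Qed.

End Identities.

(** * Existence, decay and adjoint of the gauge transformation *)

Section Recursion.
Variables (R : realType) (mu : nat).
Local Notation mx := 'M[CC R]_mu.
Variables (M1 N1 : CC R -> mx) (N0 eta : mx).
Hypothesis (hM1 : mentire M1) (hN1 : mentire N1).
Hypothesis flat1 : forall x, x *: dmx N1 x = M1 x - (M1 x *m N0 - N0 *m M1 x).
Hypothesis flat2 : forall x, M1 x *m N1 x = N1 x *m M1 x.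
Hypothesis eta_unit : eta \in unitmx.
Hypothesis M1_sym : forall x, (M1 x)^T *m eta = eta *m M1 x.

Let M := M1 0.

Definition gauge_rhs (F : CC R -> mx) x := - (M1 x *m F x - F x *m M).

(* H = sum_n h_n tau^n solves x dH/dx = - tau (M1(x) H - H M1(0)), H(0, tau) = 1. *)
Definition gauge_sol (h : nat -> CC R -> mx) :=
  [/\ forall x, h 0%N x = 1%:M, forall n, mentire (h n), forall n, h n.+1 0 = 0 &
      forall n x, x *: dmx (h n.+1) x = gauge_rhs (h n) x].

Lemma gauge_sol_ex : exists h, gauge_sol h.
Proof.
pose good (F G : CC R -> mx) := [/\ mentire G, G 0 = 0 & forall x,
  x *: dmx G x = gauge_rhs F x].
(* The default value of [xget] is never reached: F 0 is 1 or 0 at every stage and commutes with [M],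
   so the right-hand side vanishes at 0 and a primitive exists. *)
pose step (F : CC R -> mx) := xget (fun=> 0) (good F).
have stepP F : mentire F -> M *m F 0 = F 0 *m M -> good F (step F).
  move=> hF F0; have r0 : gauge_rhs F 0 = 0 by rewrite /gauge_rhs F0 subrr oppr0.
  have hr : mentire (gauge_rhs F).
    by apply: mentireN; apply: mentireB; apply: mentireM => //; exact: mentire_cst.
  have [G0 hG] := mentire_primitive hr r0.
  exact: (xgetPex (fun=> 0) (ex_intro _ G0 hG)).
pose h n := iter n step (fun=> 1%:M).
have hh n : mentire (h n) /\ (h n 0 = if n is 0%N then 1%:M else 0).
  elim: n => [|n [ih1 ih2]]; first by split=> //; exact: mentire_cst.
  have [|? ? _] := stepP _ ih1; last by split.
  by rewrite ih2; case: (n) => [|k]; rewrite ?mulmx1 ?mul1mx ?mulmx0 ?mul0mx.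
exists h; split.
- by [].
- by move=> n; exact: (hh n).1.
- by move=> n; exact: (hh n.+1).2.
move=> n x; have [|_ _ H] := stepP _ (hh n).1; last exact: H.
by rewrite (hh n).2; case: (n) => [|k]; rewrite ?mulmx1 ?mul1mx ?mulmx0 ?mul0mx.
Qed.

Variable h : nat -> CC R -> mx.
Hypothesis hh : gauge_sol h.

Let h0 x : h 0%N x = 1%:M. Proof. by case: hh. Qed.
Let hE n : mentire (h n). Proof. by case: hh. Qed.
Let hS0 n : h n.+1 0 = 0. Proof. by case: hh. Qed.

(** The coefficient of index n - 1, set to 0 for n = 0, so that one equation covers all orders. *)
Let prev n x := pstau (fun k => h k x) n.

Lemma gauge_ode n x : x *: dmx (h n) x = - (M1 x *m prev n x - prev n x *m M).
Proof.
case: n => [|n]; last by case: hh => _ _ _ ->.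
rewrite /prev /= mulmx0 mul0mx subrr oppr0.
by rewrite (mder_dmx (L := 0)) ?scaler0//; apply: mder_ext (mder_cst 1%:M x) => w; rewrite h0.
Qed.

(** At x = 0 the derivative drops out of the flatness equation and [M, N0] = M remains. *)
Lemma flat_M : N0 *m M = M *m N0 - M.
Proof.
have := flat1 0; rewrite scale0r -/M => /esym/eqP; rewrite subr_eq0 => /eqP e.
by rewrite [X in _ - X]e subKr.
Qed.

Lemma flat_MN : M *m N1 0 = N1 0 *m M. Proof. exact: flat2. Qed.

(* Coefficient of tau^n in
   (N0 + tau N1(x)) H + tau dH/dtau - H (N0 + tau N1(0)). *)
Definition conj_defect n x : mx :=
  N0 *m h n x + N1 x *m prev n x + n%:R *: h n x - h n x *m N0 - prev n x *m N1 0.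

Lemma conj_defect0 n x : conj_defect n x = 0.
Proof.
elim: n x => [|n ih] x.
  by rewrite /conj_defect /prev /= h0 mulmx1 mul1mx mulmx0 mul0mx scale0r !addr0 subr0 subrr.
pose der z := N0 *m dmx (h n.+1) z + (dmx N1 z *m h n z + N1 z *m dmx (h n) z)
    + n.+1%:R *: dmx (h n.+1) z - dmx (h n.+1) z *m N0 - dmx (h n) z *m N1 0.
have dK z : mder (conj_defect n.+1) z (der z).
  have d1 := mentire_mder z (hE n.+1); have d2 := mentire_mder z (hE n).
  have c X := mder_cst X z : mder (fun=> X : mx) z 0.
  have := mderB (mderB (mderD (mderD (mderM (c N0) d1) (mderM (mentire_mder z hN1) d2))
    (mderZc n.+1%:R d1)) (mderM d1 (c N0))) (mderM d2 (c (N1 0))).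
  by rewrite !mul0mx !mulmx0 !add0r !addr0.
apply: mentire_ode0 x => [||z].
- by apply: mder_entire => z; exists (der z).
(* At x = 0 only the commutator of N1(0) with [h n 0] is left, and [h n 0] is 1 or 0. *)
- rewrite /conj_defect hS0 /prev /= mulmx0 mul0mx scaler0 subr0 addr0 add0r.
  by case: (n) => [|k]; rewrite ?h0 ?hS0 ?mulmx1 ?mul1mx ?mulmx0 ?mul0mx subrr.
rewrite (mder_dmx (dK z)) /der.
rewrite -[n.+1%:R]natr1; apply: (gauge_step (gauge_ode n.+1 z) (flat1 z) (gauge_ode n z)).
- exact: ih.
- exact: flat_M.
- exact: flat2.
- exact: flat_MN.
Qed.

(* The vanishing of [conj_defect] bounds [n - 2 |N0|] times [|h_n|] by a multiple of
   [|h_(n-1)|], whereas the equation in x only yields a geometric bound. *)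
Lemma gauge_bound (r s : R) : 0 < r -> 0 < s ->
  exists C : R, forall n x, nc x <= r -> mnorm (h n x) * s ^+ n <= C.
Proof.
move=> r0 s0.
have [B B0 hB] := mentire_bound r hN1.
have /choice[b hb] : forall n, exists b : R, 0 <= b /\ forall z, nc z <= r ->
  mnorm (h n z) <= b.
  by move=> n; have [b b0 hb] := mentire_bound r (hE n); exists b.
(* Once the order exceeds [D], the factor order - 2 |N0| is larger than (B + |N1(0)|) s, so the
   weighted norms [mnorm (h n x) * s ^+ n] stop increasing. The finitely many smaller orders are
   covered by the sum of their bounds. *)
pose D := 2 * mnorm N0 + (B + mnorm (N1 0)) * s + 1.
have N00 := mnorm_ge0 N0; have N10 := mnorm_ge0 (N1 0).
have B1 : 0 <= (B + mnorm (N1 0)) * s by rewrite mulr_ge0 ?(ltW s0)// addr_ge0.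
pose m := Num.Def.archi_bound D.
have hm : D < m%:R by apply: archi_boundP; rewrite /D; lra.
exists (\sum_(k < m.+1) b k * s ^+ k) => n x xr.
have small k : (k <= m)%N -> mnorm (h k x) * s ^+ k <= \sum_(k < m.+1) b k * s ^+ k.
  move=> km; rewrite (bigD1 (Ordinal (km : (k < m.+1)%N)))//=.
  rewrite ler_wpDr ?sumr_ge0// => [i _|];
    first by rewrite mulr_ge0 ?exprn_ge0 ?(ltW s0)// (hb i).1.
  by rewrite ler_wpM2r ?exprn_ge0 ?(ltW s0)// (hb k).2.
elim: n => [|n ih]; first exact: small.
have [nm|nm] := leqP n.+1 m; first exact: small.
apply: le_trans ih.
have := conj_defect0 n.+1 x; rewrite /conj_defect /prev /= => K0.
have E : n.+1%:R *: h n.+1 x = (h n.+1 x *m N0 - N0 *m h n.+1 x) +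
  (h n x *m N1 0 - N1 x *m h n x).
  have key (U V W X Y : mx) : U + V + W - X - Y = 0 -> W = (X - U) + (Y - V).
    by move=> K; apply/eqP; rewrite -subr_eq0 -[X in _ == X]K; apply/eqP/matrixP => i j;
      rewrite !mxE; ring.
  exact: key K0.
have {E} : n.+1%:R * mnorm (h n.+1 x) <= 2 * mnorm N0 * mnorm (h n.+1 x) + (B +
  mnorm (N1 0)) * mnorm (h n x).
  rewrite -(nc_nat R) -mnormZ E; apply: le_trans (mnormD _ _) _.
  apply: le_trans (lerD (mnormB _ _) (mnormB _ _)) _.
  have e1 := mnormM (h n.+1 x) N0; have e2 := mnormM N0 (h n.+1 x).
  have e3 := mnormM (h n x) (N1 0); have e4 := mnormM (N1 x) (h n x).
  have e5 := ler_wpM2r (mnorm_ge0 (h n x)) (hB x xr).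
  lra.
have mn : m%:R <= n.+1%:R :> R by rewrite ler_nat ltnW.
rewrite exprS mulrCA mulrA ler_pM2r ?exprn_gt0//.
have := mnorm_ge0 (h n.+1 x); have := mnorm_ge0 (h n x); move: hm mn; rewrite /D.
move: (mnorm (h n.+1 x)) (mnorm (h n x)) (n.+1%:R) => u v k hm mn v0 u0 H.
have B2 : 0 <= B + mnorm (N1 0) by rewrite addr_ge0.
(* When B + |N1(0)| = 0 one cannot divide by it; then k u <= 2 |N0| u with k > 2 |N0| forces u =
   0. *)
have [B3|B3] := leP ((B + mnorm (N1 0)) * s) 0.
  have e : B + mnorm (N1 0) = 0.
    by apply/eqP; rewrite eq_le B2 andbT -(pmulr_lle0 _ s0).
  move: H; rewrite e mul0r addr0 => H.
  have : u = 0 by nra.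
  by move=> ->; rewrite mulr0.
have B4 : 0 < B + mnorm (N1 0) by rewrite -(pmulr_lgt0 _ s0).
rewrite -(ler_pM2l B4) mulrA; nra.
Qed.

(** The adjoint for the bilinear form with Gram matrix [eta]. *)
Definition eta_star (A : mx) := invmx eta *m A^T *m eta.

Lemma eta_starM A B : eta_star (A *m B) = eta_star B *m eta_star A.
Proof. by rewrite /eta_star trmx_mul !mulmxA mulmxK. Qed.

Lemma eta_starB A B : eta_star (A - B) = eta_star A - eta_star B.
Proof. by rewrite /eta_star linearB /= mulmxBr mulmxBl. Qed.

Lemma eta_starZ c A : eta_star (c *: A) = c *: eta_star A.
Proof. by rewrite /eta_star linearZ /= -scalemxAr -scalemxAl. Qed.

Lemma eta_star1 : eta_star 1%:M = 1%:M.
Proof. by rewrite /eta_star trmx1 mulmx1 mulVmx. Qed.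

Lemma eta_star0 : eta_star 0 = 0.
Proof. by rewrite /eta_star trmx0 mulmx0 mul0mx. Qed.

Lemma eta_star_M1 x : eta_star (M1 x) = M1 x.
Proof. by rewrite /eta_star -mulmxA M1_sym mulKmx. Qed.

Lemma mder_eta_star F z L : mder F z L -> mder (fun w => eta_star (F w)) z (eta_star L).
Proof.
move=> hF; have := mderM (mderM (mder_cst (invmx eta) z) (mder_tr hF)) (mder_cst eta z).
by rewrite mul0mx add0r mulmx0 addr0.
Qed.

Definition hstar x : pser R mu := fun n => (-1) ^+ n *: eta_star (h n x).

(** Adjunction reverses the products and tau |-> - tau changes the sign, so H^*(x, - tau) solves the
    same equation as the inverse of H, since M1(x) is self-adjoint. *)
Lemma hstar_ode n x : x *: ((-1) ^+ n *: eta_star (dmx (h n) x)) =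
  pstau (hstar x) n *m M1 x - M *m pstau (hstar x) n.
Proof.
rewrite scalerA mulrC -scalerA -eta_starZ gauge_ode; case: n => [|n].
  by rewrite /prev /= !(mulmx0, mul0mx) subrr oppr0 eta_star0 scaler0.
rewrite /prev /= /hstar opprB eta_starB !eta_starM -/M eta_star_M1 (eta_star_M1 0).
by rewrite exprS mulN1r -!scalemxAl -!scalemxAr scaleNr scalerBr opprB.
Qed.

Lemma hstarP x n : psmul (hstar x) (h ^~ x) n = @ps1 R mu n.
Proof.
suff H : forall n x, psmul (hstar x) (h ^~ x) n - @ps1 R mu n = 0.
  by apply/eqP; rewrite -subr_eq0 H.
elim=> {n x} [|n ih] x.
  by rewrite /psmul big_ord1 /hstar /= scale1r h0 eta_star1 mulmx1 subrr.
pose L z := psmul (hstar z) (h ^~ z) n.+1 - @ps1 R mu n.+1.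
pose DH z : pser R mu := fun k => (-1) ^+ k *: eta_star (dmx (h k) z).
have dL z : mder L z (psmul (DH z) (h ^~ z) n.+1 +
  psmul (hstar z) (fun k => dmx (h k) z) n.+1).
  rewrite -[X in mder _ _ X]subr0; apply: mderB (mder_cst _ z).
  apply: (@mder_psmul _ _ hstar (fun w k => h k w)) => k.
    by apply: mderZc; apply: mder_eta_star; exact: mentire_mder.
  exact: mentire_mder.
apply: (mentire_ode0 (F := L)) x => [||z].
- by apply: mder_entire => z; eexists; exact: dL.
- rewrite /L /= subr0 /psmul big1// => -[i /= hi] _.
  case: i hi => [|i] hi; first by rewrite subn0 hS0 mulmx0.
  by rewrite /hstar hS0 eta_star0 scaler0 mul0mx.
rewrite (mder_dmx (dL z)) scalerDr.
have -> : z *: psmul (DH z) (h ^~ z) n.+1 = psmul (fun k => z *: DH z k) (h ^~ z) n.+1.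
  by rewrite /psmul scaler_sumr; apply: eq_bigr => i _; rewrite -scalemxAl.
rewrite -psmulZr (eq_psmul _ (fun k => hstar_ode k z) (fun k => erefl)).
rewrite [X in _ + X](eq_psmul _ (fun k => erefl) (fun k => gauge_ode k z)).
rewrite psmulDl psmulNl psmul_mxl psmul_mxm.
rewrite [X in _ + X]psmulNr psmulDr psmulNr psmul_mxr.
rewrite !psmul_taul /=.
have -> : psmul (hstar z) (fun k => M1 z *m prev k z) n.+1 = psmul (hstar z) (fun k => M1 z
  *m h k z) n.
  rewrite (@eq_psmul _ _ _ _ (hstar z) (pstau (fun k => M1 z *m h k z)))//;
    first by rewrite psmul_taur.
  by case=> [|k] //; rewrite /prev /= mulmx0.
rewrite psmul_taur /=.
(* What remains is the commutator of [M] with the coefficient of order n, which by induction is 1 or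
   0. *)
have -> : psmul (hstar z) (h ^~ z) n = @ps1 R mu n by apply/eqP; rewrite -subr_eq0 ih.
have -> : M *m @ps1 R mu n = @ps1 R mu n *m M.
  by case: (n) => [|k] /=; rewrite ?mulmx1 ?mul1mx ?mulmx0 ?mul0mx.
by rewrite subrr.
Qed.

End Recursion.

(** * Flat logarithmic systems *)

Section FlatSystem.
Variables (R : realType) (mu : nat) (Q : qds_data R mu).
Hypotheses (hQ : log_qds Q) (hflat : flat_qds Q).
Local Notation mx := 'M[CC R]_mu.

Lemma entire_M1 : mentire (M1 Q). Proof. exact: holo_mentire (holo_M1 hQ). Qed.
Lemma entire_N0 : mentire (N0 Q). Proof. exact: holo_mentire (holo_N0 hQ). Qed.
Lemma entire_N1 : mentire (N1 Q). Proof. exact: holo_mentire (holo_N1 hQ). Qed.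
Lemma entire_gram : mentire (gram Q). Proof. exact: holo_mentire (holo_gram hQ). Qed.

Lemma two_neq0 : 2 != 0 :> CC R. Proof. by rewrite pnatr_eq0. Qed.

(** Flatness is available for tau != 0 only; three nonzero values still determine a polynomial of
    degree 2. *)
Lemma quadratic_coefs (U V W : mx) :
  (forall s : CC R, s != 0 -> U + s *: V + s ^+ 2 *: W = 0) -> [/\ U = 0, V = 0 & W = 0].
Proof.
move=> H.
have h1 := H 1 (oner_neq0 _); have h2 := H (-1) _; have h3 := H 2 two_neq0.
have {}h2 := h2 (_ : -1 != 0); rewrite oppr_eq0 oner_eq0 in h2; have {}h2 := h2 isT.
have key (u v w : CC R) : u + 1 * v + 1 ^+ 2 * w = 0 -> u + (-1) * v + (-1) ^+ 2 * w = 0 ->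
    u + 2 * v + 2 ^+ 2 * w = 0 -> [/\ u = 0, v = 0 & w = 0].
  move=> e1 e2 e3.
  have ev : v = 0.
    have : 2 * v = (u + 1 * v + 1 ^+ 2 * w) - (u + (-1) * v + (-1) ^+ 2 * w) by ring.
    by rewrite e1 e2 subrr => /eqP; rewrite mulf_eq0 (negPf two_neq0) => /eqP.
  have ew : w = 0.
    have : 3 * w = (u + 2 * v + 2 ^+ 2 * w) - (u + 1 * v + 1 ^+ 2 * w) - v by ring.
    by rewrite e1 e3 ev !subr0 => /eqP; rewrite mulf_eq0 pnatr_eq0 => /eqP.
  by split=> //; move: e1; rewrite ev ew !mulr0 !addr0.
have E i j : [/\ U i j = 0, V i j = 0 & W i j = 0].
  apply: key.
  - by move/matrixP: h1 => /(_ i j); rewrite !mxE.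
  - by move/matrixP: h2 => /(_ i j); rewrite !mxE.
  - by move/matrixP: h3 => /(_ i j); rewrite !mxE.
by split; apply/matrixP => i j; rewrite [RHS]mxE; case: (E i j).
Qed.

Lemma flat_coefs x : x != 0 -> [/\ x *: dmx (N0 Q) x = 0,
  x *: dmx (N1 Q) x = M1 Q x - (M1 Q x *m N0 Q x - N0 Q x *m M1 Q x) &
  M1 Q x *m N1 Q x = N1 Q x *m M1 Q x].
Proof.
move=> x0.
have [|e1 e2 e3] := @quadratic_coefs (x *: dmx (N0 Q) x)
   (x *: dmx (N1 Q) x - (M1 Q x - (M1 Q x *m N0 Q x - N0 Q x *m M1 Q x)))
   (M1 Q x *m N1 Q x - N1 Q x *m M1 Q x).
  move=> s s0; rewrite -[RHS](connection_flat hQ x0 s0).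
  have -> : dmx (contau Q ^~ s) x = dmx (N0 Q) x + s *: dmx (N1 Q) x.
    by apply: mder_dmx; apply: mderD (mentire_mder x entire_N0) (mderZc s (mentire_mder x
      entire_N1)).
  have -> : dmx (conx Q x) s = M1 Q x.
    apply: mder_dmx; have := mderD (mder_cst (M0 Q x) s) (mderZ (mder_cst (M1 Q x) s)
      (cder_id s)).
    by rewrite scale1r scaler0 addr0 add0r.
  rewrite /conx /contau hflat add0r.
  move: (dmx (N0 Q) x) (dmx (N1 Q) x) (M1 Q x) (N0 Q x) (N1 Q x) => A B C D E.
  by mx_linear.
by split=> //; apply/eqP; rewrite -subr_eq0; apply/eqP.
Qed.

Lemma N0_const x : N0 Q x = N0 Q 0.
Proof.
have H z : z *: dmx (N0 Q) z = 0.
  by have [->|/flat_coefs[]//] := eqVneq z 0; rewrite scale0r.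
apply/eqP; rewrite -subr_eq0; apply/eqP; apply: (mentire_ode0 (F := fun x => N0 Q x - N0 Q 0)).
- by apply: mentireB; [exact: entire_N0|exact: mentire_cst].
- by rewrite subrr.
move=> z; rewrite (mder_dmx (mderB (mentire_mder z entire_N0) (mder_cst (N0 Q 0) z))).
by rewrite subr0.
Qed.

(** Both sides are entire, so the relation known off x = 0 extends to 0 by continuity. Its value at
    0 is what [flat_M] extracts. *)
Lemma flat_N1 x : x *: dmx (N1 Q) x = M1 Q x - (M1 Q x *m N0 Q 0 - N0 Q 0 *m M1 Q x).
Proof.
apply/eqP; rewrite -subr_eq0; apply/eqP; move: x.
apply: mentire_eq0 => [|x /flat_coefs[_ -> _]]; last by rewrite N0_const subrr.
apply: mentireB; first by apply: mentireZ; [exact: entire_id|exact: mentire_dmx entire_N1].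
have c := mentire_cst (N0 Q 0); have m := entire_M1.
by apply: mentireB => //; apply: mentireB; apply: mentireM.
Qed.

Lemma flat_comm x : M1 Q x *m N1 Q x = N1 Q x *m M1 Q x.
Proof.
apply/eqP; rewrite -subr_eq0; apply/eqP; move: x.
apply: mentire_eq0 => [|x /flat_coefs[_ _ ->]]; last by rewrite subrr.
have n := entire_N1; have m := entire_M1.
by apply: mentireB; apply: mentireM.
Qed.

Lemma pair_col (A B G : mx) i j :
  ((A *m delta_mx i (0 : 'I_1))^T *m G *m (B *m delta_mx j (0 : 'I_1))) ord0 ord0 =
  (A^T *m G *m B) i j.
Proof. by rewrite trmx_mul trmx_delta mulmxA -colE mxE -!mulmxA -rowE mxE mulmxA. Qed.

Lemma cder_exprzV (d : int) (s : CC R) : s != 0 ->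
  cder (fun s => (s^-1) ^ d) s (- (d%:~R * s^-1 * (s^-1) ^ d)).
Proof.
move=> s0; case: d => n.
  have := cder_comp (cderV s0) (cderX n (s^-1)).
  rewrite (_ : _ * _ = - (n%:~R * s^-1 * s^-1 ^+ n)) //.
  case: n => [|n]; first by rewrite !mul0r oppr0.
  by rewrite -pmulrn /= (exprS _ n) expr2 invfM; ring.
have E w : w^-1 ^ Negz n = w ^+ n.+1 :> CC R by rewrite /exprz /= exprVn invrK.
rewrite E (_ : - _ = n.+1%:R * s ^+ n.+1.-1); last first.
  by rewrite NegzE mulrNz /= exprS mulNr mulNr opprK -mulrA mulKf.
by apply: cder_ext (cderX n.+1 s) => w; rewrite E.
Qed.

Let delta (i : 'I_mu) : 'cV[CC R]_mu := delta_mx i 0.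

Lemma pair_delta (x s : CC R) i j (A B : mx) :
  pairing Q id (fun _ _ => A *m delta i) (fun _ _ => B *m delta j) x s =
  (s^-1) ^ deg Q * (A^T *m gram Q x *m B) i j.
Proof. by rewrite /pairing pair_col. Qed.

(** Flatness of S is tested on the constant basis sections, whose covariant derivatives are columns
    of the connection matrix. The factor (1 / tau)^deg cancels, and its logarithmic derivative
    leaves [- deg Q] in the direction of tau. *)
Lemma pairing_coefs x s i j : x != 0 -> s != 0 ->
  x * dmx (gram Q) x i j = s * ((M1 Q x)^T *m gram Q x - gram Q x *m M1 Q x) i j /\
  - (deg Q)%:~R * gram Q x i j =
    ((contau Q x s)^T *m gram Q x + gram Q x *m contau Q x (- s)) i j.
Proof.
move=> x0 s0.
pose U : set (CC R * CC R) := [set p | p.1 != 0 /\ p.2 != 0].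
have oU : open U.
  rewrite openE => -[y t] /= [y0 t0].
  have ne (w : CC R) : w != 0 -> nbhs w [set z | z != 0].
    move=> w0; apply/nbhs_CCP; exists (nc w); first by rewrite nc_gt0.
    by move=> z zw; apply/eqP => z0; move: zw; rewrite z0 sub0r ncN ltxx.
  by exists ([set z | z != 0], [set z | z != 0]); [split; exact: ne|move=> -[a b]].
have hc (V : set (CC R * CC R)) (v : 'cV[CC R]_mu) : holo2 V (fun _ _ => v).
  by move=> p _ k l; exact: differentiable_cst.
have [] := @pairing_flat _ _ _ hQ U (fun _ _ => delta i) (fun _ _ => delta j) oU (fun p h
  => h) (hc _ _) (hc _ _) x s (conj x0 s0).
have d1 k : (fun _ _ : CC R => delta k) = (fun _ _ => 1%:M *m delta k).
  by apply/funext => ?; apply/funext => ?; rewrite mul1mx.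
have nx k (y t : CC R) : nabla_x Q (fun _ _ => delta k) y t = (t *: M1 Q y) *m delta k.
  by rewrite /nabla_x (mder_dmx (mder_cst _ _)) scaler0 add0r /conx hflat add0r.
have nt k (y t : CC R) : nabla_tau Q id (fun _ _ => delta k) y t = contau Q y t *m delta k.
  by rewrite /nabla_tau (mder_dmx (mder_cst _ _)) scaler0 add0r.
have sd : (s^-1) ^ deg Q != 0 by rewrite expfz_neq0// invr_eq0.
have p1 y t : pairing Q id (fun _ _ => delta i) (fun _ _ => delta j) y t = (t^-1) ^ deg Q *
  gram Q y i j.
  by rewrite !d1 pair_delta trmx1 mul1mx mulmx1.
have p2 (A : CC R -> CC R -> mx) (a : CC R -> CC R -> 'cV[CC R]_mu) :
    a = (fun y t => A y t *m delta i) ->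
    pairing Q id a (fun _ _ => delta j) x s = (s^-1) ^ deg Q * ((A x s)^T *m gram Q x) i j.
  by move=> ->; rewrite /pairing -[delta j]mul1mx pair_col mulmx1.
have p3 (A : CC R -> CC R -> mx) (a : CC R -> CC R -> 'cV[CC R]_mu) :
    a = (fun y t => A y t *m delta j) ->
    pairing Q id (fun _ _ => delta i) a x s = (s^-1) ^ deg Q * (gram Q x *m A x (- s)) i j.
  by move=> ->; rewrite /pairing -[delta i]mul1mx pair_col trmx1 mul1mx.
rewrite (p2 (fun y t => t *: M1 Q y)); last by apply/funext => y; apply/funext => t; exact: nx.
rewrite (p3 (fun y t => t *: M1 Q y)); last by apply/funext => y; apply/funext => t; exact: nx.
rewrite (p2 (contau Q)); last by apply/funext => y; apply/funext => t; exact: nt.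
rewrite (p3 (contau Q)); last by apply/funext => y; apply/funext => t; exact: nt.
have -> : pairing Q id (fun _ _ => delta i) (fun _ _ => delta j) ^~ s = fun y => (s^-1) ^
  deg Q * gram Q y i j.
  by apply/funext => y; exact: p1.
have -> : pairing Q id (fun _ _ => delta i) (fun _ _ => delta j) x = fun t => gram Q x i j
  * (t^-1) ^ deg Q.
  by apply/funext => t; rewrite p1 mulrC.
have := mentire_mder x entire_gram i j.
move=> /(cderZ ((s^-1) ^ deg Q)) /cder_derive1 ->.
have /(cderZ (gram Q x i j)) /cder_derive1 -> := cder_exprzV (deg Q) s0.
rewrite -!mulrDr => e1 e2; split; apply: (mulfI sd).
  transitivity (x * ((s^-1) ^ deg Q * dmx (gram Q) x i j)); first by ring.
  rewrite e1 linearZ /= -scalemxAl scaleNr mulmxN -scalemxAr !mxE; ring.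
rewrite [in RHS]mxE -e2; field; exact: s0.
Qed.

(** The powers of tau are separated. Because the second argument is taken at - tau, M1 and N1 come
    out self-adjoint, whereas N0, which carries no tau, is skew up to the weight [deg Q]. *)
Lemma gram_relations x : x != 0 ->
  [/\ x *: dmx (gram Q) x = 0, (M1 Q x)^T *m gram Q x = gram Q x *m M1 Q x,
    (N0 Q x)^T *m gram Q x + gram Q x *m N0 Q x = - (deg Q)%:~R *: gram Q x &
    (N1 Q x)^T *m gram Q x = gram Q x *m N1 Q x].
Proof.
move=> x0.
have [|e1 e2 _] := @quadratic_coefs (x *: dmx (gram Q) x) (- ((M1 Q x)^T *m gram Q x - gram
  Q x *m M1 Q x)) 0.
  move=> s s0; apply/matrixP => i j; have [e _] := pairing_coefs i j x0 s0.
  move: e; move: (_ - _ : mx) => A; rewrite !mxE => ->; ring.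
have [|e3 e4 _] := @quadratic_coefs
    ((N0 Q x)^T *m gram Q x + gram Q x *m N0 Q x + (deg Q)%:~R *: gram Q x)
    ((N1 Q x)^T *m gram Q x - gram Q x *m N1 Q x) 0.
  move=> s s0; apply/matrixP => i j; have [_ e] := pairing_coefs i j x0 s0.
  have {}e : (deg Q)%:~R * gram Q x i j =
    - ((contau Q x s)^T *m gram Q x + gram Q x *m contau Q x (- s)) i j by rewrite -e; ring.
  transitivity (((contau Q x s)^T *m gram Q x + gram Q x *m contau Q x (- s)) i j +
    (deg Q)%:~R * gram Q x i j).
    have -> : (contau Q x s)^T = (N0 Q x)^T + s *: (N1 Q x)^T by apply/matrixP => k l;
      rewrite !mxE.
    rewrite /contau scaleNr mulmxDl mulmxDr mulmxN -scalemxAl -scalemxAr.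
    by mulmx_atoms; rewrite !mxE; ring.
  by rewrite e [RHS]mxE subrr.
split=> //.
- by apply/eqP; rewrite -subr_eq0 -oppr_eq0; apply/eqP.
- by apply/eqP; rewrite -subr_eq0 scaleNr opprK; apply/eqP.
- by apply/eqP; rewrite -subr_eq0; apply/eqP.
Qed.

Lemma gram_const x : gram Q x = gram Q 0.
Proof.
have H z : z *: dmx (gram Q) z = 0.
  by have [->|/gram_relations[]//] := eqVneq z 0; rewrite scale0r.
apply/eqP; rewrite -subr_eq0; apply/eqP;
  apply: (mentire_ode0 (F := fun x => gram Q x - gram Q 0)).
- by apply: mentireB; [exact: entire_gram|exact: mentire_cst].
- by rewrite subrr.
move=> z; rewrite (mder_dmx (mderB (mentire_mder z entire_gram) (mder_cst (gram Q 0) z))).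
by rewrite subr0.
Qed.

Lemma mentire_tr (F : CC R -> mx) : mentire F -> mentire (fun z => (F z)^T).
Proof. by move=> hF; apply: mder_entire => z; eexists; exact: mder_tr (mentire_mder z hF). Qed.

Lemma sym_extend (F : CC R -> mx) : mentire F ->
  (forall x, x != 0 -> (F x)^T *m gram Q x = gram Q x *m F x) ->
  forall x, (F x)^T *m gram Q 0 = gram Q 0 *m F x.
Proof.
move=> hF H x; apply/eqP; rewrite -subr_eq0; apply/eqP; move: x.
apply: mentire_eq0 => [|x /H]; last by rewrite gram_const => ->; rewrite subrr.
have c := mentire_cst (gram Q 0); have t := mentire_tr hF.
by apply: mentireB; apply: mentireM.
Qed.

Lemma M1_sym x : (M1 Q x)^T *m gram Q 0 = gram Q 0 *m M1 Q x.
Proof. by apply: sym_extend => [|y /gram_relations[]//]; exact: entire_M1. Qed.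

Lemma N1_sym x : (N1 Q x)^T *m gram Q 0 = gram Q 0 *m N1 Q x.
Proof. by apply: sym_extend => [|y /gram_relations[]//]; exact: entire_N1. Qed.

Lemma N0_antisym : (N0 Q 0)^T *m gram Q 0 + gram Q 0 *m N0 Q 0 = - (deg Q)%:~R *: gram Q 0.
Proof.
by have [_ _ + _] := gram_relations (oner_neq0 _); rewrite N0_const gram_const.
Qed.

End FlatSystem.

(** * The formal fundamental solution *)

Section ExponentialSeries.
Variables (R : realType) (mu : nat) (M : 'M[CC R]_mu).
Local Notation mx := 'M[CC R]_mu.

(* Coefficients in tau of exp (- tau t M). *)
Definition expcoef (t : CC R) : pser R mu := fun n => ((- t) ^+ n / n`!%:R) *: M ^+ n.

Lemma fact_neq0 n : n`!%:R != 0 :> CC R.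
Proof. by rewrite pnatr_eq0 -lt0n fact_gt0. Qed.

Lemma mxpowS (A : mx) n : A ^+ n.+1 = A *m A ^+ n.
Proof. by rewrite exprS mulmxE. Qed.

Lemma expcoef0 t : expcoef t 0%N = 1%:M.
Proof. by rewrite /expcoef !expr0 fact0 divr1 scale1r. Qed.

Lemma expcoef_at0 n : expcoef 0 n = @ps1 R mu n.
Proof. by case: n => [|n]; rewrite ?expcoef0// /expcoef oppr0 exprS mul0r mul0r scale0r. Qed.

Lemma expcoef_comm (X : mx) t n : X *m M = M *m X -> X *m expcoef t n = expcoef t n *m X.
Proof.
move=> XM; rewrite /expcoef -scalemxAr -scalemxAl; congr (_ *: _).
elim: n => [|n ih]; first by rewrite expr0 mulmx1 mul1mx.
by rewrite mxpowS mulmxA XM -[LHS]mulmxA ih [LHS]mulmxA.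
Qed.

Lemma mder_expcoef t n : mder (expcoef^~ n) t (- (M *m pstau (expcoef t) n)).
Proof.
case: n => [|n].
  rewrite /= mulmx0 oppr0; apply: mder_ext (mder_cst 1%:M t) => w.
  by rewrite expcoef0.
have dN : cder (fun w : CC R => - w) t (-1) by exact: cderN (cder_id t).
have := mderZ (mder_cst (M ^+ n.+1) t) (cderZ (n.+1`!%:R)^-1 (cder_comp dN (cderX n.+1 (-
  t)))).
rewrite scaler0 addr0 (_ : _ *: M ^+ n.+1 = - (M *m pstau (expcoef t) n.+1)).
  by apply: mder_ext => w; rewrite /expcoef mulrC.
rewrite /= /expcoef -scalemxAr mxpowS -scaleNr; congr (_ *: _).
have f0 := fact_neq0 n; have n0 : n.+1%:R != 0 :> CC R by rewrite pnatr_eq0.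
rewrite factS natrM /=; move: f0 n0.
by move: (n`!%:R) (n.+1%:R) => b a b0 a0; field; rewrite a0 b0.
Qed.

Lemma mder0_const m n (F : CC R -> 'M[CC R]_(m, n)) : (forall z, mder F z 0) ->
  forall z w, F z = F w.
Proof.
move=> H z w; apply/matrixP => i j; apply: (@cder0_segment _ (fun u => F u i j)) => s _.
  by have := H (w + (z - w) * s%:C%C) i j; rewrite mxE.
exact: cder_cont (H _ i j).
Qed.

(** The product has derivative 0 in t and equals 1 at t = 0, which avoids binomial sums. *)
Lemma expcoef_inv t n : psmul (expcoef (- t)) (expcoef t) n = @ps1 R mu n.
Proof.
have dM w k : mder (fun w => expcoef (- w) k) w (M *m pstau (expcoef (- w)) k).
  have dN : cder (fun w : CC R => - w) w (-1) by exact: cderN (cder_id w).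
  have := mder_comp (mder_expcoef (- w) k) dN.
  by rewrite scaleN1r opprK.
have d w : mder (fun w => psmul (expcoef (- w)) (expcoef w) n) w 0.
  have := mder_psmul n (dM w) (mder_expcoef w).
  rewrite psmulNr psmul_mxl psmul_taul.
  have -> : psmul (expcoef (- w)) (fun k => M *m pstau (expcoef w) k) n =
     M *m pstau (psmul (expcoef (- w)) (expcoef w)) n.
    rewrite -psmul_taur -psmul_mxl -psmul_mxm; apply: eq_psmul => // k.
    by rewrite expcoef_comm.
  by rewrite subrr.
rewrite (mder0_const d t 0) oppr0 -[RHS]psmul1l; apply: eq_psmul => k; exact: expcoef_at0.
Qed.

Lemma ratio_bounded (u : nat -> R) (N : nat) : (forall n, 0 <= u n) ->
  (forall n, (N <= n)%N -> u n.+1 <= u n) -> exists C : R, forall n, u n <= C.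
Proof.
move=> u0 hu; exists (\sum_(k < N.+1) u k).
have small k : (k <= N)%N -> u k <= \sum_(k < N.+1) u k.
  move=> kN; rewrite (bigD1 (Ordinal (kN : (k < N.+1)%N)))//=.
  by rewrite lerDl sumr_ge0.
elim=> [|n ih]; first exact: small.
have [nN|Nn] := leqP n.+1 N; first exact: small.
exact: le_trans (hu _ Nn) ih.
Qed.

Lemma mnorm_expcoef t n : mnorm (expcoef t n) * n`!%:R <= (nc t * mnorm M) ^+ n * mnorm
  (1%:M : mx).
Proof.
have pow k : mnorm (M ^+ k) <= mnorm M ^+ k * mnorm (1%:M : mx).
  elim: k => [|k ih]; first by rewrite !expr0 mul1r.
  rewrite mxpowS exprS -mulrA; apply: le_trans (mnormM _ _) _.
  by rewrite ler_wpM2l ?mnorm_ge0.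
rewrite /expcoef mnormZ ncM ncX ncV ncN nc_nat mulrAC mulfVK ?pnatr_eq0 -?lt0n ?fact_gt0//.
by rewrite exprMn -mulrA ler_wpM2l// exprn_ge0// nc_ge0.
Qed.

Lemma ecoef_expcoef t i j : ecoef (fun n => expcoef t n i j).
Proof.
move=> r r0; pose c := nc t * mnorm M * r.
have c0 : 0 <= c by rewrite !mulr_ge0 ?nc_ge0 ?mnorm_ge0// ltW.
have fp n : 0 < n`!%:R :> R by rewrite ltr0n fact_gt0.
have [|n|C hC] := @ratio_bounded (fun n => c ^+ n / n`!%:R) (Num.Def.archi_bound c).
- by move=> n; rewrite divr_ge0 ?exprn_ge0.
- move=> cn; rewrite exprS factS natrM ler_pdivrMr ?mulr_gt0//.
  rewrite (_ : _ / _ * _ = n.+1%:R * c ^+ n); last by field; rewrite gt_eqF.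
  rewrite ler_wpM2r ?exprn_ge0// ltW// (lt_le_trans (archi_boundP c0))// ler_nat.
  exact: leqW.
exists (C * mnorm (1%:M : mx)) => n.
apply: le_trans (_ : (c ^+ n / n`!%:R) * mnorm (1%:M : mx) <= _);
  last by rewrite ler_wpM2r ?mnorm_ge0.
apply: le_trans (_ : mnorm (expcoef t n) * r ^+ n <= _).
  by rewrite ler_wpM2r ?nc_le_mnorm// exprn_ge0// ltW.
rewrite mulrAC ler_pdivlMr//  mulrAC.
have := ler_wpM2r (exprn_ge0 n (ltW r0)) (mnorm_expcoef t n).
by rewrite [X in _ <= X -> _]mulrAC -exprMn.
Qed.

Lemma csums_lim (a : nat -> CC R) s : csums a s -> limn (fun n => \sum_(k < n) a k) = s.
Proof.
move=> h; apply: cvg_lim => // P /nbhs_CCP[e e0 hP]; have [N hN] := h _ e0.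
by exists N => // n /hN; exact: hP.
Qed.

(** Links [expm], a limit of partial sums, to a power series in tau, so that the Taylor coefficients
    of [Psol] can be read off. *)
Lemma psum_expm t i j : psum (fun n => expcoef t n i j) (fun s => expm (- (s * t) *: M) i j).
Proof.
have [f hf] := psum_ex (ecoef_expcoef t i j); split=> [|s]; first exact: ecoef_expcoef.
suff -> : expm (- (s * t) *: M) i j = f s by exact: hf.2.
rewrite /expm mxE -(csums_lim (hf.2 s)); congr (limn _); apply/funext => n.
rewrite summxE; apply: eq_bigr => k _.
have -> : (- (s * t) *: M) ^+ k = (- (s * t)) ^+ k *: M ^+ k.
  elim: (k : nat) => [|m ih]; first by rewrite !expr0 scale1r.
  by rewrite !mxpowS exprS ih -scalemxAl -scalemxAr scalerA.
by rewrite /expcoef !mxE -mulrN exprMn; ring.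
Qed.

End ExponentialSeries.

Section HalfPlane.
Variable R : realType.

Lemma discE (r : \bar R) (z : CC R) : disc r z <-> ((nc z)%:E < r)%E.
Proof. by rewrite -nc_Re. Qed.

Lemma logdiscE (r : \bar R) (t : CC R) : logdisc r t <-> ((expR (complex.Re t))%:E < r)%E.
Proof. by rewrite -nc_cexp -discE. Qed.

Lemma logdisc_le (r : \bar R) (t u : CC R) : complex.Re u <= complex.Re t ->
  logdisc r t -> logdisc r u.
Proof.
move=> ut /logdiscE h; apply/logdiscE; apply: le_lt_trans h.
by rewrite lee_fin ler_expR.
Qed.

(** Membership only depends on the real part and is inherited to the left: the region is convex. *)
Lemma logdisc_segment (r : \bar R) (t u : CC R) (s : R) : logdisc r t -> logdisc r u ->
  0 <= s <= 1 -> logdisc r (t + (u - t) * s%:C%C).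
Proof.
move=> ht hu /andP[s0 s1].
have E : complex.Re (t + (u - t) * s%:C%C) = complex.Re t + s * (complex.Re u - complex.Re t).
  by rewrite ReD [_ * s%:C%C]mulrC ReZ ReD ReN.
have [ut|tu] := leP (complex.Re u) (complex.Re t).
  by apply: logdisc_le ht; rewrite E; nra.
by apply: logdisc_le hu; rewrite E; nra.
Qed.

Lemma logdisc_const m n (r : \bar R) (F : CC R -> 'M[CC R]_(m, n)) :
  (forall t, logdisc r t -> mder F t 0) ->
  forall t u, logdisc r t -> logdisc r u -> F u = F t.
Proof.
move=> H t u ht hu; apply/matrixP => i j.
apply: (@cder0_segment _ (fun w => F w i j)) => s hs.
  have /andP[s0 s1] := hs.
  have s01 : 0 <= s <= 1 by rewrite !ltW.
  by have := H _ (logdisc_segment ht hu s01) i j; rewrite mxE.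
exact: cder_cont (H _ (logdisc_segment ht hu hs) i j).
Qed.

End HalfPlane.

Section FormalSolution.
Variables (R : realType) (mu : nat) (Q : qds_data R mu).
Hypotheses (hQ : log_qds Q) (hflat : flat_qds Q).
Variable h : nat -> CC R -> 'M[CC R]_mu.
Hypothesis hh : gauge_sol (M1 Q) h.
Local Notation mx := 'M[CC R]_mu.
Local Notation M := (M1 Q 0).
Local Notation eta := (gram Q 0).

Let eta_unit : eta \in unitmx. Proof. exact: gram_nondegenerate hQ 0. Qed.

Lemma mulmx_pstau (X : mx) (A : pser R mu) :
  (fun k => X *m pstau A k) = pstau (fun k => X *m A k).
Proof. by apply/funext => -[|k] //=; rewrite mulmx0. Qed.

Definition formal_sol (t : CC R) : pser R mu := psmul (h ^~ (cexp t)) (expcoef M t).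

(** The term H M of the gauge equation cancels the derivative of the exponential, and the Dubrovin
    equation remains. The chain rule through x = cexp t turns x d/dx into d/dt. *)
Lemma formal_sol_ode n t :
  mder (formal_sol ^~ n) t (- (M1 Q (cexp t) *m pstau (formal_sol t) n)).
Proof.
have dh k : mder (fun w => h k (cexp w)) t (- (M1 Q (cexp t) *m pstau (h ^~ (cexp t)) k -
    pstau (h ^~ (cexp t)) k *m M)).
  rewrite -(gauge_ode hh); apply: mder_comp (cder_cexp t).
  by case: hh => _ he _ _; exact: mentire_mder.
have := mder_psmul n dh (mder_expcoef M t).
set D := _ + _; suff -> : D = - (M1 Q (cexp t) *m pstau (formal_sol t) n) by [].
rewrite /D psmulNl psmulDl psmulNl psmul_mxl psmul_taul psmul_mxm psmul_taul psmulNr.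
by rewrite mulmx_pstau psmul_taur opprB addrAC subrr sub0r.
Qed.

Lemma formal_sol0 t : formal_sol t 0%N = 1%:M.
Proof. by rewrite /formal_sol /psmul big_ord1 expcoef0 mulmx1; case: hh => ->. Qed.

Definition star_series (A : pser R mu) : pser R mu := fun k => (-1) ^+ k *: eta_star eta (A k).

Lemma star_psmul (A C : pser R mu) n :
  star_series (psmul A C) n = psmul (star_series C) (star_series A) n.
Proof.
rewrite /star_series /psmul /eta_star linear_sum mulmx_sumr mulmx_suml scaler_sumr.
rewrite (reindex_inj rev_ord_inj) /=; apply: eq_bigr => i _.
rewrite subSS subKn -1?ltnS// -scalemxAl -scalemxAr scalerA.
have := eta_starM eta_unit (A (n - i)%N) (C i); rewrite /eta_star => ->.
by rewrite -exprD subnKC// -ltnS.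
Qed.

Lemma star_expcoef t k : star_series (expcoef M t) k = expcoef M (- t) k.
Proof.
have pw j : eta_star eta (M ^+ j) = M ^+ j.
  elim: j => [|j ih]; first by rewrite expr0; exact: eta_star1 eta_unit.
  rewrite {1}mxpowS (eta_starM eta_unit) ih (eta_star_M1 eta_unit (M1_sym hQ hflat)).
  by rewrite exprSr mulmxE.
rewrite /star_series /expcoef eta_starZ pw scalerA; congr (_ *: _).
by rewrite mulrA -exprMn mulN1r.
Qed.

(** By the symmetry proved below this adjoint is the inverse, so no power series has to be
    inverted. *)
Definition formal_inv t : pser R mu := star_series (formal_sol t).

Lemma formal_invE t n : formal_inv t n = psmul (expcoef M (- t)) (hstar eta h (cexp t)) n.
Proof.
rewrite /formal_inv /formal_sol star_psmul; apply: eq_psmul => k //.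
exact: star_expcoef.
Qed.

Lemma formal_invP t : psmul (formal_inv t) (formal_sol t) =1 @ps1 R mu.
Proof.
move=> n; rewrite (eq_psmul n (formal_invE t) (fun k => erefl)) -psmulA.
rewrite -[RHS](expcoef_inv M t); apply: eq_psmul => // k.
rewrite /formal_sol psmulA -[RHS]psmul1l; apply: eq_psmul => // j.
exact (hstarP eta_unit (M1_sym hQ hflat) hh (cexp t) j).
Qed.

Lemma formal_solP t : psmul (formal_sol t) (formal_inv t) =1 @ps1 R mu.
Proof. by apply: psmul_linv (formal_invP t); rewrite formal_sol0 unitmx1. Qed.

Lemma pstar_formal t n : pstar Q formal_sol t n = formal_inv t n.
Proof. by rewrite /pstar (gram_const hQ hflat). Qed.

Lemma formal_inv_ode n t : mder (formal_inv ^~ n) t (pstau (formal_inv t) n *m M1 Q (cexp t)).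
Proof.
have d := mderZc ((-1) ^+ n) (mder_eta_star eta (formal_sol_ode n t)).
suff <- : (-1) ^+ n *: eta_star eta (- (M1 Q (cexp t) *m pstau (formal_sol t) n)) =
  pstau (formal_inv t) n *m M1 Q (cexp t) by exact: d.
clear d; case: n => [|n]; first by rewrite /= mulmx0 oppr0 eta_star0 scaler0 mul0mx.
rewrite /= -[- (_ *m _)]scaleN1r eta_starZ (eta_starM eta_unit) (eta_star_M1 eta_unit
  (M1_sym hQ hflat)).
by rewrite scalerA -exprSr 2!exprS mulrA mulrNN !mul1r /formal_inv /star_series -scalemxAl.
Qed.

(** From [M, N0] = M follows [M^j, N0] = j M^j, and j is the weight of tau^j under tau d/dtau. Hence
    a base change by the exponential leaves the term N0 unchanged. *)
Lemma expcoef_N0 t k : N0 Q 0 *m expcoef M t k +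
  k%:R *: expcoef M t k = expcoef M t k *m N0 Q 0.
Proof.
have pw j : N0 Q 0 *m M ^+ j + j%:R *: M ^+ j = M ^+ j *m N0 Q 0.
  elim: j => [|j ih]; first by rewrite expr0 scale0r addr0 mulmx1 mul1mx.
  rewrite !mxpowS mulmxA (flat_M (flat_N1 hQ hflat)) mulmxBl -natr1 scalerDl scale1r.
  rewrite -[RHS]mulmxA -ih mulmxDr -scalemxAr mulmxA.
  by rewrite addrACA addNr addr0.
by rewrite /expcoef -scalemxAr -scalemxAl -pw scalerDr !scalerA; congr (_ + _ *: _);
  rewrite mulrC.
Qed.

(** H turns N0 + tau N1(x) into N0 + tau N1(0) by [conj_defect0]. The exponential preserves the
    latter, by [expcoef_N0] and because N1(0) commutes with M1(0). *)
Lemma formal_sol_tau t n :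
  N0 Q 0 *m formal_sol t n + N1 Q (cexp t) *m pstau (formal_sol t) n + n%:R *: formal_sol t n =
  formal_sol t n *m N0 Q 0 + pstau (formal_sol t) n *m N1 Q 0.
Proof.
have hN1 := entire_N1 hQ; have f1 := flat_N1 hQ hflat; have f2 := flat_comm hQ hflat.
pose x := cexp t.
have K k : N0 Q 0 *m h k x + N1 Q x *m pstau (h ^~ x) k + k%:R *: h k x =
    h k x *m N0 Q 0 + pstau (h ^~ x) k *m N1 Q 0.
  have := conj_defect0 hN1 f1 f2 hh k x; rewrite /conj_defect => /eqP.
  by rewrite !subr_eq add0r => /eqP ->; exact: addrC.
rewrite /formal_sol psmul_deg -psmul_mxl -psmul_taul -psmul_mxl addrA -2!psmulDl.
rewrite (eq_psmul n K (fun k => erefl)) psmulDl !psmul_mxm addrAC -psmulDr.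
rewrite (eq_psmul n (fun k => erefl) (expcoef_N0 t)) psmul_mxr; congr (_ + _).
rewrite -psmul_mxr; apply: eq_psmul => // k; apply: expcoef_comm.
by rewrite flat_MN.
Qed.

Lemma formal_base_change r : base_change Q r formal_sol (fun _ _ => 0)
  (fun _ => nth 0 [:: N0 Q 0; N1 Q 0]).
Proof.
move=> t _; exists (formal_inv t); split; [exact: formal_solP|exact: formal_invP| |].
  move=> n; rewrite -psmulDr.
  have E k : psmul (nth 0 [:: M0 Q (cexp t); M1 Q (cexp t)]) (formal_sol t) k
      + dmx (formal_sol ^~ k) t = 0.
    by rewrite psmul_poly1 hflat mul0mx add0r (mder_dmx (formal_sol_ode _ t)) subrr.
  rewrite (eq_psmul n (fun k => erefl) E).
  by rewrite /psmul big1// => i _; rewrite mulmx0.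
move=> n; rewrite -psmulDr.
have E k : psmul (nth 0 [:: N0 Q (cexp t); N1 Q (cexp t)]) (formal_sol t) k
    + k%:R *: formal_sol t k = psmul (formal_sol t) (nth 0 [:: N0 Q 0; N1 Q 0]) k.
  by rewrite psmul_poly1 psmul_poly1r (N0_const hQ hflat) formal_sol_tau.
rewrite (eq_psmul n (fun k => erefl) E) psmulA -[LHS]psmul1l; apply/esym.
by apply: eq_psmul => // k; exact: formal_invP.
Qed.

Lemma formal_symmetric r : symmetric_sol Q r formal_sol.
Proof.
by move=> t _ n; rewrite (eq_psmul n (pstar_formal t) (fun k => erefl)) formal_invP.
Qed.

Lemma formal_conformal r c : c != 0 -> M1 Q 0 = c *: N1 Q 0 -> conformal_sol Q r formal_sol.
Proof.
move=> c0 Mc; exists 1%N, (nth 0 [:: N0 Q 0; N1 Q 0]); split; last exact: formal_base_change.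
  by case=> [|[|k]] //= _; rewrite nth_nil.
case=> [|[|k]] //= _; last by rewrite nth_nil mulmx0 mul0mx subrr scaler0 oppr0.
have := flat_M (flat_N1 hQ hflat); rewrite Mc -scalemxAr -scalemxAl -scalerBr.
move/(congr1 (fun X => c^-1 *: X)); rewrite !scalerA mulVf// !scale1r => ->.
by rewrite addrAC subrr sub0r.
Qed.

Lemma fundamental_der r F : fundamental Q r F -> forall t, logdisc r t -> forall n,
  mder (F ^~ n) t (- (M1 Q (cexp t) *m pstau (F t) n)).
Proof.
move=> [hF _ dF] t ht n.
have dm : mder (F ^~ n) t (dmx (F ^~ n) t).
  by move=> i j; rewrite mxE; apply: derivable_cder; exact: hF.
suff <- : dmx (F ^~ n) t = - (M1 Q (cexp t) *m pstau (F t) n) by [].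
apply/eqP; rewrite -addr_eq0 -[X in _ == X](dF t ht n) /dubrovin; apply/eqP; congr (_ + _).
by case: (n) => [|k] //=; rewrite mulmx0.
Qed.

Lemma fundamental_formal r : fundamental Q r formal_sol.
Proof.
split.
- by move=> n t _ i j; exact: mder_derivable (formal_sol_ode n t).
- by move=> t _; rewrite formal_sol0 unitmx1.
move=> t _ n; rewrite /dubrovin (mder_dmx (formal_sol_ode n t)).
by case: n => [|n] /=; rewrite ?mulmx0 ?oppr0 ?addr0 // addNr.
Qed.

(** [formal_inv] solves the adjoint equation, so its product with F has derivative 0 in t and is
    constant on the convex half-plane; this constant is [Pcl]. *)
Lemma fundamental_unique r F : fundamental Q r F -> exists Pcl : pser R mu,
  forall t, logdisc r t -> forall n, F t n = psmul (formal_sol t) Pcl n.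
Proof.
move=> hF.
have d n t : logdisc r t -> mder (fun w => psmul (formal_inv w) (F w) n) t 0.
  move=> ht; have H := mder_psmul n (formal_inv_ode^~ t) (fundamental_der hF ht).
  have e1 := etrans (psmul_mxm (M1 Q (cexp t)) (pstau (formal_inv t)) (F t) n) (psmul_taul
    _ _ _).
  have e2 := etrans (congr1 (fun A => psmul (formal_inv t) A n) (mulmx_pstau (M1 Q (cexp
    t)) (F t)))
    (psmul_taur _ _ _).
  have e3 := etrans (psmulNr (fun k => M1 Q (cexp t) *m pstau (F t) k) (formal_inv t) n)
    (congr1 -%R e2).
  have Z := etrans (congr2 +%R e1 e3) (subrr _).
  by move: H; rewrite [X in mder _ _ X -> _]Z.
(* The half-plane is empty when r <= 0; any series will then do. *)
have [[t0 ht0]|none] := pselect (exists t0, logdisc r t0); last first.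
  by exists (fun=> 0) => t ht; case: none; exists t.
exists (psmul (formal_inv t0) (F t0)) => t ht n.
have E k : psmul (formal_inv t) (F t) k = psmul (formal_inv t0) (F t0) k.
  exact: (logdisc_const (d k) ht0 ht).
rewrite -(eq_psmul n (fun k => erefl) E) psmulA -[LHS]psmul1l.
by apply: eq_psmul => // k; rewrite formal_solP.
Qed.

End FormalSolution.

(** * Convergence and uniqueness *)

Section JointDifferentiability.
Variable R : realType.

Definition lin2 (a b : CC R) (q : CC R * CC R) : CC R := a * q.1 + b * q.2.

Lemma lin2_linear a b : linear (lin2 a b).
Proof. by move=> c p q; rewrite /lin2 /= /GRing.scale /=; ring. Qed.

HB.instance Definition _ a b :=
  GRing.isLinear.Build (CC R) (CC R * CC R)%type (CC R) *:%R (lin2 a b) (lin2_linear a b).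

Lemma lin2_continuous a b : continuous (lin2 a b).
Proof.
move=> q P /nbhs_CCP[e e0 hP].
have B : 0 < nc a + nc b + 1 by have := nc_ge0 a; have := nc_ge0 b; lra.
have d0 : 0 < e / (nc a + nc b + 1) by rewrite divr_gt0.
exists ([set z | nc (z - q.1) < e / (nc a + nc b + 1)],
  [set z | nc (z - q.2) < e / (nc a + nc b + 1)]).
  by split; apply/nbhs_CCP; exists (e / (nc a + nc b + 1)).
move=> -[z w] /= []; rewrite !ltr_pdivlMr// => hz hw; apply: hP.
rewrite /lin2 /= (_ : _ - _ = a * (z - q.1) + b * (w - q.2)); last by ring.
apply: le_lt_trans (ncD _ _) _; rewrite !ncM.
have := nc_ge0 (z - q.1); have := nc_ge0 (w - q.2); have := nc_ge0 a; have := nc_ge0 b.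
move: hz hw; set u := nc (z - _); set v := nc (w - _) => *.
have [uv|uv] := leP u v; nra.
Qed.

Lemma norm_pair (p : CC R * CC R) : `|p| = (Num.max (nc p.1) (nc p.2))%:C%C.
Proof.
rewrite prod_normE !ncE maxElt ltcR [in RHS]maxElt.
by case: ifP.
Qed.

Lemma differentiable2 (f : CC R * CC R -> CC R) (x s a b : CC R) :
  (forall e : R, 0 < e -> exists2 d : R, 0 < d & forall u v, nc u < d -> nc v < d ->
     nc (f (x + u, s + v) - f (x, s) - (a * u + b * v)) <= e * (nc u + nc v)) ->
  differentiable f (x, s).
Proof.
move=> H.
have E : f \o shift (x, s) = cst (f (x, s)) + lin2 a b +o_ (0 : CC R * CC R) id.
  apply/eqaddoP => e /CC_gt0[e' e0 ->].
  have e2 : 0 < e' / 2 by rewrite divr_gt0.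
  have [d d0 hd] := H _ e2.
  exists ([set u | nc u < d], [set v | nc v < d]).
    by split; apply/nbhs_CCP; exists d => // w; rewrite subr0.
  move=> [u v] /= [hu hv]; rewrite norm_pair ncE -rmorphM lecR /=.
  have := hd u v hu hv.
  have -> : (f \o shift (x, s) - (cst (f (x, s)) + lin2 a b)) (u, v) =
      f (x + u, s + v) - f (x, s) - (a * u + b * v).
    rewrite !fctE /= /shift /= /lin2 /= opprD addrA; congr (f _ - _ - _).
    by rewrite -[RHS]/((x, s) + (u, v)) addrC.
  move/le_trans; apply.
  have : nc u <= Num.max (nc u) (nc v) by rewrite le_max lexx.
  have : nc v <= Num.max (nc u) (nc v) by rewrite le_max lexx orbT.
  by move: (Num.max _ _) => N *; nra.
have D := diff_unique (@lin2_continuous a b) E.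
by apply/diff_locallyP; rewrite D; split=> //; exact: lin2_continuous.
Qed.

End JointDifferentiability.

Section GaugeTransformation.
Variables (R : realType) (mu : nat) (Q : qds_data R mu).
Hypotheses (hQ : log_qds Q) (hflat : flat_qds Q).
Variable h : nat -> CC R -> 'M[CC R]_mu.
Hypothesis hh : gauge_sol (M1 Q) h.
Local Notation mx := 'M[CC R]_mu.
Local Notation M := (M1 Q 0).

Let bound := gauge_bound (entire_N1 hQ) (flat_N1 hQ hflat) (flat_comm hQ hflat) hh.

Lemma gauge_coef_bound (x : CC R) (r s : R) : 0 < r -> 0 < s ->
  exists2 C, 0 <= C & forall n w i j, nc (w - x) <= r -> nc (h n w i j) * s ^+ n <= C.
Proof.
move=> r0 s0; have rr : 0 < nc x + r by have := nc_ge0 x; lra.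
have [C hC] := bound rr s0.
have H n w i j : nc (w - x) <= r -> nc (h n w i j) * s ^+ n <= C.
  move=> wx; apply: le_trans (hC n w _).
    by rewrite ler_wpM2r ?nc_le_mnorm// exprn_ge0// ltW.
  by have := ncD (w - x) x; rewrite subrK; lra.
exists (Num.max C 0); first by rewrite le_max lexx orbT.
by move=> n w i j /H hC'; rewrite le_max hC'.
Qed.

Lemma gauge_ex : exists H : CC R -> CC R -> mx, forall x i j,
  psum (fun n => h n x i j) (fun s => H x s i j).
Proof.
have /choice[F hF] : forall p : CC R * ('I_mu * 'I_mu), exists f,
  psum (fun n => h n p.1 p.2.1 p.2.2) f.
  move=> [x [i j]]; apply: psum_ex => s s0 /=.
  have [C _ hC] := gauge_coef_bound x ltr01 s0; exists C => n.
  by apply: hC; rewrite subrr nc0.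
exists (fun x s => \matrix_(i, j) F (x, (i, j)) s) => x i j.
apply: psum_ext (hF (x, (i, j))) => // s; by rewrite mxE.
Qed.

Variable H : CC R -> CC R -> mx.
Hypothesis hH : forall x i j, psum (fun n => h n x i j) (fun s => H x s i j).

Lemma gauge_entire x : mentire (H x).
Proof. by move=> i j; exact: psum_entire (hH x i j). Qed.

Lemma gauge_at0 s : H 0 s = 1%:M.
Proof.
apply/matrixP => i j; have z : psum (fun=> 0) (fun=> 0 : CC R).
  have := psumZ 0 (entire_coef (entire_cst (0 : CC R))).
  by apply: psum_ext => ?; rewrite mul0r.
have hc : psum (fun n => h n 0 i j) (fun s => (1%:M : mx) i j + s * 0).
  by apply: psum_ext (psum_cons _ z) => // -[|n] /=; case: hh => h0 _ hS _;
    rewrite ?h0 ?hS ?mxE.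
by rewrite (psum_unique (hH 0 i j) hc s) mulr0 addr0.
Qed.

(** Each [h n] is expanded to first order in x with the uniform remainder of [entire_quad]. Summed
    against powers of tau, this gives the partial derivative [g] in x and a quadratic error uniform
    for tau near s; in the direction of tau, H is entire with derivative [l]. *)
Lemma gauge_holo2 (r : \bar R) : holo2 [set p | disc r p.1] H.
Proof.
move=> [x s] _ i j; rewrite /=.
(* |s + v| <= |s| + 1 for |v| <= 1, and the factor 2 provides the geometric ratio 1/2. *)
have s0 : 0 < 2 * (nc s + 1) by have := nc_ge0 s; lra.
have [C C0 hC] := gauge_coef_bound x (ltr0n R 2) s0.
pose hn n w := h n w i j.
have he n : entire (hn n) by case: hh => _ he _ _; exact: he.
have hB n w : nc (w - x) <= 2 -> nc (hn n w) <= C / (2 * (nc s + 1)) ^+ n.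
  by move=> wx; rewrite ler_pdivlMr ?exprn_gt0//; exact: hC.
pose c n := derive1 (hn n) x.
have hc : ecoef c.
  move=> u u0; have [D _ hD] := gauge_coef_bound x (ltr0n R 2) u0; exists D => n.
  rewrite -ler_pdivlMr ?exprn_gt0//.
  have [|//] := @entire_quad _ (hn n) x (D / u ^+ n) (he n).
  by move=> w wx; rewrite ler_pdivlMr ?exprn_gt0//; exact: hD.
have [g hg] := psum_ex hc.
have [l hl] := psum_entire (hH x i j) s.
have [m hm] := psum_entire hg s.
have quad u v : nc u <= 1 -> nc v <= 1 ->
    nc (H (x + u) (s + v) i j - H x (s + v) i j - g (s + v) * u) <= 8 * C * nc u ^+ 2.
  move=> u1 v1.
  have : csums (fun n => (hn n (x + u) - hn n x - c n * u) * (s + v) ^+ n)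
     (H (x + u) (s + v) i j - H x (s + v) i j - g (s + v) * u).
    have := csumsD (csumsD ((hH (x + u) i j).2 (s + v)) (csumsZ (-1) ((hH x i j).2 (s + v))))
       (csumsZ (- u) (hg.2 (s + v))).
    by rewrite mulN1r mulNr (mulrC u); apply: csums_ext => n; rewrite /hn; ring.
  move/csums_le => /(_ (fun n => 4 * C * nc u ^+ 2 * (2^-1) ^+ n)); apply.
    move=> n; rewrite ncM.
    have [_ /(_ u u1) q] := entire_quad (he n) (hB n).
    apply: le_trans (_ : (4 * (C / (2 * (nc s + 1)) ^+ n) * nc u ^+ 2) * (nc s + 1) ^+ n <= _).
      rewrite ncX; apply: ler_pM; rewrite ?nc_ge0 ?exprn_ge0 ?nc_ge0//.
      by rewrite lerXn2r ?nnegrE ?nc_ge0//; have := ncD s v; have := nc_ge0 s; lra.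
    have sn : (nc s + 1) ^+ n != 0 by rewrite expf_neq0// gt_eqF//; have := nc_ge0 s; lra.
    have tn : 2 ^+ n != 0 :> R by rewrite expf_neq0.
    rewrite exprMn exprVn le_eqVlt; apply/orP; left; apply/eqP.
    by field; rewrite sn tn.
  move=> n; rewrite (_ : 8 * C * _ = 2 * (4 * C * nc u ^+ 2)); last by ring.
  by apply: sum_geo_le; rewrite !mulr_ge0 ?exprn_ge0 ?nc_ge0.
apply: (@differentiable2 _ _ x s (g s) l) => e e0 /=.
have e3 : 0 < e / 3 by rewrite divr_gt0.
have [d1 d10 h1] := hl _ e3.
have [d2 d20 h2] := cder_cont hm e3.
have B : 0 < 8 * C + 1 by lra.
exists (Num.min (Num.min 1 (e / 3 / (8 * C + 1))) (Num.min d1 d2)).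
  by rewrite !lt_min ltr01 d10 d20 !divr_gt0.
move=> u v; rewrite !lt_min => /andP[/andP[u1 u2] _] /andP[/andP[v1 _] /andP[v3 v4]].
have := h1 v v3 => q1.
have q2 : nc (g (s + v) - g s) <= e / 3 by apply/ltW/h2; rewrite addrAC subrr add0r.
have q3 := quad u v (ltW u1) (ltW v1).
rewrite (_ : _ - _ - _ = (H (x + u) (s + v) i j - H x (s + v) i j - g (s + v) * u)
   + ((g (s + v) - g s) * u + (H x (s + v) i j - H x s i j - l * v))); last by ring.
apply: le_trans (ncD _ _) _; apply: le_trans (lerD (lexx _) (ncD _ _)) _; rewrite (ncM _ u).
have u0 := nc_ge0 u; have v0 := nc_ge0 v.
have q4 : nc (g (s + v) - g s) * nc u <= e / 3 * nc u by rewrite ler_wpM2r.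
have q5 : 8 * C * nc u ^+ 2 <= e / 3 * nc u.
  rewrite expr2 mulrA ler_wpM2r//; move: u2; rewrite ltr_pdivlMr// => u2; nra.
have e0' := ltW e0; nra.
Qed.

Lemma coef_mulmx (F G : CC R -> mx) n : mentire F -> mentire G ->
  \matrix_(i, j) coef n (fun s => (F s *m G s) i j) =
  psmul (fun k => \matrix_(i, j) coef k (fun s => F s i j))
        (fun k => \matrix_(i, j) coef k (fun s => G s i j)) n.
Proof.
move=> hF hG; apply/matrixP => i j; rewrite mxE summxE.
rewrite (_ : (fun s => _) = fun s => \sum_k F s i k * G s k j); last by apply/funext => s;
  rewrite mxE.
rewrite coef_sum; last by move=> k; exact: entireM.
under eq_bigr do rewrite coefM//.
rewrite exchange_big /=; apply: eq_bigr => k _; rewrite mxE; apply: eq_bigr => l _.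
by rewrite !mxE.
Qed.

Lemma taylor_Psol (F : CC R -> CC R -> mx) t n : mentire (F (cexp t)) ->
  taylor (Psol Q F) t n =
  psmul (fun k => \matrix_(i, j) coef k (fun s => F (cexp t) s i j)) (expcoef M t) n.
Proof.
move=> hF; have hE : mentire (fun s => expm (- (s * t) *: M)).
  by move=> i j; exact: psum_entire (psum_expm M t i j).
rewrite /taylor -[LHS]/(\matrix_(i, j) coef n (fun s => (F (cexp t) s *m expm (- (s * t) *:
  M)) i j)).
rewrite coef_mulmx//; apply: eq_psmul => // k; apply/matrixP => i j; rewrite mxE.
exact: psum_coef (psum_expm M t i j).
Qed.

Lemma taylor_gauge : taylor (Psol Q H) = formal_sol Q h.
Proof.
apply/funext => t; apply/funext => n; rewrite taylor_Psol; last exact: gauge_entire.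
apply: eq_psmul => // k; apply/matrixP => i j; rewrite mxE.
exact: psum_coef (hH _ i j).
Qed.

End GaugeTransformation.

(** * Uniqueness of the normalised gauge transformation *)

Section Uniqueness.
Variables (R : realType) (mu : nat) (Q : qds_data R mu).
Hypotheses (hQ : log_qds Q) (hflat : flat_qds Q).
Variables (h : nat -> CC R -> 'M[CC R]_mu) (H : CC R -> CC R -> 'M[CC R]_mu).
Hypothesis hh : gauge_sol (M1 Q) h.
Hypothesis hH : forall x i j, psum (fun n => h n x i j) (fun s => H x s i j).
Local Notation mx := 'M[CC R]_mu.
Local Notation M := (M1 Q 0).

Lemma coef_cst n (c : CC R) : coef n (fun=> c) = if n is 0%N then c else 0.
Proof.
have z : psum (fun=> 0) (fun=> 0 : CC R).
  have := psumZ 0 (entire_coef (entire_cst (0 : CC R))).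
  by apply: psum_ext => ?; rewrite mul0r.
have := psum_cons c z; rewrite (_ : (fun s : CC R => _) = fun=> c).
  by move/(psum_coef n) => ->; case: n.
by apply/funext => s; rewrite mulr0 addr0.
Qed.

Lemma holo2_entire (F : CC R -> CC R -> mx) r x : holo2 [set p | disc r p.1] F ->
  disc r x -> mentire (F x).
Proof.
move=> hF xr i j s.
have d1 := hF (x, s) xr i j.
have d2 : differentiable (fun t : CC R => (x, t)) s.
  by apply: differentiable_pair; [exact: differentiable_cst|apply/derivable1_diffP;
    exact: derivable_id].
have /derivable1_diffP d3 := differentiable_comp d2 d1.
by eexists; exact: derivable_cder d3.
Qed.

(** Cauchy's estimate bounds a coefficient in tau by values on the unit circle. That circle is
    compact, so continuity of F at the points of {0} x circle passes to every coefficient. *)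
Lemma holo2_coef_lim (F : CC R -> CC R -> mx) r n i j : (0 < r)%E ->
  holo2 [set p | disc r p.1] F -> (forall s, F 0 s = 1%:M) ->
  forall e : R, 0 < e -> exists2 d : R, 0 < d & forall x, disc r x -> nc x < d ->
    nc (coef n (fun s => F x s i j) - @ps1 R mu n i j) <= e.
Proof.
move=> r0 hF F0 e e0; have e2 : 0 < e / 2 by rewrite divr_gt0.
have d0 : disc r (0 : CC R) by apply/discE; rewrite nc0.
have [|d dpos hd] := (nbhs_CCP _ _).1 (@tube_segment R (CC R) 0 (fun x a => F x (cis a) i
  j) 0 (pi *+ 2) (e / 2) _ e2).
  move=> a _ k k0.
  have /differentiable_continuous ct := hF (0, cis a) d0 i j.
  have [[U V] /= [hU hV] UV] : nbhs (0 : CC R,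
    cis a : CC R) [set q | nc (F q.1 q.2 i j - F 0 (cis a) i j) < k].
    by apply: (ct [set w | nc (w - F 0 (cis a) i j) < k]); apply/nbhs_CCP; exists k.
  have /nbhs_CCP[t t0 ht] := hV; have [t' t'0 ht'] := rcont_cis a t0.
  exists ([set b | `|b - a| < t'], U); first by split=> //; apply/nbhs_RP; exists t'.
  by move=> -[b x] /= [/ht' bt Ux]; apply: (UV (x, cis b)); split=> //; exact: ht.
exists d => // x xr xd.
have eF : entire (fun s => F x s i j) := holo2_entire hF xr i j.
have -> : @ps1 R mu n i j = coef n (fun=> (1%:M : mx) i j).
  by rewrite coef_cst; case: (n) => [|k] //=; rewrite mxE.
have -> : coef n (fun s => F x s i j) - coef n (fun=> (1%:M : mx) i j) =
    coef n (fun s => F x s i j + - (1%:M : mx) i j).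
  by rewrite coefD ?coef_cst//; [case: (n) => [|k] //; rewrite oppr0|exact: entire_cst].
have := @entire_cauchy _ (fun s => F x s i j + - (1%:M : mx) i j) n 1 (e / 2)
  (entireD eF (entire_cst _)) ltr01.
rewrite expr1n mulr1 [2 * _]mulrC divfK//; apply => a ha.
by rewrite mul1r ltW// -(F0 (cis a)); apply: hd; rewrite ?subr0.
Qed.

Lemma nc_small (z : CC R) : (forall e : R, 0 < e -> nc z <= e) -> z = 0.
Proof.
move=> hz; apply/eqP; rewrite -nc_eq0; apply: contraT => nz.
have z0 : 0 < nc z by rewrite lt_def nz nc_ge0.
have := hz (nc z / 2); rewrite divr_gt0// => /(_ isT); lra.
Qed.

Lemma gauge_unique r (F : CC R -> CC R -> mx) : (0 < r)%E -> normalized_H Q r F ->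
  forall x, disc r x -> forall s, F x s = H x s.
Proof.
move=> r0 [hF F0 fundF].
pose f n x : mx := \matrix_(i, j) coef n (fun s => F x s i j).
have eF x : disc r x -> mentire (F x) by exact: holo2_entire.
have TE t : logdisc r t -> forall n,
  taylor (Psol Q F) t n = psmul (f ^~ (cexp t)) (expcoef M t) n.
  by move=> ht n; rewrite taylor_Psol//; exact: eF.
have key n t : logdisc r t -> f n (cexp t) = h n (cexp t).
  elim/ltn_ind: n t => n ih t ht.
  pose G t := taylor (Psol Q F) t n - formal_sol Q h t n.
  (* The orders below n agree by induction and the exponential has constant coefficient 1, so only
     the terms of order n of F and H survive, which depend on x = cexp u alone. *)
  have GE u : logdisc r u -> G u = f n (cexp u) - h n (cexp u).
    move=> hu; rewrite /G TE// /formal_sol /psmul !big_ord_recr /= subnn expcoef0 !mulmx1.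
    rewrite (eq_bigr (fun i : 'I_n => h i (cexp u) *m expcoef M u (n - i)%N)); last first.
      by move=> i _; rewrite ih.
    by rewrite [X in X - _]addrC addrKA.
  have dG u : logdisc r u -> mder G u 0.
    move=> hu; have := mderB (fundamental_der fundF hu n) (formal_sol_ode hh n u).
    have -> : pstau (taylor (Psol Q F) u) n = pstau (formal_sol Q h u) n.
      case: n ih {G GE} => [//|n] ih /=; rewrite TE// /formal_sol; apply: eq_bigr => i _.
      by rewrite ih.
    by rewrite subrr.
  apply/eqP; rewrite -subr_eq0 -GE//; apply/eqP/matrixP => i j; rewrite [RHS]mxE.
  apply: nc_small => e e0; have e2 : 0 < e / 2 by rewrite divr_gt0.
  have [d1 d10 h1] := holo2_coef_lim n i j r0 hF F0 e2.
  have he : entire (fun x => h n x i j) by case: hh => _ he _ _; exact: he.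
  have [l hl] := he 0.
  have [d2 d20 h2] := cder_cont hl e2.
  have hn0 : h n 0 = @ps1 R mu n by case: hh => h0 _ hS _; case: (n) => [|k].
  pose d := Num.min d1 d2 / 2.
  have d0 : 0 < d by rewrite divr_gt0// lt_min d10.
  (* Moving t to the left stays in the half-plane, does not change [G], and makes x = cexp u as
     small as required. *)
  pose u : CC R := Complex (Num.min (complex.Re t) (ln d)) (complex.Im t).
  have hu : logdisc r u by apply: logdisc_le ht; rewrite ge_min lexx.
  have ud : nc (cexp u) < Num.min d1 d2.
    rewrite nc_cexp; apply: (@le_lt_trans _ _ d).
      by rewrite -[leRHS]lnK ?posrE// ler_expR ge_min lexx orbT.
    by rewrite /d ltr_pdivrMr// ltr_pMr ?ltr1n// lt_min d10.
  move: ud; rewrite lt_min => /andP[ud1 ud2].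
  have -> : G t = G u by exact: (logdisc_const dG hu ht).
  rewrite GE// mxE [X in _ + X]mxE.
  have q1 := h1 _ hu ud1.
  have q2 : nc (h n (cexp u) i j - @ps1 R mu n i j) < e / 2.
    by rewrite -hn0; apply: h2; rewrite subr0.
  rewrite mxE (_ : _ - _ = (coef n (fun s => F (cexp u) s i j) - @ps1 R mu n i j)
     - (h n (cexp u) i j - @ps1 R mu n i j)); last by ring.
  by apply: le_trans (ncB _ _) _; lra.
move=> x xr s; have [->|x0] := eqVneq x 0.
  by rewrite F0 (gauge_at0 hh hH).
apply/matrixP => i j; have [t tx] := cexp_surj x0.
have ht : logdisc r t by rewrite /logdisc /= tx.
apply: (entire_coef_inj (eF x xr i j) (gauge_entire hH x i j)) => n.
rewrite (psum_coef n (hH x i j)); have := key n t ht.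
by rewrite tx => /matrixP/(_ i j); rewrite mxE.
Qed.

End Uniqueness.

(** * The Leibniz rule of the pairing in the direction of tau *)

Section Leibniz.
Variables (R : realType) (mu : nat) (Q : qds_data R mu).
Hypotheses (hQ : log_qds Q) (hflat : flat_qds Q).
Local Notation mx := 'M[CC R]_mu.
Local Notation eta := (gram Q 0).

(** The contributions of N1 cancel because it is self-adjoint and the second factor is taken at - s;
    the skewness of N0 up to weight leaves the degree. *)
Lemma contau_sym x s : (contau Q x s)^T *m eta +
  eta *m contau Q x (- s) = - (deg Q)%:~R *: eta.
Proof.
rewrite -(N0_antisym hQ hflat) /contau (N0_const hQ hflat).
have -> : (N0 Q 0 + s *: N1 Q x)^T = (N0 Q 0)^T + s *: (N1 Q x)^T.
  by apply/matrixP => k l; rewrite !mxE.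
rewrite scaleNr mulmxDl mulmxBr -scalemxAl -scalemxAr (N1_sym hQ hflat).
by rewrite addrACA subrr addr0.
Qed.

(** By the product rule, valid for any frame entire in tau: the derivative of (1 / tau)^deg is
    exactly compensated by the weight in [contau_sym]. *)
Lemma pairing_leibniz (P : CC R -> CC R -> mx) t s i j : mentire (P t) -> s != 0 ->
  let e j t s := col j (P t s) in
  s * derive1 (pairing Q (@cexp R) (e i) (e j) t) s =
    pairing Q (@cexp R) (nabla_tau Q (@cexp R) (e i)) (e j) t s
    + pairing Q (@cexp R) (e i) (nabla_tau Q (@cexp R) (e j)) t s.
Proof.
move=> hP s0 e.
pose D := dmx (P t); have dP z : mder (P t) z (D z) := mentire_mder z hP.
have nt k z : nabla_tau Q (@cexp R) (e k) t z =
    (z *: D z + contau Q (cexp t) z *m P t z) *m delta_mx k 0.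
  rewrite /nabla_tau /e.
  have -> : (fun z => col k (P t z)) = fun z => P t z *m delta_mx k 0.
    by apply/funext => w; rewrite colE.
  rewrite (mder_dmx (mderM (dP z) (mder_cst _ z))) mulmx0 addr0 colE.
  by rewrite [RHS]mulmxDl -scalemxAl mulmxA.
have sd : (s^-1) ^ deg Q != 0 by rewrite expfz_neq0// invr_eq0.
rewrite /pairing !nt /e !colE !pair_col (gram_const hQ hflat).
have -> : (fun z => (z^-1) ^ deg Q * ((col i (P t z))^T *m eta *m col j (P t (- z))) ord0 ord0)
   = fun z => (z^-1) ^ deg Q * ((P t z)^T *m eta *m P t (- z)) i j.
  by apply/funext => z; rewrite !colE pair_col.
have dN : cder (fun z : CC R => - z) s (-1) by exact: cderN (cder_id s).
have d1 := mderM (mderM (mder_tr (dP s)) (mder_cst eta s)) (mder_comp (dP (- s)) dN).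
have d2 := cderM (cder_exprzV (deg Q) s0) (d1 i j).
rewrite (cder_derive1 d2).
rewrite -mulrDr mulmx0 addr0.
have E : ((s *: D s + contau Q (cexp t) s *m P t s)^T *m eta *m P t (- s)) i j +
  ((P t s)^T *m eta *m (- s *: D (- s) + contau Q (cexp t) (- s) *m P t (- s))) i j =
  s * ((D s)^T *m eta *m P t (- s) + (P t s)^T *m eta *m (-1 *: D (- s))) i j
  - (deg Q)%:~R * ((P t s)^T *m eta *m P t (- s)) i j.
  have C : (P t s)^T *m ((contau Q (cexp t) s)^T *m eta +
    eta *m contau Q (cexp t) (- s)) *m P t (- s)
    = - (deg Q)%:~R *: ((P t s)^T *m eta *m P t (- s)).
    by rewrite contau_sym -scalemxAr -scalemxAl.
  rewrite -mulNr; move/matrixP: C => /(_ i j); rewrite [RHS]mxE => <-.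
  have -> : (s *: D s + contau Q (cexp t) s *m P t s)^T =
     s *: (D s)^T + (P t s)^T *m (contau Q (cexp t) s)^T.
    by rewrite -trmx_mul; apply/matrixP => k l; rewrite !mxE.
  move: (contau Q (cexp t) s) (contau Q (cexp t) (- s)) (D s) (D (- s)) (P t s) (P t (- s)).
  move=> c c' d d' p p'.
  rewrite scaleN1r scaleNr !(mulmxDl, mulmxDr, mulmxBl, mulmxBr, mulmxN, mulNmx, mulmxA).
  rewrite -?scalemxAl -?scalemxAr; mulmx_atoms; rewrite !mxE; ring.
rewrite E; field; exact: s0.
Qed.

End Leibniz.

Theorem theorem6p3p4 (R : realType) (mu : nat) (Q : qds_data R mu)
    (hQ : log_qds Q) (hflat : flat_qds Q) :
  exists (r : \bar R) (H : CC R -> CC R -> 'M[CC R]_mu),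
    let P : CC R -> CC R -> 'M[CC R]_mu := Psol Q H in
    let e (j : 'I_mu) (t tau : CC R) : 'cV[CC R]_mu := col j (P t tau) in
    (0 < r)%E /\
    [/\ normalized_H Q r H /\
        (forall (r' : \bar R) (H' : CC R -> CC R -> 'M[CC R]_mu),
           (0 < r')%E -> normalized_H Q r' H' ->
           forall x : CC R, disc r x -> disc r' x ->
           forall tau : CC R, H' x tau = H x tau),
        (forall (r' : \bar R) (F : CC R -> pser R mu),
           (0 < r')%E -> fundamental Q r' F ->
           exists Pcl : pser R mu,
             forall t : CC R, logdisc r t -> logdisc r' t ->
             forall n : nat, F t n = psmul (taylor P t) Pcl n),
        base_change Q r (taylor P)
          (fun _ _ => 0) (fun _ => nth 0 [:: N0 Q 0; N1 Q 0]),
        symmetric_sol Q r (taylor P) /\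
        (forall (i j : 'I_mu) (t tau : CC R), logdisc r t -> tau != 0 ->
           tau * derive1 (pairing Q (@cexp R) (e i) (e j) t) tau =
             pairing Q (@cexp R) (nabla_tau Q (@cexp R) (e i)) (e j) t tau
             + pairing Q (@cexp R) (e i) (nabla_tau Q (@cexp R) (e j)) t tau) &
        (forall c : CC R, c != 0 -> M1 Q 0 = c *: N1 Q 0 ->
           conformal_sol Q r (taylor P))].
Proof.
have [h hh] := gauge_sol_ex (entire_M1 hQ).
have [H hH] := gauge_ex hQ hflat hh.
exists +oo%E, H => P e; have TP : taylor P = formal_sol Q h := taylor_gauge Q hH.
split; first exact: ltey.
split.
- split; first split.
  + exact: (gauge_holo2 hQ hflat hh hH).
  + by move=> s; exact: (gauge_at0 hh hH s).
  + by rewrite -/P TP; exact: fundamental_formal.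
  by move=> r' H' r0 nH x _ xr s; exact: (gauge_unique hh hH r0 nH xr s).
- rewrite TP => r' F _ /(fundamental_unique hQ hflat hh)[Pcl hP].
  by exists Pcl => t _ ht n; exact: hP.
- by rewrite TP; exact: formal_base_change.
- split; first by rewrite TP; exact: formal_symmetric.
  move=> i j t s _ s0; apply: (pairing_leibniz hQ hflat) => //.
  apply: mentireM; first exact: (gauge_entire hH).
  by move=> k l; exact: psum_entire (psum_expm (M1 Q 0) t k l).
- by rewrite TP => c c0 Mc; exact: formal_conformal Mc.
Qed.
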